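(* Let $Q$ be a simply laced quiver, let $\Delta=(A,M)$ be a $Q$-set all of whose composition maps $\alpha$ are zero, and let $\Lambda_\Delta=A\oplus M$ be the corresponding $k$-algebra arising from a $k$-category with zero compositions. There is a cohomology long exact sequence $$0\to \mathsf{HH}^0(\Lambda_\Delta)\to \mathsf{HH}^0(A)\to \mathsf{End}_{A-A}M\to \mathsf{HH}^1(\Lambda_\Delta)\to \mathsf{HH}^1(A)\to \bigoplus_{\delta\in DQ_{\leq 2}}\mathsf{H}^2_\delta(\Delta)\to \mathsf{HH}^2(\Lambda_\Delta)\to \mathsf{HH}^2(A)\oplus\bigoplus_{\gamma\in CQ_2}\mathsf{H}^2_\gamma(\Delta)\to\cdots$$ $$\cdots\to\bigoplus_{\delta\in DQ_{\leq n}}\mathsf{H}^n_\delta(\Delta)\to \mathsf{HH}^n(\Lambda_\Delta)\to \mathsf{HH}^n(A)\oplus\bigoplus_{\gamma\in CQ_{\leq n},\ \gamma\notin Q_0}\mathsf{H}^n_\gamma(\Delta)\to\bigoplus_{\delta\in DQ_{\leq n+1}}\mathsf{H}^{n+1}_\delta(\Delta)\to\cdots$$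
   Context: $k$ is a field; algebras are nonzero associative unital $k$-algebras, not necessarily finite dimensional; $\otimes=\otimes_k$; $\mathsf{HH}^n(\Lambda)=\mathsf{Ext}^n_{\Lambda\otimes\Lambda^{op}}(\Lambda,\Lambda)$; $\mathsf{End}_{A-A}$ denotes endomorphisms of $A$-bimodules. **$Q$-sets.** A (finite) quiver $Q$ has a finite set $Q_0$ of vertices, a finite set $Q_1$ of arrows and source and target maps $s,t:Q_1\to Q_0$. It is simply laced if it has no loops and at most one arrow from any vertex to any other. A $Q$-set $\Delta$ consists of an algebra $A_x$ for each $x\in Q_0$; a nonzero $A_{t(a)}$-$A_{s(a)}$-bimodule $M_a={}_{t(a)}M_{s(a)}$ for each $a\in Q_1$ (put ${}_yM_x=0$ if $x\ne y$ and there is no arrow from $x$ to $y$, and ${}_xM_x=A_x$); and bimodule maps $\alpha_{z,y,x}:{}_zM_y\otimes_{A_y}{}_yM_x\to{}_zM_x$ for $x\neq y\neq z$ satisfying the associativity constraints. Put $A=\times_{x}A_x$, $M=\oplus_{a}M_a$ (an $A$-bimodule, actions extended by zero). $\Lambda_\Delta=A\oplus M$ is the algebra whose product is given by the product of $A$, the bimodule structure of $M$, and the maps $\alpha$ on $M\times M$. If all maps $\alpha$ are zero (so $M^2=0$), $\Lambda_\Delta$ is said to arise from a $k$-category with zero compositions. Let $e_x$ be the unit of $A_x$. **Paths and trajectories.** A path of length $m>0$ is $\omega=a_m\cdots a_1$ with $a_i\in Q_1$, $t(a_i)=s(a_{i+1})$; $s(\omega)=s(a_1)$, $t(\omega)=t(a_m)$.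 Vertices are the paths of length $0$. $Q_m$ is the set of paths of length $m$. A path is a cycle if $s(\omega)=t(\omega)$ (so vertices are cycles); $CQ_m$ and $DQ_m$ are the sets of cycles and of non cycles of length $m$; the subscript $\leq n$ means length at most $n$. For a path $\omega$, $\Delta_\omega=e_{t(\omega)}\Lambda_\Delta e_{s(\omega)}$. A trajectory of duration $n$ over $\omega=a_m\cdots a_1$ is a sequence $\tau=t(a_m)^{p_{m+1}},a_m,s(a_m)^{p_m},\dots,s(a_2)^{p_2},a_1,s(a_1)^{p_1}$ with integers $p_i\ge0$ (waiting times) and $n=m+\sum_ip_i$; $x^p$ means $x$ repeated $p$ times. For a vertex $x$, the only trajectory of duration $n$ over $x$ is $x^n$. $T_n(\omega)$ is the set of trajectories of duration $n$ over $\omega$. Put $\tau_\Delta=A_{t(a_m)}^{\otimes p_{m+1}}\otimes M_{a_m}\otimes A_{s(a_m)}^{\otimes p_m}\otimes\cdots\otimes M_{a_1}\otimes A_{s(a_1)}^{\otimes p_1}$, and $(x^n)_\Delta=A_x^{\otimes n}$ (with $A_x^{\otimes0}=k$). $\tau_0^+$ is the set of trajectories of duration $n+1$ obtained from $\tau\in T_n(\omega)$ by increasing one waiting time by one. **Cohomology along a path.** For $\omega\in Q_m$ and $n\ge m$, $\mathsf{H}^n_\omega(\Delta)$ is the degree $n$ cohomology of the complex $(\mathsf K^\bullet_\omega,\mathsf d)$ with $\mathsf K_\omega^n=\bigoplus_{\tau\in T_n(\omega)}\mathsf{Hom}_k(\tau_\Delta,\Delta_\omega)$ and $\mathsf d f_\tau=\sum_{\sigma\in\tau_0^+}(df_\tau)_\sigma$,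 where $(df_\tau)_\sigma$ is the restriction to $\sigma_\Delta$ of the Hochschild coboundary $x_1f_\tau(x_2\otimes\cdots\otimes x_{n+1})+\sum_{i=1}^n(-1)^if_\tau(x_1\otimes\cdots\otimes x_ix_{i+1}\otimes\cdots\otimes x_{n+1})+(-1)^{n+1}f_\tau(x_1\otimes\cdots\otimes x_n)x_{n+1}$ (products in $\Lambda_\Delta$; $f_\tau$ is extended by zero to $\tau'_\Delta$ for $\tau'\neq\tau$; for $z\in\mathsf K^0_x=A_x$, $(dz)(a)=az-za$). *)

(* Defs.v *)
From HB Require Import structures.
From mathcomp Require Import all_boot all_algebra ssrAC.
From mathcomp Require Import boolp functions.

Set Implicit Arguments.
Unset Strict Implicit.
Unset Printing Implicit Defensive.

Import GRing.Theory.
Local Open Scope ring_scope.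
Local Open Scope quotient_scope.

Section Subspace.
Variables (k : fieldType) (V : lmodType k) (S : submodClosed V).

Record subspace := Subspace { subspace_val :> V; _ : subspace_val \in S }.

HB.instance Definition _ := [isSub for subspace_val].
HB.instance Definition _ := [Choice of subspace by <:].
HB.instance Definition _ := [SubChoice_isSubLmodule of subspace by <:].

(* submodClosed does not inherit from zmodClosed. *)
Definition submod_zmod : {pred V} := fun x => x \in S.

Fact submod_zmod_closed : zmod_closed submod_zmod.
Proof.
split=> [|x y Sx Sy]; rewrite unfold_in; first exact: rpred0.
by rewrite rpredD // -scaleN1r rpredZ.
Qed.

HB.instance Definition _ :=
  GRing.isZmodClosed.Build V submod_zmod submod_zmod_closed.

Definition quotspace := Quotient.quot submod_zmod.

HB.instance Definition _ := EqQuotient.on quotspace.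
HB.instance Definition _ := ZmodQuotient.on quotspace.

Definition quotspace_scale (c : k) (x : quotspace) : quotspace :=
  \pi_quotspace (c *: repr x).

Lemma pi_quotspace_scale (c : k) (v : V) :
  quotspace_scale c (\pi_quotspace v) = \pi_quotspace (c *: v).
Proof.
apply/eqP; rewrite -[_ == _]/(_ == _ %[mod quotspace]) -Quotient.idealrBE.
rewrite -scalerBr unfold_in rpredZ // -[_ \in S]/(_ \in submod_zmod).
by rewrite Quotient.idealrBE reprK.
Qed.

Lemma pi_quotspaceD (u v : V) :
  \pi_quotspace u + \pi_quotspace v = \pi_quotspace (u + v).
Proof. exact: (esym (Quotient.pi_add submod_zmod u v)). Qed.

Fact quotspace_scaleA c d x :
  quotspace_scale c (quotspace_scale d x) = quotspace_scale (c * d) x.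
Proof.
elim/quotW: x => v; rewrite [quotspace_scale d _]pi_quotspace_scale.
by rewrite (pi_quotspace_scale c) (pi_quotspace_scale (c * d)) scalerA.
Qed.

Fact quotspace_scale1 : left_id 1 quotspace_scale.
Proof. by elim/quotW=> v; rewrite (pi_quotspace_scale 1) scale1r. Qed.

Fact quotspace_scaleDr : right_distributive quotspace_scale +%R.
Proof.
move=> c; elim/quotW=> u; elim/quotW=> v.
rewrite pi_quotspaceD (pi_quotspace_scale c (u + v)).
by rewrite (pi_quotspace_scale c u) (pi_quotspace_scale c v) pi_quotspaceD scalerDr.
Qed.

Fact quotspace_scaleDl x : {morph quotspace_scale^~ x : c d / c + d}.
Proof.
elim/quotW: x => v c d; rewrite (pi_quotspace_scale (c + d)) scalerDl.
by rewrite (pi_quotspace_scale c) (pi_quotspace_scale d) pi_quotspaceD.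
Qed.

HB.instance Definition _ := GRing.Zmodule_isLmodule.Build k quotspace
  quotspace_scaleA quotspace_scale1 quotspace_scaleDr quotspace_scaleDl.

End Subspace.

Section Subquotient.
Variables (k : fieldType) (V : lmodType k) (Z B : submodClosed V).

Definition sub_pullback : {pred subspace Z} := fun x => val x \in B.

Fact sub_pullback_closed : submod_closed sub_pullback.
Proof.
split=> [|c x y Bx By]; rewrite /sub_pullback unfold_in; first exact: rpred0.
by rewrite linearP rpredD ?rpredZ.
Qed.

HB.instance Definition _ :=
  GRing.isSubmodClosed.Build k (subspace Z) sub_pullback sub_pullback_closed.

(* Z / (Z :&: B). *)
Definition subquotient : lmodType k := quotspace sub_pullback.

End Subquotient.

(* When I is finite this is also the direct sum of the T i. *)
Definition prodspace (I : Type) (T : I -> Type) : Type := forall i, T i.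

Section ProdSpace.
Variables (k : fieldType) (I : Type) (T : I -> lmodType k).
Implicit Types x y z : prodspace T.

HB.instance Definition _ := gen_eqMixin (prodspace T).
HB.instance Definition _ := gen_choiceMixin (prodspace T).

Definition prodspace_zero : prodspace T := fun=> 0.
Definition prodspace_opp x : prodspace T := fun i => - x i.
Definition prodspace_add x y : prodspace T := fun i => x i + y i.
Definition prodspace_scale (c : k) x : prodspace T := fun i => c *: x i.

Fact prodspace_addA : associative prodspace_add.
Proof. by move=> x y z; apply: functional_extensionality_dep => i; apply: addrA. Qed.
Fact prodspace_addC : commutative prodspace_add.
Proof. by move=> x y; apply: functional_extensionality_dep => i; apply: addrC. Qed.
Fact prodspace_add0 : left_id prodspace_zero prodspace_add.
Proof. by move=> x; apply: functional_extensionality_dep => i; apply: add0r. Qed.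
Fact prodspace_addN : left_inverse prodspace_zero prodspace_opp prodspace_add.
Proof. by move=> x; apply: functional_extensionality_dep => i; apply: addNr. Qed.

HB.instance Definition _ := GRing.isZmodule.Build (prodspace T)
  prodspace_addA prodspace_addC prodspace_add0 prodspace_addN.

Fact prodspace_scaleA c d x : prodspace_scale c (prodspace_scale d x) = prodspace_scale (c * d) x.
Proof. by apply: functional_extensionality_dep => i; apply: scalerA. Qed.
Fact prodspace_scale1 : left_id 1 prodspace_scale.
Proof. by move=> x; apply: functional_extensionality_dep => i; apply: scale1r. Qed.
Fact prodspace_scaleDr : right_distributive prodspace_scale +%R.
Proof. by move=> c x y; apply: functional_extensionality_dep => i; apply: scalerDr. Qed.
Fact prodspace_scaleDl x : {morph prodspace_scale^~ x : c d / c + d}.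
Proof. by move=> c d; apply: functional_extensionality_dep => i; apply: scalerDl. Qed.

HB.instance Definition _ := GRing.Zmodule_isLmodule.Build k (prodspace T)
  prodspace_scaleA prodspace_scale1 prodspace_scaleDr prodspace_scaleDl.

End ProdSpace.

Reserved Notation "a *> m" (at level 40, left associativity).
Reserved Notation "m <* b" (at level 40, left associativity).

(* An A-B-bimodule: k acts centrally, i.e. these are the A (x) B^op-modules. *)
Record bimod (k : fieldType) (A B : algType k) := Bimod {
  bmod :> lmodType k;
  lact : A -> bmod -> bmod;
  ract : bmod -> B -> bmod;
  lact_linl : forall m, linear (lact^~ m);
  lact_linr : forall a, linear (lact a);
  ract_linl : forall b, linear (ract^~ b);
  ract_linr : forall m, linear (ract m);
  lact1 : forall m, lact 1 m = m;
  lactA : forall a a' m, lact (a * a') m = lact a (lact a' m);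
  ract1 : forall m, ract m 1 = m;
  ractA : forall m b b', ract m (b * b') = ract (ract m b) b';
  lractA : forall a m b, ract (lact a m) b = lact a (ract m b)
}.

Notation "a *> m" := (lact a m) : ring_scope.
Notation "m <* b" := (ract m b) : ring_scope.

Section BimoduleTheory.
Variables (k : fieldType) (A B : algType k) (X : bimod A B).
Implicit Types (c : k) (a : A) (b : B) (m n : X).

Lemma lactDl a a' m : (a + a') *> m = a *> m + a' *> m.
Proof. by have := lact_linl m 1 a a'; rewrite !scale1r. Qed.
Lemma lactDr a m n : a *> (m + n) = a *> m + a *> n.
Proof. by have := lact_linr a 1 m n; rewrite !scale1r. Qed.
Lemma ractDl m n b : (m + n) <* b = m <* b + n <* b.
Proof. by have := ract_linl b 1 m n; rewrite !scale1r. Qed.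
Lemma ractDr m b b' : m <* (b + b') = m <* b + m <* b'.
Proof. by have := ract_linr m 1 b b'; rewrite !scale1r. Qed.
Lemma lact0m m : 0 *> m = 0.
Proof. by apply: (@addrI _ (0 *> m)); rewrite -lactDl !addr0. Qed.
Lemma lactm0 a : a *> (0 : X) = 0.
Proof. by apply: (@addrI _ (a *> 0)); rewrite -lactDr !addr0. Qed.
Lemma ract0m b : (0 : X) <* b = 0.
Proof. by apply: (@addrI _ (0 <* b)); rewrite -ractDl !addr0. Qed.
Lemma ractm0 m : m <* 0 = 0.
Proof. by apply: (@addrI _ (m <* 0)); rewrite -ractDr !addr0. Qed.
Lemma lactZl c a m : (c *: a) *> m = c *: (a *> m).
Proof. by have := lact_linl m c a 0; rewrite lact0m !addr0. Qed.
Lemma lactZr c a m : a *> (c *: m) = c *: (a *> m).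
Proof. by have := lact_linr a c m 0; rewrite lactm0 !addr0. Qed.
Lemma ractZl c m b : (c *: m) <* b = c *: (m <* b).
Proof. by have := ract_linl b c m 0; rewrite ract0m !addr0. Qed.
Lemma ractZr c m b : m <* (c *: b) = c *: (m <* b).
Proof. by have := ract_linr m c b 0; rewrite ractm0 !addr0. Qed.
End BimoduleTheory.

Section RegularBimodule.
Variables (k : fieldType) (A : algType k).

Fact reg_linl (m : A) : linear (fun a : A => a * m).
Proof. by move=> c x y; rewrite mulrDl scalerAl. Qed.
Fact reg_linr (a : A) : linear (fun m : A => a * m).
Proof. by move=> c x y; rewrite mulrDr scalerAr. Qed.

Definition regular : bimod A A :=
  @Bimod k A A A (fun a m => a * m) (fun m b => m * b)
    reg_linl reg_linr reg_linl reg_linr (@mul1r A)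
    (fun a a' m => esym (mulrA a a' m)) (@mulr1 A) (@mulrA A)
    (fun a m b => esym (mulrA a m b)).
End RegularBimodule.

Section BimoduleSum.
Variables (k : fieldType) (A B : algType k) (X Y : bimod A B).

Definition bisum_lact (a : A) (m : X * Y) : X * Y := (a *> m.1, a *> m.2).
Definition bisum_ract (m : X * Y) (b : B) : X * Y := (m.1 <* b, m.2 <* b).

Fact bisum_lact_linl m : linear (bisum_lact^~ m).
Proof. by move=> c x y; congr pair; apply: lact_linl. Qed.
Fact bisum_lact_linr a : linear (bisum_lact a).
Proof. by move=> c x y; congr pair; apply: lact_linr. Qed.
Fact bisum_ract_linl b : linear (bisum_ract^~ b).
Proof. by move=> c x y; congr pair; apply: ract_linl. Qed.
Fact bisum_ract_linr m : linear (bisum_ract m).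
Proof. by move=> c x y; congr pair; apply: ract_linr. Qed.
Fact bisum_lact1 m : bisum_lact 1 m = m.
Proof. by case: m => x y; rewrite /bisum_lact !lact1. Qed.
Fact bisum_lactA a a' m : bisum_lact (a * a') m = bisum_lact a (bisum_lact a' m).
Proof. by rewrite /bisum_lact !lactA. Qed.
Fact bisum_ract1 m : bisum_ract m 1 = m.
Proof. by case: m => x y; rewrite /bisum_ract !ract1. Qed.
Fact bisum_ractA m b b' : bisum_ract m (b * b') = bisum_ract (bisum_ract m b) b'.
Proof. by rewrite /bisum_ract !ractA. Qed.
Fact bisum_lractA a m b : bisum_ract (bisum_lact a m) b = bisum_lact a (bisum_ract m b).
Proof. by rewrite /bisum_ract /bisum_lact !lractA. Qed.

Definition bisum : bimod A B :=
  @Bimod k A B (X * Y)%type bisum_lact bisum_ract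
    bisum_lact_linl bisum_lact_linr bisum_ract_linl bisum_ract_linr
    bisum_lact1 bisum_lactA bisum_ract1 bisum_ractA bisum_lractA.
End BimoduleSum.

Section BimoduleHom.
Variables (k : fieldType) (A B : algType k).

Definition bihom (X Y : bimod A B) (f : X -> Y) : Prop :=
  [/\ linear f, forall a x, f (a *> x) = a *> f x
    & forall x b, f (x <* b) = f x <* b].

Definition bihoms (X Y : bimod A B) : {pred X -> Y} := fun f => `[< bihom f >].

Fact bihoms_closed X Y : submod_closed (@bihoms X Y).
Proof.
split=> [|c f g /asboolP[lf af bf] /asboolP[lg ag bg]]; apply/asboolP.
  split=> [d x y|a x|x b]; first by rewrite -[RHS]/(d *: 0 + 0) scaler0 addr0.
  - by rewrite -[RHS]/(a *> 0) lactm0.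
  - by rewrite -[RHS]/(0 <* b) ract0m.
have E x : (c *: f + g) x = c *: f x + g x by [].
split=> [d x y|a x|x b]; rewrite !E.
- by rewrite lf lg !scalerDr !scalerA [c * d]mulrC addrACA.
- by rewrite af ag lact_linr.
- by rewrite bf bg ract_linl.
Qed.

HB.instance Definition _ (X Y : bimod A B) :=
  GRing.isSubmodClosed.Build k (X -> Y) (@bihoms X Y) (@bihoms_closed X Y).

Definition biHom (X Y : bimod A B) : lmodType k := subspace (@bihoms X Y).

Definition projective (P : bimod A B) : Prop :=
  forall (X Y : bimod A B) (p : X -> Y) (f : P -> Y),
    bihom p -> (forall y, exists x, p x = y) -> bihom f ->
    exists2 g : P -> X, bihom g & forall x, p (g x) = f x.

End BimoduleHom.

(* An A-balanced map of A-bimodules M (x)_A M -> A (+) M, associative together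
   with the actions of A on M. *)
Record composition (k : fieldType) (A : algType k) (M : bimod A A) :=
  Composition {
    cmap :> M -> M -> bisum (regular A) M;
    cmap_linl : forall n, linear (cmap^~ n);
    cmap_linr : forall m, linear (cmap m);
    cmap_balanced : forall m a n, cmap (m <* a) n = cmap m (a *> n);
    cmap_lact : forall a m n, cmap (a *> m) n = a *> cmap m n;
    cmap_ract : forall m n a, cmap m (n <* a) = cmap m n <* a;
    (* (m n) p = m (n p), both products being computed in A (+) M *)
    cmap_assoc : forall m n p,
      (0, (cmap m n).1 *> p) + cmap (cmap m n).2 p =
      (0, m <* (cmap n p).1) + cmap m (cmap n p).2
  }.

Section Extension.
Variables (k : fieldType) (A : algType k) (M : bimod A A) (c : composition M).

(* The parameter c determines the product. *)
Definition extalg of composition M : Type := (A * M)%type.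
Local Notation L := (extalg c).

HB.instance Definition _ := GRing.Lmodule.copy L (A * M)%type.

Definition extalg_one : L := (1, 0).
Definition extalg_mul (x y : L) : L :=
  ((x.1 * y.1, x.1 *> y.2 + x.2 <* y.1) : L) + (c x.2 y.2 : L).

Lemma cmapDl m n p : c (m + n) p = c m p + c n p.
Proof. by have := cmap_linl c p 1 m n; rewrite !scale1r. Qed.
Lemma cmapDr m n p : c m (n + p) = c m n + c m p.
Proof. by have := cmap_linr c m 1 n p; rewrite !scale1r. Qed.
Lemma cmap0m m : c 0 m = 0.
Proof. by apply: (@addrI _ (c 0 m)); rewrite -cmapDl !addr0. Qed.
Lemma cmapm0 m : c m 0 = 0.
Proof. by apply: (@addrI _ (c m 0)); rewrite -cmapDr !addr0. Qed.
Lemma cmapZl d m n : c (d *: m) n = d *: c m n.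
Proof. by have := cmap_linl c n d m 0; rewrite cmap0m !addr0. Qed.
Lemma cmapZr d m n : c m (d *: n) = d *: c m n.
Proof. by have := cmap_linr c m d n 0; rewrite cmapm0 !addr0. Qed.

Fact extalg_mul1 : left_id extalg_one extalg_mul.
Proof.
by case=> a m; rewrite /extalg_mul/= cmap0m mul1r lact1 ract0m !addr0.
Qed.
Fact extalg_mulr1 : right_id extalg_one extalg_mul.
Proof.
by case=> a m; rewrite /extalg_mul/= cmapm0 mulr1 ract1 lactm0 add0r addr0.
Qed.
Fact extalg_mulDl : left_distributive extalg_mul +%R.
Proof.
move=> x y z; rewrite /extalg_mul cmapDl addrACA; congr (_ + _).
by congr pair; rewrite /= ?mulrDl // lactDl ractDl addrACA.
Qed.
Fact extalg_mulDr : right_distributive extalg_mul +%R.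
Proof.
move=> x y z; rewrite /extalg_mul cmapDr addrACA; congr (_ + _).
by congr pair; rewrite /= ?mulrDr // lactDr ractDr addrACA.
Qed.
Fact extalg_mulA : associative extalg_mul.
Proof.
move=> [a m] [b n] [d p].
have E1 (x y : bisum (regular A) M) : (x + y).1 = x.1 + y.1 by [].
have E2 (x y : bisum (regular A) M) : (x + y).2 = x.2 + y.2 by [].
have := cmap_assoc c m n p.
move/(congr1 (fun x : A * M => (x.1, x.2))).
rewrite !E1 !E2 /= !add0r => -[A1 A2].
congr pair; rewrite /extalg_mul /=.
  rewrite !cmapDl !cmapDr !E1 cmap_lact cmap_ract cmap_balanced /=.
  by rewrite mulrDl mulrDr mulrA A1 [LHS](AC (2*3) (1*4*(2*3*5))).
rewrite !cmapDl !cmapDr !E2 cmap_lact cmap_ract cmap_balanced /=.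
rewrite !lactDl !lactDr !ractDl !ractDr !lactA !ractA !lractA.
rewrite [LHS](AC (3*2*3) (1*2*3*4*6*7*(5*8))) /=.
by rewrite -A2 [LHS](AC (6*2) ((1*7)*(2*4*6)*(3*5*8))).
Qed.

Fact extalg_scaleAl (d : k) (x y : L) : d *: extalg_mul x y = extalg_mul (d *: x) y.
Proof.
rewrite /extalg_mul scalerDr cmapZl; congr (_ + _); congr pair => /=.
  by rewrite scalerAl.
by rewrite lactZl ractZl scalerDr.
Qed.
Fact extalg_scaleAr (d : k) (x y : L) : d *: extalg_mul x y = extalg_mul x (d *: y).
Proof.
rewrite /extalg_mul scalerDr cmapZr; congr (_ + _); congr pair => /=.
  by rewrite scalerAr.
by rewrite lactZr ractZr scalerDr.
Qed.
Fact extalg_one_neq0 : extalg_one != 0.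
Proof. by apply/eqP => -[/eqP]; rewrite oner_eq0. Qed.

HB.instance Definition _ := GRing.Zmodule_isNzRing.Build L
  extalg_mulA extalg_mul1 extalg_mulr1 extalg_mulDl extalg_mulDr extalg_one_neq0.
HB.instance Definition _ :=
  GRing.Lmodule_isLalgebra.Build k L extalg_scaleAl.
HB.instance Definition _ :=
  GRing.Lalgebra_isAlgebra.Build k L extalg_scaleAr.
End Extension.

(* The space of n-cochains is the subspace ccoch n of cspace n.  The
   differential is extended to the ambient space cspace n.  That cdiff maps
   cochains to cochains and has square zero on them is not part of the record;
   it holds for the two instances below, where cohomology is thus the usual
   quotient of cocycles by coboundaries. *)
Record cochains (k : fieldType) := Cochains {
  cspace : nat -> lmodType k;
  ccoch : forall n, submodClosed (cspace n);
  cdiff : forall n, {linear cspace n -> cspace n.+1}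
}.

Section Cohomology.
Variables (k : fieldType) (C : cochains k).

Definition cocycles n : {pred cspace C n} :=
  fun f => (f \in ccoch C n) && (cdiff C n f == 0).

Fact cocycles_closed n : submod_closed (@cocycles n).
Proof.
split=> [|c f g /andP[Cf /eqP df] /andP[Cg /eqP dg]]; rewrite unfold_in.
  by rewrite rpred0 linear0 eqxx.
by rewrite rpredD ?rpredZ // linearP df dg scaler0 addr0 eqxx.
Qed.

HB.instance Definition _ (n : nat) :=
  GRing.isSubmodClosed.Build k (cspace C n) (@cocycles n) (@cocycles_closed n).

Definition coboundaries n : {pred cspace C n} :=
  match n return {pred cspace C n} with
  | 0 => fun f => f == 0
  | n'.+1 => fun f => `[< exists2 g, g \in ccoch C n' & f = cdiff C n' g >]
  end.

Fact coboundaries_closed n : submod_closed (@coboundaries n).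
Proof.
case: n => [|n]; split.
- by rewrite unfold_in /= eqxx.
- by move=> c f g /eqP-> /eqP->; rewrite unfold_in /= scaler0 addr0 eqxx.
- by apply/asboolP; exists 0; rewrite ?rpred0 ?linear0.
move=> c _ _ /asboolP[f Cf ->] /asboolP[g Cg ->]; apply/asboolP.
by exists (c *: f + g); rewrite ?linearP // rpredD ?rpredZ.
Qed.

HB.instance Definition _ (n : nat) := GRing.isSubmodClosed.Build k (cspace C n)
  (@coboundaries n) (@coboundaries_closed n).

Definition cohomology n : lmodType k :=
  subquotient (@cocycles n) (@coboundaries n).
End Cohomology.

Section Ext.
Variables (k : fieldType) (A B : algType k).

Record proj_resolution (X : bimod A B) := ProjResolution {
  pres : nat -> bimod A B;
  pdiff : forall n, pres n.+1 -> pres n;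
  paug : pres 0 -> X;
  pres_proj : forall n, projective (pres n);
  pdiff_hom : forall n, bihom (@pdiff n);
  paug_hom : bihom paug;
  paug_surj : forall x, exists p, paug p = x;
  paug_exact : forall p, paug p = 0 <-> exists q, pdiff q = p;
  pdiff_exact : forall n (p : pres n.+1), pdiff p = 0 <-> exists q, pdiff q = p
}.

Variables (X : bimod A B) (P : proj_resolution X) (N : bimod A B).

Definition ext_diff n (f : pres P n -> N) : pres P n.+1 -> N :=
  fun x => f (pdiff x).

Fact ext_diff_linear n : linear (@ext_diff n).
Proof. by []. Qed.

HB.instance Definition _ (n : nat) := GRing.isLinear.Build k (pres P n -> N)
  (pres P n.+1 -> N) _ (@ext_diff n) (@ext_diff_linear n).

Definition ext_cochains : cochains k :=
  @Cochains k (fun n => pres P n -> N) (fun n => @bihoms k A B (pres P n) N)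
    (fun n => @ext_diff n).

(* Ext^n(X, N) computed with the projective resolution P of X. *)
Definition Ext n : lmodType k := cohomology ext_cochains n.
End Ext.

Definition HH (k : fieldType) (L : algType k) (P : proj_resolution (regular L)) n :
  lmodType k := Ext P (regular L) n.

(* There is at least one vertex: the product of the vertex algebras must be a
   nonzero algebra. *)
Record quiver := Quiver {
  vertex : finType;
  arrow : finType;
  src : arrow -> vertex;
  tgt : arrow -> vertex;
  vertex_inh : (0 < #|vertex|)%N
}.

Definition simply_laced (Q : quiver) : Prop :=
  (forall a : arrow Q, src a <> tgt a) /\
  (forall a b : arrow Q, src a = src b -> tgt a = tgt b -> a = b).

Record qbimod (k : fieldType) (Q : quiver) := QBimod {
  valg : vertex Q -> algType k;
  abim : forall a : arrow Q, bimod (valg (tgt a)) (valg (src a));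
  abim_neq0 : forall a, exists m : abim a, m <> 0
}.

Section ProductAlgebra.
Variables (k : fieldType) (Q : quiver) (D : qbimod k Q).

Definition prodA_type : Type := prodspace (valg D).

HB.instance Definition _ := GRing.Lmodule.on prodA_type.

Definition prodA_one : prodA_type := fun=> 1.
Definition prodA_mul (a b : prodA_type) : prodA_type := fun x => a x * b x.

Fact prodA_mulA : associative prodA_mul.
Proof. by move=> a b c; apply: functional_extensionality_dep => x; apply: mulrA. Qed.
Fact prodA_mul1 : left_id prodA_one prodA_mul.
Proof. by move=> a; apply: functional_extensionality_dep => x; apply: mul1r. Qed.
Fact prodA_mulr1 : right_id prodA_one prodA_mul.
Proof. by move=> a; apply: functional_extensionality_dep => x; apply: mulr1. Qed.
Fact prodA_mulDl : left_distributive prodA_mul +%R.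
Proof. by move=> a b c; apply: functional_extensionality_dep => x; apply: mulrDl. Qed.
Fact prodA_mulDr : right_distributive prodA_mul +%R.
Proof. by move=> a b c; apply: functional_extensionality_dep => x; apply: mulrDr. Qed.
Fact prodA_one_neq0 : prodA_one != 0.
Proof.
have /card_gt0P[x _] := vertex_inh Q.
by apply/eqP => /(congr1 (fun a : prodA_type => a x))/eqP; rewrite oner_eq0.
Qed.

HB.instance Definition _ := GRing.Zmodule_isNzRing.Build prodA_type
  prodA_mulA prodA_mul1 prodA_mulr1 prodA_mulDl prodA_mulDr prodA_one_neq0.

Fact prodA_scaleAl (c : k) (a b : prodA_type) : c *: (a * b) = c *: a * b.
Proof. by apply: functional_extensionality_dep => x; apply: scalerAl. Qed.
Fact prodA_scaleAr (c : k) (a b : prodA_type) : c *: (a * b) = a * (c *: b).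
Proof. by apply: functional_extensionality_dep => x; apply: scalerAr. Qed.

HB.instance Definition _ :=
  GRing.Lmodule_isLalgebra.Build k prodA_type prodA_scaleAl.
HB.instance Definition _ :=
  GRing.Lalgebra_isAlgebra.Build k prodA_type prodA_scaleAr.

Definition prodA : algType k := prodA_type.

Definition sumM_mod : lmodType k := prodspace (fun a => abim D a).

Definition sumM_lact (a : prodA) (m : sumM_mod) : sumM_mod :=
  fun i => a (tgt i) *> m i.
Definition sumM_ract (m : sumM_mod) (a : prodA) : sumM_mod :=
  fun i => m i <* a (src i).

Fact sumM_lact_linl m : linear (sumM_lact^~ m).
Proof. by move=> c x y; apply: functional_extensionality_dep => i; apply: lact_linl. Qed.
Fact sumM_lact_linr a : linear (sumM_lact a).
Proof. by move=> c x y; apply: functional_extensionality_dep => i; apply: lact_linr. Qed.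
Fact sumM_ract_linl b : linear (sumM_ract^~ b).
Proof. by move=> c x y; apply: functional_extensionality_dep => i; apply: ract_linl. Qed.
Fact sumM_ract_linr m : linear (sumM_ract m).
Proof. by move=> c x y; apply: functional_extensionality_dep => i; apply: ract_linr. Qed.
Fact sumM_lact1 m : sumM_lact 1 m = m.
Proof. by apply: functional_extensionality_dep => i; apply: lact1. Qed.
Fact sumM_lactA a a' m : sumM_lact (a * a') m = sumM_lact a (sumM_lact a' m).
Proof. by apply: functional_extensionality_dep => i; apply: lactA. Qed.
Fact sumM_ract1 m : sumM_ract m 1 = m.
Proof. by apply: functional_extensionality_dep => i; apply: ract1. Qed.
Fact sumM_ractA m b b' : sumM_ract m (b * b') = sumM_ract (sumM_ract m b) b'.
Proof. by apply: functional_extensionality_dep => i; apply: ractA. Qed.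
Fact sumM_lractA a m b : sumM_ract (sumM_lact a m) b = sumM_lact a (sumM_ract m b).
Proof. by apply: functional_extensionality_dep => i; apply: lractA. Qed.

Definition sumM : bimod prodA prodA :=
  @Bimod k prodA prodA sumM_mod sumM_lact sumM_ract
    sumM_lact_linl sumM_lact_linr sumM_ract_linl sumM_ract_linr
    sumM_lact1 sumM_lactA sumM_ract1 sumM_ractA sumM_lractA.

End ProductAlgebra.

(* The maps zMy (x)_(A_y) yMx -> zMx of a Q-set are given together, as one map
   M (x)_A M -> A (+) M.  For m' in zMy' and m in yMx, balancedness gives
   m' m = 0 unless y = y', and A-linearity on both sides puts m' m in
   e_z (A (+) M) e_x, which is zMx (in particular A_x if z = x). *)
Record qset (k : fieldType) (Q : quiver) := QSet {
  qdata :> qbimod k Q;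
  qcomp : composition (sumM qdata)
}.

Definition zero_compositions (k : fieldType) (Q : quiver) (D : qset k Q) : Prop :=
  forall m n : sumM D, qcomp D m n = 0.

Definition Lambda (k : fieldType) (Q : quiver) (D : qset k Q) : algType k :=
  extalg (qcomp D).

Section Paths.
Variable Q : quiver.

(* The path a_m ... a_1 with source x is encoded by x and [:: a_m; ...; a_1]. *)
Definition endpoint (x : vertex Q) (w : seq (arrow Q)) : vertex Q :=
  if w is a :: _ then tgt a else x.

Fixpoint is_path (x : vertex Q) (w : seq (arrow Q)) : bool :=
  if w is a :: w' then (src a == endpoint x w') && is_path x w' else true.

Record qpath := QPath {
  psrc : vertex Q;
  parrows : seq (arrow Q);
  qpathP : is_path psrc parrows
}.

Definition ptgt (w : qpath) : vertex Q := endpoint (psrc w) (parrows w).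
Definition plen (w : qpath) : nat := size (parrows w).
Definition is_cycle (w : qpath) : bool := psrc w == ptgt w.

(* Both types are finite: there are finitely many paths of length at most n. *)
Definition DQle (n : nat) : Type := {w : qpath | (plen w <= n)%N && ~~ is_cycle w}.
Definition CQle_pos (n : nat) : Type :=
  {w : qpath | [&& (0 < plen w)%N, (plen w <= n)%N & is_cycle w]}.

(* A trajectory is determined by its waiting times p_(m+1), ..., p_1. *)
Definition traj (w : qpath) (n : nat) : Type :=
  {p : (plen w).+1.-tuple 'I_n.+1 | (plen w + \sum_(q <- p) q)%N == n}.

HB.instance Definition _ (w : qpath) (n : nat) := Finite.on (traj w n).

Fixpoint letters (x : vertex Q) (w : seq (arrow Q)) (p : seq nat) :
    seq (vertex Q + arrow Q) :=
  if w is a :: w' then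
    nseq (head 0%N p) (inl (tgt a)) ++ inr a :: letters x w' (behead p)
  else nseq (head 0%N p) (inl x).

Definition traj_letters (w : qpath) (n : nat) (t : traj w n) :
    seq (vertex Q + arrow Q) :=
  letters (psrc w) (parrows w) [seq nat_of_ord q | q <- val t].

(* u is in t_0^+. *)
Definition traj_succ (w : qpath) (n : nat) (t : traj w n) (u : traj w n.+1) : bool :=
  [exists i, [forall j,
     tnth (val u) j == (tnth (val t) j + (j == i))%N :> nat]].
End Paths.

Section Hochschild.
Variables (k : fieldType) (L : algType k).

Definition multilinear (n : nat) (f : ('I_n -> L) -> L) : Prop :=
  forall (i : 'I_n) (x : 'I_n -> L),
    linear (fun u : L => f (fun j => if j == i then u else x j)).

(* (x_0, ..., x_i x_(i+1), ..., x_n), with indices starting from 0. *)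
Definition merge_at (n : nat) (i : 'I_n) (x : 'I_n.+1 -> L) : 'I_n -> L := fun j =>
  if (j < i)%N then x (lift ord_max j)
  else if j == i then x (lift ord_max i) * x (lift ord0 i)
  else x (lift ord0 j).

Definition hcobound (n : nat) (f : ('I_n -> L) -> L) : ('I_n.+1 -> L) -> L :=
  fun x => x ord0 * f (fun j => x (lift ord0 j))
    + \sum_(i < n) (-1) ^+ i.+1 *: f (merge_at i x)
    + (-1) ^+ n.+1 *: (f (fun j => x (lift ord_max j)) * x ord_max).

Fact hcobound_linear n : linear (@hcobound n).
Proof.
move=> c f g; apply: funext => x.
have E y : (c *: f + g) y = c *: f y + g y by [].
rewrite -[RHS]/(c *: hcobound f x + hcobound g x) /hcobound !E.
rewrite mulrDr mulrDl -scalerAr -scalerAl !scalerDr !scalerA.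
rewrite [_ * c]mulrC -!scalerA.
under eq_bigr do rewrite E scalerDr scalerA [_ * c]mulrC -scalerA.
by rewrite big_split/= -scaler_sumr [RHS]addrACA; congr (_ + _); rewrite addrACA.
Qed.

HB.instance Definition _ (n : nat) := GRing.isLinear.Build k
  (('I_n -> L) -> L) (('I_n.+1 -> L) -> L) _ (@hcobound n) (@hcobound_linear n).
End Hochschild.

Section PathCohomology.
Variables (k : fieldType) (Q : quiver) (D : qset k Q).
Local Notation L := (Lambda D).

Definition unit_at (x : vertex Q) : L :=
  ((fun y => if y == x then 1 else 0) : prodA D, 0 : sumM D).

(* The projections of Lambda onto its summands A_x and M_a. *)
Definition proj_letter (l : vertex Q + arrow Q) (y : L) : L :=
  match l with
  | inl x => ((fun z => if z == x then y.1 z else 0) : prodA D, 0 : sumM D)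
  | inr a => (0 : prodA D, (fun b => if b == a then y.2 b else 0) : sumM D)
  end.

Variable w : qpath Q.

(* The list traj_letters t has length n; the default is never used. *)
Definition proj_traj n (t : traj w n) (x : 'I_n -> L) : 'I_n -> L := fun i =>
  proj_letter (nth (inl (psrc w)) (traj_letters t) i) (x i).

(* A linear map t_Delta -> Delta_w is encoded by its extension by zero to
   Lambda^(x n): a multilinear map on Lambda^n which factors through the
   projection onto t_Delta, with values in e_t(w) Lambda e_s(w). *)
Definition traj_hom n (t : traj w n) (f : ('I_n -> L) -> L) : Prop :=
  [/\ multilinear f, forall x, f (proj_traj t x) = f x
    & forall x, unit_at (ptgt w) * f x * unit_at (psrc w) = f x].

Definition path_coch n : {pred traj w n -> ('I_n -> L) -> L} :=
  fun f => `[< forall t, traj_hom t (f t) >].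

Fact path_coch_closed n : submod_closed (@path_coch n).
Proof.
split=> [|c f g /asboolP Cf /asboolP Cg]; apply/asboolP => t.
  split=> [i x d u v|//|x]; last by rewrite -[RHS]/(0 : L) mulr0 mul0r.
  by rewrite -[RHS]/(d *: (0 : L) + 0) scaler0 addr0.
have [lf pf uf] := Cf t; have [lg pg ug] := Cg t.
have E x : (c *: f + g) t x = c *: f t x + g t x by [].
split=> [i x d u v|x|x]; rewrite !E.
- by rewrite lf lg !scalerDr !scalerA [c * d]mulrC addrACA.
- by rewrite pf pg.
- by rewrite mulrDr mulrDl -scalerAr -scalerAl uf ug.
Qed.

HB.instance Definition _ (n : nat) := GRing.isSubmodClosed.Build k
  (traj w n -> ('I_n -> L) -> L) (@path_coch n) (@path_coch_closed n).

Definition path_diff n (f : traj w n -> ('I_n -> L) -> L) :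
    traj w n.+1 -> ('I_n.+1 -> L) -> L :=
  fun u x => \sum_(t | traj_succ t u) hcobound (f t) (proj_traj u x).

Fact path_diff_linear n : linear (@path_diff n).
Proof.
move=> c f g; apply: funext => u; apply: funext => x.
rewrite -[RHS]/(c *: path_diff f u x + path_diff g u x) /path_diff.
rewrite scaler_sumr -big_split; apply: eq_bigr => t _.
by rewrite -[(c *: f + g) t]/(c *: f t + g t) linearP.
Qed.

HB.instance Definition _ (n : nat) := GRing.isLinear.Build k
  (traj w n -> ('I_n -> L) -> L) (traj w n.+1 -> ('I_n.+1 -> L) -> L) _
  (@path_diff n) (@path_diff_linear n).

Definition path_cochains : cochains k :=
  @Cochains k (fun n => traj w n -> ('I_n -> L) -> L)
    (fun n => @path_coch n) (fun n => @path_diff n).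

Definition Hpath (n : nat) : lmodType k := cohomology path_cochains n.
End PathCohomology.

Section Terms.
Variables (k : fieldType) (Q : quiver) (D : qset k Q).

Definition HDQ (n : nat) : lmodType k := prodspace (fun w : DQle Q n => Hpath D (val w) n).

Definition HCQ (n : nat) : lmodType k := prodspace (fun w : CQle_pos Q n => Hpath D (val w) n).

Variable PA : proj_resolution (regular (prodA D)).

(* The term following HH^n(Lambda). *)
Definition les_cycle (n : nat) : lmodType k :=
  match n with
  | 0 | 1 => HH PA n
  | _ => (HH PA n * HCQ n)%type
  end.

(* The term preceding HH^(n+1)(Lambda). *)
Definition les_noncycle (n : nat) : lmodType k :=
  if n is 0 then biHom (sumM D) (sumM D) else HDQ n.+1.
End Terms.

Definition exact (k : fieldType) (U V W : lmodType k)
    (f : {linear U -> V}) (g : {linear V -> W}) : Prop :=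
  forall v, g v = 0 <-> exists u, f u = v.

(* Main.v *)
Require Import Defs.
From HB Require Import structures.
From mathcomp Require Import all_boot all_algebra zify.
From mathcomp Require Import boolp classical_sets functions.

(* Let E be the span of the idempotents e_x.  Hochschild cohomology is computed by
   the bar complex of E-balanced cochains.  Without tensor products: for a
   projective resolution P of L, the double complex Hom_{L-L}(P_p, I^q), where I^q
   consists of the bar cochains that need not be right L-linear, has exact rows
   (P_p is projective) and exact columns (P splits as a complex of
   E-L-bimodules), so its two edges have the same cohomology.

   The product of M being zero, M and A = Lambda/M are Lambda-bimodules on which M
   acts by zero, and the theorem is the long exact sequence of the coefficients
   0 -> M -> Lambda -> A -> 0.  A balanced cochain with values in a bimodule killed
   by M is the family of its restrictions to the trajectories, and the coboundary
   does not change the path of a trajectory: the complex is the product of the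
   complexes K_w.  As Q has no loops, values along a path w lie in M when w is not
   a cycle and in A when w is a cycle; the vertices contribute HH(A). *)

Set Implicit Arguments.
Unset Strict Implicit.
Unset Printing Implicit Defensive.

Import GRing.Theory.
Local Open Scope ring_scope.

(** * Subquotients and long exact sequences *)

(** Working over E rather than over k makes cochains split along trajectories: letters that do not
    compose contribute nothing, and a nonempty word of composable letters spells one trajectory of
    one path. The same idempotents serve A, so the comparison with Ext is used for Lambda and again
    for A; HH(A) is then split off from the cohomology with coefficients in A by inflation along
    Lambda -> A and restriction along its section A -> Lambda.

    That section is not a map of Lambda-bimodules, which obstructs lifting A-valued cochains to
    Lambda. It is E-bilinear, however, and a cochain normalised by setting both end arguments to 1
    only has to respect E; hence the two forms of cochains.

    The low degrees look different because there are no loops: no nonzero element of M commutes with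
    E, so there are no nonzero M-valued 0-cochains. Hence the sequence starts with 0, and the
    M-valued 1-cocycles, with no coboundaries to divide by, are the endomorphisms of M. *)

Lemma linear_fun (k : fieldType) (U V : lmodType k) (f : U -> V) :
  linear f -> exists g : {linear U -> V}, g =1 f.
Proof.
move=> L; pose m := GRing.isLinear.Build k U V *:%R f L.
by pose g : {linear U -> V} := HB.pack f m; exists g.
Qed.

Lemma linear_eq0 (k : fieldType) (U V : lmodType k) (f : U -> V) : linear f -> f 0 = 0.
Proof. by move=> lf; have := lf (-1) 0 0; rewrite scaler0 addr0 scaleN1r addNr. Qed.

Section SubquotientClass.
Local Open Scope quotient_scope.
Variables (k : fieldType) (V : lmodType k) (Z B : submodClosed V).

(** The default of [insubd] gives class 0 outside [Z]. Being total on [V], the class can be used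
    with relations on [V] without subtypes; it is linear only on [Z]. *)
Definition sqclass (a : V) : subquotient Z B :=
  \pi_(quotspace (@sub_pullback k V Z B)) (insubd (0 : subspace Z) a).

Lemma val_insubd0 a : a \in Z -> val (insubd (0 : subspace Z) a) = a.
Proof. by move=> Za; apply: (insubdK _ Za). Qed.

Lemma insubd_subP c a b : a \in Z -> b \in Z ->
  insubd (0 : subspace Z) (c *: a + b) = c *: insubd (0 : subspace Z) a + insubd 0 b.
Proof.
by move=> Za Zb; apply: val_inj; rewrite linearP /= !val_insubd0 ?rpredD ?rpredZ.
Qed.

Lemma sqclassP c a b : a \in Z -> b \in Z ->
  sqclass (c *: a + b) = c *: sqclass a + sqclass b.
Proof.
move=> Za Zb; rewrite /sqclass insubd_subP // -pi_quotspaceD.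
by congr (_ + _); apply: esym; apply: pi_quotspace_scale.
Qed.

Lemma sqclass0 : sqclass 0 = 0.
Proof.
by have := sqclassP (-1) (rpred0 Z) (rpred0 Z); rewrite scaler0 addr0 scaleN1r addNr.
Qed.

Lemma sqclass_eq0 a : a \in Z -> (sqclass a = 0) <-> a \in B.
Proof.
move=> Za; rewrite -sqclass0 /sqclass.
have -> : (a \in B) = (insubd (0 : subspace Z) a - insubd (0 : subspace Z) 0
    \in submod_zmod (@sub_pullback k V Z B)).
  rewrite -[RHS]/(val (insubd (0 : subspace Z) a - insubd 0 0) \in B).
  by rewrite raddfB /= !val_insubd0 ?rpred0 ?subr0.
by rewrite Quotient.idealrBE; split=> [->|/eqP].
Qed.

Lemma sqclassW (q : subquotient Z B) : exists2 a, a \in Z & q = sqclass a.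
Proof.
elim/quotW: q => -[a Za]; exists a => //.
suff -> : Subspace Za = insubd 0 a by [].
by apply: val_inj; rewrite val_insubd0.
Qed.

Lemma sqclass_eq a b : a \in Z -> b \in Z -> (sqclass a = sqclass b) <-> a - b \in B.
Proof.
move=> Za Zb; rewrite -sqclass_eq0 ?rpredB //; last first.
  by rewrite -scaleN1r rpredD ?rpredZ.
have := sqclassP (-1) Zb Za; rewrite !scaleN1r addrC => ->.
rewrite addrC; split=> [->|]; first by rewrite subrr.
by move/eqP; rewrite subr_eq0 => /eqP.
Qed.

Variables (U : lmodType k) (R : V -> U -> Prop).
Hypothesis R_lin : forall c a b u v, R a u -> R b v -> R (c *: a + b) (c *: u + v).
Hypothesis R_tot : forall a, a \in Z -> exists u, R a u.
Hypothesis R_bd : forall a u, a \in Z -> R a u -> a \in B -> u = 0.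

(** A relation is used because connecting maps and staircases involve choices. Linearity, and [R_bd]
    applied to the difference of two representatives of one class, show that the choices do not
    matter. *)
Lemma sq_relmap : exists phi : {linear subquotient Z B -> U},
  forall a u, a \in Z -> R a u -> phi (sqclass a) = u.
Proof.
have H (q : subquotient Z B) : exists u, exists2 a, a \in Z & q = sqclass a /\ R a u.
  by have [a Za ->] := sqclassW q; have [u Ru] := R_tot Za; exists u, a.
pose phi q := projT1 (cid (H q)).
have E a u : a \in Z -> R a u -> phi (sqclass a) = u.
  move=> Za Ra; rewrite /phi; case: cid => u' /= [b Zb [Eab Rb]].
  have D : b - a \in B by apply/(sqclass_eq Zb Za).
  have := R_lin (-1) Ra Rb; rewrite !scaleN1r ![- _ + _]addrC => /R_bd H0.
  apply/eqP; rewrite -subr_eq0; apply/eqP/H0; rewrite //.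
  by rewrite -scaleN1r rpredD ?rpredZ.
have L : linear phi.
  move=> c q r; have [a Za ->] := sqclassW q; have [b Zb ->] := sqclassW r.
  have [u Ru] := R_tot Za; have [v Rv] := R_tot Zb.
  rewrite -sqclassP // (E _ _ Za Ru) (E _ _ Zb Rv).
  by apply: E; rewrite ?rpredD ?rpredZ //; apply: R_lin.
by have [g gE] := linear_fun L; exists g => a u Za Ra; rewrite gE; apply: E.
Qed.

End SubquotientClass.

Section LinearIso.
Variable k : fieldType.
Implicit Types U V W : lmodType k.

Definition liso U V : Prop := exists (phi : {linear U -> V}) (psi : {linear V -> U}),
  cancel phi psi /\ cancel psi phi.

Lemma liso_sym U V : liso U V -> liso V U.
Proof. by case=> phi [psi [H1 H2]]; exists psi, phi. Qed.

Lemma liso_trans V U W : liso U V -> liso V W -> liso U W.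
Proof.
case=> f [g [fK gK]] [f' [g' [fK' gK']]].
by exists (f' \o f : {linear U -> W}), (g \o g' : {linear W -> U}); split; apply: can_comp.
Qed.

Lemma liso_refl U : liso U U.
Proof. by exists idfun, idfun. Qed.

Lemma liso_bij U V (phi : {linear U -> V}) :
  (forall u, phi u = 0 -> u = 0) -> (forall v, exists u, phi u = v) -> liso U V.
Proof.
move=> inj onto; pose psi v := projT1 (cid (onto v)).
have psiK : cancel psi phi by move=> v; rewrite /psi; case: cid.
have phiI : injective phi by move=> u v /eqP; rewrite -subr_eq0 -linearB => /eqP /inj /eqP; rewrite subr_eq0 => /eqP.
have L : linear psi by move=> c u v; apply: phiI; rewrite linearP !psiK.
have [g gE] := linear_fun L; exists phi, g; split=> u; rewrite gE ?psiK //.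
by apply: phiI; rewrite psiK.
Qed.

Lemma liso_prod U U' V V' : liso U U' -> liso V V' -> liso (U * V)%type (U' * V')%type.
Proof.
case=> f [g [fK gK]] [f' [g' [fK' gK']]].
pose phi (x : U * V) : U' * V' := (f x.1, f' x.2).
have L : linear phi by move=> c x y; rewrite /phi !linearP.
have [h hE] := linear_fun L; apply: (liso_bij (phi := h)).
  move=> [u v]; rewrite hE => -[] /(congr1 g) + /(congr1 g').
  by rewrite /= fK fK' !linear0 => -> ->.
by move=> [u v]; exists (g u, g' v); rewrite hE /phi /= gK gK'.
Qed.

Lemma liso_prod0 U V : (forall v : V, v = 0) -> liso (U * V)%type U.
Proof.
move=> V0; apply: (liso_bij (phi := (fst : {linear (U * V)%type -> U}))).
  by case=> u v /= ->; rewrite [v]V0.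
by move=> u; exists (u, 0).
Qed.

End LinearIso.

Section SubquotientIso.
Variables (k : fieldType) (V : lmodType k) (Z B : submodClosed V).
Variables (U : lmodType k) (R : V -> U -> Prop).
Hypothesis R_lin : forall c a b u v, R a u -> R b v -> R (c *: a + b) (c *: u + v).
Hypothesis R_tot : forall a, a \in Z -> exists u, R a u.
Hypothesis R_bd : forall a u, a \in Z -> R a u -> a \in B -> u = 0.
Hypothesis R_inj : forall a, a \in Z -> R a 0 -> a \in B.
Hypothesis R_onto : forall u, exists2 a, a \in Z & R a u.

Lemma sq_reliso : liso (subquotient Z B) U.
Proof.
have [phi E] := sq_relmap R_lin R_tot R_bd.
apply: (liso_bij (phi := phi)) => [q|u].
  have [a Za ->] := sqclassW q; have [u Ru] := R_tot Za.
  rewrite (E _ _ Za Ru) => u0; apply/sqclass_eq0 => //.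
  by apply: R_inj; rewrite // -u0.
by have [a Za Ra] := R_onto u; exists (sqclass Z B a); apply: E.
Qed.
End SubquotientIso.

Section SubquotientIso2.
Variables (k : fieldType) (V V' : lmodType k).
Variables (Z B : submodClosed V) (Z' B' : submodClosed V') (R : V -> V' -> Prop).
Hypothesis R_lin : forall c a b u v, R a u -> R b v -> R (c *: a + b) (c *: u + v).
Hypothesis R_tot : forall a, a \in Z -> exists2 u, u \in Z' & R a u.
Hypothesis R_bd : forall a u, a \in Z -> u \in Z' -> R a u -> a \in B -> u \in B'.

Let R' a (q : subquotient Z' B') := exists2 u, u \in Z' & q = sqclass Z' B' u /\ R a u.

Let R'_lin c a b u v : R' a u -> R' b v -> R' (c *: a + b) (c *: u + v).
Proof.
move=> [x Zx [-> Rx]] [y Zy [-> Ry]]; exists (c *: x + y); first by rewrite rpredD ?rpredZ.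
by split; [rewrite sqclassP | apply: R_lin].
Qed.
Let R'_tot a : a \in Z -> exists u, R' a u.
Proof. by move=> Za; have [u Zu Ru] := R_tot Za; exists (sqclass Z' B' u), u. Qed.
Let R'_bd a u : a \in Z -> R' a u -> a \in B -> u = 0.
Proof. by move=> Za [x Zx [-> Rx]] Ba; apply/sqclass_eq0 => //; apply: R_bd Rx Ba. Qed.

(** The relation is composed with the class map of the target, so that [u] has to be controlled only
    up to [B']. *)
Lemma sq_relmap2 : exists phi : {linear subquotient Z B -> subquotient Z' B'},
  forall a u, a \in Z -> u \in Z' -> R a u -> phi (sqclass Z B a) = sqclass Z' B' u.
Proof.
have [phi E] := sq_relmap R'_lin R'_tot R'_bd; exists phi => a u Za Zu Ru.
by apply: E => //; exists u.
Qed.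

Hypothesis R_onto : forall u, u \in Z' -> exists2 a, a \in Z & R a u.
Hypothesis R_inj : forall a u, a \in Z -> u \in Z' -> R a u -> u \in B' -> a \in B.

Lemma sq_reliso2 : liso (subquotient Z B) (subquotient Z' B').
Proof.
apply: (sq_reliso R'_lin R'_tot R'_bd) => [a Za [u Zu [/esym/sqclass_eq0 u0 Ru]]|q].
  exact: R_inj Ru (u0 Zu).
have [u Zu ->] := sqclassW q; have [a Za Ra] := R_onto Zu.
by exists a => //; exists u.
Qed.
End SubquotientIso2.

Section ExactTransport.
Variables (k : fieldType).

Lemma exact_conj (U V W U' V' W' : lmodType k)
    (f : {linear U -> V}) (g : {linear V -> W})
    (a : {linear U' -> U}) (a' : {linear U -> U'})
    (b : {linear V -> V'}) (b' : {linear V' -> V}) (c : {linear W -> W'}) :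
  cancel a' a -> cancel b b' -> cancel b' b -> injective c ->
  exact f g ->
  exact (b \o f \o a : {linear U' -> V'}) (c \o g \o b' : {linear V' -> W'}).
Proof.
move=> aK bK b'K cI fg v; split=> /= [|[u <-]].
  rewrite -(linear0 c) => /cI/fg[u Ef].
  by exists (a' u); rewrite /= aK Ef b'K.
by rewrite bK; have -> : g (f (a u)) = 0; [apply/fg; exists (a u) | rewrite linear0].
Qed.
End ExactTransport.

Section CochainMembership.
Variables (k : fieldType) (C : cochains k).

Lemma cocyclesP n (a : cspace C n) :
  (a \in @cocycles k C n) <-> a \in ccoch C n /\ cdiff C n a = 0.
Proof. by rewrite unfold_in; split=> [/andP[-> /eqP]|[-> ->]]; rewrite ?eqxx. Qed.

Lemma coboundaries0P (a : cspace C 0) : (a \in @coboundaries k C 0) <-> a = 0.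
Proof. by rewrite unfold_in; split=> /eqP. Qed.

Lemma coboundariesSP n (a : cspace C n.+1) :
  (a \in @coboundaries k C n.+1) <-> exists2 b, b \in ccoch C n & a = cdiff C n b.
Proof. by rewrite unfold_in; split=> /asboolP. Qed.

End CochainMembership.

Lemma submodP (k : fieldType) (V : lmodType k) (S : submodClosed V) c a b :
  a \in S -> b \in S -> c *: a + b \in S.
Proof. by move=> Sa Sb; rewrite rpredD ?rpredZ. Qed.

Lemma submodB (k : fieldType) (V : lmodType k) (S : submodClosed V) a b :
  a \in S -> b \in S -> a - b \in S.
Proof. by move=> Sa Sb; rewrite -scaleN1r rpredD ?rpredZ. Qed.

Section LongExactSequence.
Variables (k : fieldType) (X Y T : cochains k).
Variables (i : forall n, {linear cspace X n -> cspace Y n}).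
Variables (p : forall n, {linear cspace Y n -> cspace T n}).
Hypothesis Yd : forall n f, f \in ccoch Y n -> cdiff Y n f \in ccoch Y n.+1.
Hypothesis Ydd : forall n f, cdiff Y n.+1 (cdiff Y n f) = 0.
Hypothesis iC : forall n f, f \in ccoch X n -> i n f \in ccoch Y n.
Hypothesis pC : forall n f, f \in ccoch Y n -> p n f \in ccoch T n.
Hypothesis id : forall n f, i n.+1 (cdiff X n f) = cdiff Y n (i n f).
Hypothesis pd : forall n f, p n.+1 (cdiff Y n f) = cdiff T n (p n f).
Hypothesis i_inj : forall n, injective (i n).
Hypothesis pi0 : forall n f, p n (i n f) = 0.
Hypothesis ip_ex : forall n f, f \in ccoch Y n -> p n f = 0 ->
  exists2 g, g \in ccoch X n & i n g = f.
Hypothesis p_onto : forall n f, f \in ccoch T n -> exists2 g, g \in ccoch Y n & p n g = f.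

Let Zi n a : a \in @cocycles k X n -> i n a \in @cocycles k Y n.
Proof. by move=> /cocyclesP[Ca da]; apply/cocyclesP; rewrite iC // -id da linear0. Qed.

Let Zp n a : a \in @cocycles k Y n -> p n a \in @cocycles k T n.
Proof. by move=> /cocyclesP[Ca da]; apply/cocyclesP; rewrite pC // -pd da linear0. Qed.

Let Bi n a : a \in @coboundaries k X n -> i n a \in @coboundaries k Y n.
Proof.
case: n a => [|n] a; first by move/coboundaries0P->; rewrite linear0 rpred0.
by move=> /coboundariesSP[b Cb ->]; apply/coboundariesSP; exists (i n b); rewrite ?id ?iC.
Qed.

Let Bp n a : a \in @coboundaries k Y n -> p n a \in @coboundaries k T n.
Proof.
case: n a => [|n] a; first by move/coboundaries0P->; rewrite linear0 rpred0.
by move=> /coboundariesSP[b Cb ->]; apply/coboundariesSP; exists (p n b); rewrite ?pd ?pC.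
Qed.

Let coc n (C : cochains k) := @sqclass k (cspace C n) (@cocycles k C n) (@coboundaries k C n).

Let ex_i n : exists phi : {linear cohomology X n -> cohomology Y n},
  forall a, a \in @cocycles k X n -> phi (coc a) = coc (i n a).
Proof.
have [|||phi E] := @sq_relmap2 k _ _ (@cocycles k X n) (@coboundaries k X n)
  (@cocycles k Y n) (@coboundaries k Y n) (fun a u => u = i n a).
- by move=> c a b _ _ -> ->; rewrite linearP.
- by move=> a Za; exists (i n a); rewrite ?Zi.
- by move=> a _ _ _ ->; apply: Bi.
by exists phi => a Za; apply: E; rewrite ?Zi.
Qed.

Let ex_p n : exists phi : {linear cohomology Y n -> cohomology T n},
  forall a, a \in @cocycles k Y n -> phi (coc a) = coc (p n a).
Proof.
have [|||phi E] := @sq_relmap2 k _ _ (@cocycles k Y n) (@coboundaries k Y n)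
  (@cocycles k T n) (@coboundaries k T n) (fun a u => u = p n a).
- by move=> c a b _ _ -> ->; rewrite linearP.
- by move=> a Za; exists (p n a); rewrite ?Zp.
- by move=> a _ _ _ ->; apply: Bp.
by exists phi => a Za; apply: E; rewrite ?Zp.
Qed.

Let Rc n (a : cspace T n) (u : cspace X n.+1) :=
  exists2 b, b \in ccoch Y n & p n b = a /\ cdiff Y n b = i n.+1 u.

Let Rc_tot n a : a \in @cocycles k T n -> exists2 u, u \in @cocycles k X n.+1 & Rc a u.
Proof.
move=> /cocyclesP[Ca da]; have [b Cb Eb] := p_onto Ca.
have [|u Cu Eu] := ip_ex (Yd Cb); first by rewrite pd Eb.
exists u; last by exists b.
by apply/cocyclesP; split=> //; apply: (@i_inj n.+2); rewrite id Eu Ydd linear0.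
Qed.

(** When [a] is a coboundary, subtracting from [b] the differential of a lift of the primitive of
    [a] moves it into the kernel of [p] without changing its own differential; the result comes from
    X. In degree 0, [a] is already 0. *)
Let Rc_bd n a u : Rc a u -> a \in @coboundaries k T n -> u \in @coboundaries k X n.+1.
Proof.
move=> [b Cb [Eb db]] Ba.
have [b' [Cb' pb' db']] : exists b', [/\ b' \in ccoch Y n, p n b' = 0 & cdiff Y n b' = cdiff Y n b].
  case: n a u b Cb Eb db Ba => [|n] a u b Cb Eb db.
    by move/coboundaries0P=> a0; exists b; rewrite Eb a0.
  move/coboundariesSP=> [c Cc Ec]; have [y Cy Ey] := p_onto Cc.
  exists (b - cdiff Y n y); rewrite !linearB /= pd Ey Eb Ec subrr Ydd subr0.
  by rewrite submodB ?Yd.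
have [x Cx Ex] := ip_ex Cb' pb'.
apply/coboundariesSP; exists x => //; apply: (@i_inj n.+1).
by rewrite id Ex db'.
Qed.

Let Rc_lin n c (a b : cspace T n) u v : Rc a u -> Rc b v -> Rc (c *: a + b) (c *: u + v).
Proof.
move=> [x Cx [Ex dx]] [y Cy [Ey dy]]; exists (c *: x + y); first by rewrite rpredD ?rpredZ.
by rewrite !linearP Ex Ey dx dy.
Qed.

Let ex_c n : exists phi : {linear cohomology T n -> cohomology X n.+1},
  forall a u, a \in @cocycles k T n -> u \in @cocycles k X n.+1 -> Rc a u ->
    phi (coc a) = coc u.
Proof.
by apply: sq_relmap2 => [|a|a u _ _]; [exact: Rc_lin | exact: Rc_tot | exact: Rc_bd].
Qed.

Lemma long_exact_sequence : exists (f : forall n, {linear cohomology X n -> cohomology Y n})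
    (g : forall n, {linear cohomology Y n -> cohomology T n})
    (h : forall n, {linear cohomology T n -> cohomology X n.+1}),
  [/\ forall n, exact (f n) (g n), forall n, exact (g n) (h n)
    & forall n, exact (h n) (f n.+1)].
Proof.
pose f n := projT1 (cid (ex_i n)); have fE n a : a \in @cocycles k X n -> f n (coc a) = coc (i n a) :=
  projT2 (cid (ex_i n)) a.
pose g n := projT1 (cid (ex_p n)); have gE n a : a \in @cocycles k Y n -> g n (coc a) = coc (p n a) :=
  projT2 (cid (ex_p n)) a.
pose h n := projT1 (cid (ex_c n)); have hE n a u : a \in @cocycles k T n -> u \in @cocycles k X n.+1 -> Rc a u ->
    h n (coc a) = coc u := projT2 (cid (ex_c n)) a u.
exists f, g, h; split=> n q.
- have [a Za ->] := sqclassW q; rewrite gE //; have /cocyclesP[Ca da] := Za; split.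
    move/sqclass_eq0 => /(_ (Zp Za)) Ba.
    (* Correcting [a] by the differential of a lift of the primitive of [p a] makes it lie over 0
       strictly, and not only up to a coboundary. *)
    have [b [Zb pb Bb]] : exists b, [/\ b \in @cocycles k Y n, p n b = 0
        & a - b \in @coboundaries k Y n].
      case: n q a Za Ca da Ba => [|n] q a Za Ca da.
        by move=> /coboundaries0P pa; exists a; rewrite subrr rpred0.
      move/coboundariesSP=> [c Cc Ec]; have [y Cy Ey] := p_onto Cc.
      exists (a - cdiff Y n y); rewrite linearB /= pd Ey Ec subrr; split=> //.
        by apply/cocyclesP; rewrite submodB ?Yd // linearB /= da Ydd subrr.
      by rewrite subKr; apply/coboundariesSP; exists y.
    have /cocyclesP[Cb db] := Zb; have [x Cx Ex] := ip_ex Cb pb.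
    have Zx : x \in @cocycles k X n.
      by apply/cocyclesP; split=> //; apply: (@i_inj n.+1); rewrite id Ex db linear0.
    exists (coc x); rewrite fE // Ex; apply/sqclass_eq => //.
    by rewrite -opprB -sub0r submodB ?rpred0.
  case=> r; have [x Zx ->] := sqclassW r; rewrite fE // => /sqclass_eq E.
  have Zix := Zi Zx.
  have := Bp (E Zix Za); rewrite linearB /= pi0 sub0r => B.
  by apply/sqclass_eq0; rewrite ?Zp // -[p n a]opprK -sub0r submodB ?rpred0.
- have [a Za ->] := sqclassW q; have /cocyclesP[Ca da] := Za.
  have [u Zu Ru] := Rc_tot Za; rewrite (hE _ _ _ Za Zu Ru).
  have /cocyclesP[Cu du] := Zu; split.
    move/sqclass_eq0 => /(_ Zu) /coboundariesSP[x Cx Ex].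
    case: Ru => b Cb [Eb db].
    have Zb : b - i n x \in @cocycles k Y n.
      by apply/cocyclesP; rewrite submodB ?iC //= linearB /= db -id Ex subrr.
    by exists (coc (b - i n x)); rewrite gE // linearB /= Eb pi0 subr0.
  case=> r; have [b Zb ->] := sqclassW r; rewrite gE // => /sqclass_eq E.
  have /cocyclesP[Cb db] := Zb.
  (* The class of [a] is also that of [p n b], which is related to 0 since [b] is a cocycle; the
     difference is a coboundary related to [u]. *)
  apply/sqclass_eq0 => //; apply: (Rc_bd (a := a - p n b)).
    have R0 : Rc (p n b) 0 by exists b; rewrite ?db ?linear0.
    by have := Rc_lin (-1) R0 Ru; rewrite scaler0 add0r scaleN1r addrC.
  by rewrite -opprB -sub0r submodB ?rpred0 // E // Zp.
have [u Zu ->] := sqclassW q; have /cocyclesP[Cu du] := Zu; rewrite fE //; split.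
  move/sqclass_eq0 => /(_ (Zi Zu)) /coboundariesSP[b Cb Eb].
  have Za : p n b \in @cocycles k T n by apply/cocyclesP; rewrite pC // -pd -Eb pi0.
  by exists (coc (p n b)); apply: hE => //; exists b.
case=> r; have [a Za ->] := sqclassW r; have [u' Zu' Ru'] := Rc_tot Za.
rewrite (hE _ _ _ Za Zu' Ru') => /sqclass_eq E.
case: Ru' => b Cb [Eb db].
have Biu' : i n.+1 u' \in @coboundaries k Y n.+1 by apply/coboundariesSP; exists b.
have /Bi := E Zu' Zu; rewrite linearB /= => B.
apply/sqclass_eq0; first exact: Zi.
by rewrite -[i n.+1 u](subKr (i n.+1 u')) submodB.
Qed.
End LongExactSequence.

(** * Balancing Ext by a double complex *)

Section Zigzag.
Variables (k : fieldType) (T : nat -> nat -> lmodType k).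
Variables (S : forall p q, submodClosed (T p q)).
Variables (dh : forall p q, {linear T p q -> T p.+1 q}).
Variables (dv : forall p q, {linear T p q -> T p q.+1}).
Hypothesis dhS : forall p q f, f \in S p q -> dh p q f \in S p.+1 q.
Hypothesis dvS : forall p q f, f \in S p q -> dv p q f \in S p q.+1.
Hypothesis dhv : forall p q f, dv p.+1 q (dh p q f) = dh p q.+1 (dv p q f).
Hypothesis dhh : forall p q f, f \in S p q -> dh p.+1 q (dh p q f) = 0.
Hypothesis dvv : forall p q f, dv p q.+1 (dv p q f) = 0.
Hypothesis dh_exact : forall p q f, f \in S p.+1 q -> dh p.+1 q f = 0 ->
  exists2 g, g \in S p q & dh p q g = f.
Hypothesis dv_exact : forall p q f, f \in S p q.+1 -> dv p q.+1 f = 0 ->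
  exists2 g, g \in S p q & dv p q g = f.

Fixpoint addt p q := if p is p'.+1 then addt p' q.+1 else q.

(* [zigzag f c]: a staircase of the double complex leads from [f] in position
   (p, q) to [c] in position (0, p + q).  The tail-recursive sum makes the
   recursive call typecheck without casts. *)
Fixpoint zigzag p q : T p q -> T 0 (addt p q) -> Prop :=
  if p is p'.+1 return T p q -> T 0 (addt p q) -> Prop
  then fun f c => exists2 t, t \in S p' q & dh p' q t = f /\ zigzag (dv p' q t) c
  else fun f c => f = c.

Lemma zigzag_linear p q c f g (u v : T 0 (addt p q)) :
  zigzag f u -> zigzag g v -> zigzag (c *: f + g) (c *: u + v).
Proof.
elim: p q f g u v => [|p IH] q f g u v /=; first by move=> -> ->.
move=> [s Ss [<- zs]] [t St [<- zt]]; exists (c *: s + t); first by rewrite rpredD ?rpredZ.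
by rewrite !linearP; split=> //; apply: IH.
Qed.

(** Row exactness writes [f] as [dh t]; then [dv t], with [p] lowered and [q] raised by one, is
    again killed by both differentials. *)
Lemma zigzag_total p q f : f \in S p q -> dh p q f = 0 -> dv p q f = 0 ->
  exists c, [/\ c \in S 0 (addt p q), zigzag f c, dh _ _ c = 0 & dv _ _ c = 0].
Proof.
elim: p q f => [|p IH] q f Sf dhf dvf /=; first by exists f.
have [t St Et] := dh_exact Sf dhf.
have [||| c [Sc zc dhc dvc]] := IH q.+1 (dv p q t).
- exact: dvS.
- by rewrite -dhv Et.
- exact: dvv.
by exists c; split=> //; exists t.
Qed.

(** The staircase is climbed backwards: column exactness supplies [t], and [dh t] is the next
    position. *)
Lemma zigzag_onto p q (c : T 0 (addt p q)) : c \in S _ _ -> dh _ _ c = 0 -> dv _ _ c = 0 ->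
  exists f, [/\ f \in S p q, zigzag f c, dh _ _ f = 0 & dv _ _ f = 0].
Proof.
elim: p q c => [|p IH] q c Sc dhc dvc /=; first by exists c.
have [f [Sf zf dhf dvf]] := IH q.+1 c Sc dhc dvc.
have [t St Et] := dv_exact Sf dvf.
exists (dh p q t); split; rewrite ?dhS ?dhh ?dhv ?Et //.
by exists t => //; rewrite Et.
Qed.

(** In the application these are, at [q = 0], the coboundaries of the edge Hom(P, N); [vbound] plays
    the same role at [p = 0] for the edge Hom(X, I). *)
Definition hbound p q : T p q -> Prop :=
  if p is p'.+1 return T p q -> Prop
  then fun f => exists g, [/\ g \in S p' q, dv _ _ g = 0 & f = dh p' q g]
  else fun f => f = 0.

Definition vbound p q : T p q -> Prop :=
  if q is q'.+1 return T p q -> Prop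
  then fun f => exists g, [/\ g \in S p q', dh _ _ g = 0 & f = dv p q' g]
  else fun f => f = 0.

(** If [f = dh t = dv w] and [w = dh u], then [t - dv u] is killed by [dh] and has the same image
    under [dv] as [t]. *)
Lemma zigzag_vbound p q f (c : T 0 (addt p q.+1)) :
  zigzag f c -> vbound f -> vbound c.
Proof.
elim: p q f c => [|p IH] q f c /=; first by move=> ->.
move=> [t St [<- zt]] [w [Sw dhw E]]; apply: IH zt _.
have [u Su Eu] := dh_exact Sw dhw.
exists (t - dv p q u); rewrite !linearB /= dvv subr0; split=> //.
  by rewrite submodB ?dvS.
by rewrite E -dhv Eu subrr.
Qed.

Lemma zigzag_hbound p f (c : T 0 (addt p 0)) : zigzag f c -> hbound f -> vbound c.
Proof.
case: p f c => [|p] f c /=; first by move=> ->.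
move=> [t St [<- zt]] [a [Sa dva E]]; apply: zigzag_vbound zt _.
exists (t - a); split; first exact: submodB.
  by rewrite linearB /= E subrr.
by rewrite linearB /= dva subr0.
Qed.

(** The induction passes through positions where [p] and [q] are both positive, so both kinds of
    boundary must be allowed; for [q = 0] the vertical summand is 0. *)
Lemma zigzag_bound_inv p q f (c : T 0 (addt p q)) : zigzag f c -> vbound c ->
  exists g h, [/\ f = g + h, hbound g & vbound h].
Proof.
elim: p q f c => [|p IH] q f c /=.
  by move=> -> bc; exists 0, c; rewrite add0r.
move=> [t St [<- zt]] /(IH _ _ _ zt)[g [h [E hg [w [Sw dhw Eh]]]]].
(* It suffices to correct [t] to an element killed by [dv] without changing its image under [dh].
   The part [dv w] of [dv t] is removed by subtracting [w], and the part [dh a], with [a = dv b], by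
   subtracting [dh b]. *)
suff [u [Su dvu Eu]] : exists u, [/\ u \in S p q, dv _ _ u = 0 & dh _ _ u = dh _ _ t].
  exists (dh _ _ t), 0; rewrite addr0; split=> //; first by exists u.
  by case: (q) => [|q'] //=; exists 0; rewrite !linear0 rpred0.
rewrite {h}Eh in E.
clear f c zt; case: p IH t St g hg w Sw dhw E => [|p] _ t St g hg w Sw dhw E.
  rewrite hg add0r in E; exists (t - w); rewrite submodB // !linearB /= dhw subr0.
  by rewrite E subrr.
case: hg => a [Sa dva Ea]; have [b Sb Eb] := dv_exact Sa dva.
exists (t - w - dh _ _ b); rewrite !submodB ?dhS // !linearB /= dhw dhh ?subr0 //.
by rewrite E Ea dhv Eb addrK subrr.
Qed.

End Zigzag.

(** * Sub-bimodules and lifting through projectives *)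

Section SubBimodule.
Variables (k : fieldType) (A B : algType k) (X : bimod A B) (S : submodClosed X).
Hypothesis SL : forall a x, x \in S -> a *> x \in S.
Hypothesis SR : forall x b, x \in S -> x <* b \in S.

Definition sub_lact a (x : subspace S) : subspace S := Subspace (SL a (valP x)).
Definition sub_ract (x : subspace S) b : subspace S := Subspace (SR b (valP x)).

Definition subbimod : bimod A B.
Proof.
refine (@Bimod k A B (subspace S) sub_lact sub_ract _ _ _ _ _ _ _ _ _).
- by move=> m c x y; apply: val_inj; rewrite linearP /= lactDl lactZl.
- by move=> a c x y; apply: val_inj; rewrite [RHS]linearP; apply: lact_linr.
- by move=> a c x y; apply: val_inj; rewrite [RHS]linearP; apply: ract_linl.
- by move=> m c x y; apply: val_inj; rewrite linearP /= ractDr ractZr.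
- by move=> m; apply: val_inj; rewrite /= lact1.
- by move=> a a' m; apply: val_inj; rewrite /= lactA.
- by move=> m; apply: val_inj; rewrite /= ract1.
- by move=> a a' m; apply: val_inj; rewrite /= ractA.
- by move=> a a' m; apply: val_inj; rewrite /= lractA.
Defined.

End SubBimodule.

Section BihomTheory.
Variables (k : fieldType) (A B : algType k).
Implicit Types X Y Z : bimod A B.

Lemma bihomsP X Y (f : X -> Y) : (f \in bihoms (X := X) (Y := Y)) <-> bihom f.
Proof. by rewrite unfold_in; split=> [/asboolP|?] //; apply/asboolP. Qed.

Lemma bihom_comp X Y Z (g : Y -> Z) (f : X -> Y) : bihom g -> bihom f -> bihom (g \o f).
Proof.
move=> [lg ag bg] [lf af bf]; split=> [c x y|a x|x b] /=.
- by rewrite lf lg.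
- by rewrite af ag.
- by rewrite bf bg.
Qed.

Lemma bihom0 X Y (f : X -> Y) : bihom f -> f 0 = 0.
Proof.
move=> [lf _ _]; exact: (linear_eq0 lf).
Qed.

Lemma bihomB X Y (f : X -> Y) x y : bihom f -> f (x - y) = f x - f y.
Proof. by move=> [lf _ _]; rewrite addrC -scaleN1r lf scaleN1r addrC. Qed.

Lemma bihom_inj X Y (f : X -> Y) : bihom f -> (forall x, f x = 0 -> x = 0) -> injective f.
Proof.
move=> hf f0 x y E; apply/eqP; rewrite -subr_eq0; apply/eqP/f0.
by rewrite bihomB // E subrr.
Qed.

(** [projective] lifts only along surjections, so [d] is corestricted to the kernel of [d'], a
    sub-bimodule onto which it is surjective. *)
Lemma projective_lift (P X Y : bimod A B) (Z : bimod A B) (d : X -> Y) (d' : Y -> Z) (f : P -> Y) :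
  projective P -> bihom d -> bihom d' -> bihom f -> 
  (forall y, d' y = 0 -> exists x, d x = y) -> (forall x, d' (d x) = 0) -> (forall u, d' (f u) = 0) ->
  exists2 g : P -> X, bihom g & forall u, d (g u) = f u.
Proof.
move=> Pproj hd hd' hf ker dd df.
have KC : submod_closed (fun y : Y => `[< d' y = 0 >]).
  split=> [|c x y /asboolP dx /asboolP dy]; apply/asboolP; first exact: bihom0.
  by case: (hd') => -> _ _; rewrite dx dy scaler0 addr0.
pose K : submodClosed Y := HB.pack (fun y : Y => `[< d' y = 0 >])
  (GRing.isSubmodClosed.Build k Y _ KC).
have KL a x : x \in K -> a *> x \in K.
  by rewrite !unfold_in => /asboolP E; apply/asboolP; case: (hd') => _ -> _; rewrite E lactm0.
have KR x b : x \in K -> x <* b \in K.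
  by rewrite !unfold_in => /asboolP E; apply/asboolP; case: (hd') => _ _ ->; rewrite E ract0m.
have Kd x : d x \in K by rewrite unfold_in; apply/asboolP.
have Kf u : f u \in K by rewrite unfold_in; apply/asboolP.
have [|||g hg E] := Pproj X (subbimod KL KR) (fun x => Subspace (Kd x)) (fun u => Subspace (Kf u)).
- case: hd => ld ad bd; split=> [c x y|a x|x b]; apply: val_inj; rewrite ?linearP /=.
  + exact: ld.
  + exact: ad.
  + exact: bd.
- case=> y Ky; have [|x Ex] := ker y; first by move: Ky; rewrite unfold_in => /asboolP.
  by exists x; apply: val_inj.
- case: hf => ld ad bd; split=> [c x y|a x|x b]; apply: val_inj; rewrite ?linearP /=.
  + exact: ld.
  + exact: ad.
  + exact: bd.
by exists g => // u; have /(congr1 val) := E u.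
Qed.
End BihomTheory.

Section Balancing.
Variables (k : fieldType) (A B : algType k) (X : bimod A B) (P : proj_resolution X).
Variables (N : bimod A B) (I : nat -> bimod A B) (eta : N -> I 0).
Variable delta : forall n, I n -> I n.+1.
Arguments delta : clear implicits.
Hypothesis eta_hom : bihom eta.
Hypothesis delta_hom : forall n, bihom (delta n).
Hypothesis eta_inj : forall x, eta x = 0 -> x = 0.
Hypothesis delta_eta : forall x, delta 0 (eta x) = 0.
Hypothesis delta_delta : forall n x, delta n.+1 (delta n x) = 0.
Hypothesis eta_exact : forall y, delta 0 y = 0 -> exists x, eta x = y.
Hypothesis delta_exact : forall n y, delta n.+1 y = 0 -> exists x, delta n x = y.
Hypothesis aug_exact : forall q (f : pres P 0 -> I q), bihom f ->
  (forall x, f (pdiff x) = 0) -> exists2 g : X -> I q, bihom g & forall x, f x = g (paug x).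
Hypothesis res_exact : forall p q (f : pres P p.+1 -> I q), bihom f ->
  (forall x, f (pdiff x) = 0) ->
  exists2 g : pres P p -> I q, bihom g & forall x, f x = g (pdiff x).

Definition post_delta n (f : X -> I n) : X -> I n.+1 := fun x => delta n (f x).

Fact post_delta_linear n : linear (@post_delta n).
Proof.
by move=> c f g; apply: funext => x; case: (delta_hom n) => l _ _; apply: l.
Qed.

HB.instance Definition _ n := GRing.isLinear.Build k (X -> I n) (X -> I n.+1) _
  (@post_delta n) (@post_delta_linear n).

Definition hom_cochains : cochains k :=
  @Cochains k (fun n => X -> I n) (fun n => @bihoms k A B X (I n)) (fun n => @post_delta n).

Let dv p q (f : pres P p -> I q) : pres P p -> I q.+1 := fun x => delta q (f x).
Let dv_linear p q : linear (@dv p q).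
Proof.
by move=> c f g; apply: funext => x; case: (delta_hom q) => l _ _; apply: l.
Qed.
HB.instance Definition _ p q := GRing.isLinear.Build k (pres P p -> I q) (pres P p -> I q.+1) _
  (@dv p q) (@dv_linear p q).

Let T p q : lmodType k := pres P p -> I q.
Let S p q : submodClosed (T p q) := @bihoms k A B (pres P p) (I q).
Let dhT p q : {linear T p q -> T p.+1 q} := @ext_diff k A B X P (I q) p.
Let dvT p q : {linear T p q -> T p q.+1} := @dv p q.

Let eta_lift p (f : pres P p -> I 0) : bihom f -> (forall x, delta 0 (f x) = 0) ->
  exists2 a : pres P p -> N, bihom a & f = (fun x => eta (a x)).
Proof.
move=> [lf af bf] df; have H x := eta_exact (df x).
pose a x := projT1 (cid (H x)); have aE x : eta (a x) = f x := projT2 (cid (H x)).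
have eI := bihom_inj eta_hom eta_inj; case: eta_hom => le ae be.
exists a; last by apply: funext => x; rewrite aE.
split=> [c x y|b x|x b]; apply: eI.
- by rewrite le !aE lf.
- by rewrite ae !aE af.
- by rewrite be !aE bf.
Qed.

Let dhS p q f : f \in S p q -> dhT p q f \in S p.+1 q.
Proof. by move/bihomsP=> hf; apply/bihomsP/(bihom_comp hf)/pdiff_hom. Qed.
Let dvS p q f : f \in S p q -> dvT p q f \in S p q.+1.
Proof. by move/bihomsP=> hf; apply/bihomsP/(bihom_comp _ hf)/delta_hom. Qed.
Let dhv p q f : dvT p.+1 q (dhT p q f) = dhT p q.+1 (dvT p q f).
Proof. by []. Qed.
Let dhh p q f : f \in S p q -> dhT p.+1 q (dhT p q f) = 0.
Proof.
move/bihomsP=> hf; apply: funext => x; rewrite -[LHS]/(f (pdiff (pdiff x))).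
by have -> : pdiff (pdiff x) = 0; [apply/pdiff_exact; exists x | rewrite bihom0].
Qed.
Let dvv p q f : dvT p q.+1 (dvT p q f) = 0.
Proof. by apply: funext => x; apply: delta_delta. Qed.
Let dv_exact p q f : f \in S p q.+1 -> dvT p q.+1 f = 0 ->
  exists2 g, g \in S p q & dvT p q g = f.
Proof.
move=> /bihomsP hf df.
have du u : delta q.+1 (f u) = 0 by have := congr1 (fun F => F u) df.
have [g hg E] := projective_lift (@pres_proj _ _ _ _ P p) (delta_hom q) (delta_hom q.+1) hf
  (@delta_exact q) (@delta_delta q) du.
by exists g; [apply/bihomsP | apply: funext].
Qed.
Let dh_exact p q f : f \in S p.+1 q -> dhT p.+1 q f = 0 ->
  exists2 g, g \in S p q & dhT p q g = f.
Proof.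
move=> /bihomsP hf df; have [|g hg E] := res_exact hf.
  by move=> x; have := congr1 (fun F => F x) df.
by exists g; [apply/bihomsP | apply: funext => x; rewrite E].
Qed.

(** [e] and [r] identify the edge complexes Hom(P, N) and Hom(X, I) with the kernel of [dv] at q = 0
    and the kernel of [dh] at p = 0. *)
Let e p (a : pres P p -> N) : T p 0 := fun x => eta (a x).
Let r q (c : X -> I q) : T 0 q := fun x => c (paug x).

Let rS q c : c \in bihoms (Y := I q) -> r c \in S 0 q.
Proof. by move/bihomsP=> hc; apply/bihomsP/(bihom_comp hc)/paug_hom. Qed.
Let eS p a : a \in bihoms (X := pres P p) (Y := N) -> e a \in S p 0.
Proof. by move/bihomsP=> ha; apply/bihomsP/(bihom_comp _ ha). Qed.
Let dhr q c : c \in bihoms (Y := I q) -> dhT 0 q (r c) = 0.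
Proof.
move/bihomsP=> hc; apply: funext => x; rewrite -[LHS]/(c (paug (pdiff x))).
by have -> : paug (pdiff x) = 0; [apply/paug_exact; exists x | rewrite bihom0].
Qed.
Let r_inj q : injective (@r q).
Proof.
move=> c c' E; apply: funext => x; have [p <-] := paug_surj P x.
exact: (congr1 (fun F => F p) E).
Qed.
Let e_inj p : injective (@e p).
Proof.
move=> a b E; apply: funext => x; apply: (bihom_inj eta_hom eta_inj).
exact: (congr1 (fun F => F x) E).
Qed.
Let rW q f : f \in S 0 q -> dhT 0 q f = 0 -> exists2 c, c \in bihoms (Y := I q) & f = r c.
Proof.
move=> /bihomsP hf df; have [|c hc E] := aug_exact hf.
  by move=> x; exact: (congr1 (fun F => F x) df).
by exists c; [apply/bihomsP | apply: funext].
Qed.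
Let eW p f : f \in S p 0 -> dvT p 0 f = 0 ->
  exists2 a, a \in bihoms (X := pres P p) (Y := N) & f = e a.
Proof.
move=> /bihomsP hf df; have [|a ha E] := eta_lift hf.
  by move=> x; exact: (congr1 (fun F => F x) df).
by exists a; [apply/bihomsP | ].
Qed.
Let dve p a : dvT p 0 (e a) = 0.
Proof. by apply: funext => x; apply: delta_eta. Qed.
Let r0 q : @r q 0 = 0. Proof. by []. Qed.
Let e0 p : @e p 0 = 0.
Proof. by apply: funext => x; apply: (bihom0 eta_hom). Qed.

Let vboundP q c : c \in bihoms (Y := I q) ->
  vbound S dhT dvT (r c) <-> c \in @coboundaries k hom_cochains q.
Proof.
case: q c => [|q] c Sc /=.
  by split=> [/(@r_inj 0 c 0) ->|/(@coboundaries0P k hom_cochains) ->]; first exact/(@coboundaries0P k hom_cochains).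
split=> [[w [Sw dw E]]|/(@coboundariesSP k hom_cochains)[b Sb ->]].
  have [b Sb Eb] := rW Sw dw; apply/(@coboundariesSP k hom_cochains); exists b => //.
  by apply: r_inj; rewrite E Eb.
by exists (r b); rewrite rS ?dhr.
Qed.

Let hboundP p a : a \in bihoms (X := pres P p) (Y := N) ->
  hbound S dhT dvT (e a) <-> a \in @coboundaries k (ext_cochains P N) p.
Proof.
case: p a => [|p] a Sa /=.
  split=> [|/(@coboundaries0P k (ext_cochains P N)) ->]; last by rewrite e0.
  by rewrite -[X in _ = X](e0 0) => /e_inj ->; apply/(@coboundaries0P k (ext_cochains P N)).
split=> [[w [Sw dw E]]|/(@coboundariesSP k (ext_cochains P N))[b Sb ->]].
  have [b Sb Eb] := eW Sw dw; apply/(@coboundariesSP k (ext_cochains P N)); exists b => //.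
  by apply: e_inj; rewrite E Eb.
by exists (e b); rewrite eS ?dve.
Qed.

Lemma balancing n : liso (Ext P N n) (cohomology hom_cochains n).
Proof.
have addt0 p q : addt p q = (p + q)%N by elim: p q => [|p IH] q //=; rewrite IH addSnnS.
(* [addt n 0] equals [n] only propositionally; generalising the degree on one side avoids
   transporting cohomology along this equation. *)
suff main m : addt n 0 = m -> liso (Ext P N n) (cohomology hom_cochains m).
  by apply: main; rewrite addt0 addn0.
move=> <-.
have zt := zigzag_total dvS dhv dvv dh_exact.
have zo := zigzag_onto dhS dhv dhh dv_exact.
have [le _ _] := eta_hom.
apply: (sq_reliso2 (R := fun a c => zigzag S dhT dvT (e a) (r c))).
- move=> c a b u v Ra Rb; have := zigzag_linear c Ra Rb.
  suff -> : c *: e a + e b = e (c *: a + b) by [].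
  by apply: funext => x; apply/esym/le.
- move=> a /cocyclesP[Sa da]; have [|c [Sc zc dhc dvc]] := zt n 0 (e a) (eS Sa) _ (dve a).
    by apply: funext => x; rewrite -[RHS]/(0 : I 0) -(bihom0 eta_hom); exact: (congr1 (fun F => eta (F x)) da).
  have [b Sb Eb] := rW Sc dhc; exists b; last by rewrite -Eb.
  by apply/cocyclesP; split=> //; apply: r_inj; rewrite r0 -dvc Eb.
- move=> a c /cocyclesP[Sa da] /cocyclesP[Sc dc] z /hboundP => /(_ Sa) ha.
  by apply/vboundP => //; apply: zigzag_hbound z ha.
- move=> c /cocyclesP[Sc dc]; have [|f [Sf z dhf dvf]] := zo n 0 (r c) (rS Sc) (dhr Sc).
    by apply: funext => x; exact: (congr1 (fun F => F (paug x)) dc).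
  have [a Sa Ea] := eW Sf dvf; exists a; last by rewrite -Ea.
  apply/cocyclesP; split=> //; apply: e_inj; rewrite e0 -dhf Ea //.
- move=> a c /cocyclesP[Sa da] /cocyclesP[Sc dc] z /vboundP => /(_ Sc) bc.
  apply/hboundP => //.
  by have [g [h [-> hg /= ->]]] := zigzag_bound_inv dhS dhv dhh dv_exact z bc; rewrite addr0.
Qed.
End Balancing.

(** * The relative bar complex *)

Section Faces.
Variables (k : fieldType) (L : algType k).
Implicit Types (x : nat -> L) (u : L).

Definition upd x i u : nat -> L := fun j => if j == i then u else x j.

(** On infinite sequences the simplicial identities are plain equalities, with no index type that
    depends on the number of arguments. *)
Definition face i x : nat -> L := fun j =>
  if (j < i)%N then x j else if j == i then x i * x i.+1 else x j.+1.

Ltac face_solve := apply: funext => l; rewrite /face /upd;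
  repeat match goal with |- context [if ?b then _ else _] => destruct b eqn:? end;
  rewrite -?mulrA; first [reflexivity | exfalso; lia | repeat f_equal; lia].

Lemma upd_upd x i u v : upd (upd x i u) i v = upd x i v.
Proof. face_solve. Qed.

Lemma upd_comm x i j u v : i != j -> upd (upd x i u) j v = upd (upd x j v) i u.
Proof. move=> ij; face_solve. Qed.

Lemma upd_id x i : upd x i (x i) = x.
Proof. by apply: funext => l; rewrite /upd; case: eqP => // ->. Qed.

Lemma upd_eq x i u : upd x i u i = u. Proof. by rewrite /upd eqxx. Qed.

Lemma upd_neq x i j u : j != i -> upd x i u j = x j.
Proof. by rewrite /upd => /negPf->. Qed.

Lemma face_upd_lt j x i u : (j.+1 < i)%N -> face j (upd x i u) = upd (face j x) i.-1 u.
Proof. move=> ji; face_solve. Qed.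

Lemma face_upd_gt j x i u : (i < j)%N -> face j (upd x i u) = upd (face j x) i u.
Proof. move=> ji; face_solve. Qed.

Lemma face_upd_eq j x u : face j (upd x j u) = upd (face j x) j (u * x j.+1).
Proof. face_solve. Qed.

Lemma face_updS j x u : face j (upd x j.+1 u) = upd (face j x) j (x j * u).
Proof. face_solve. Qed.

Lemma face_face i j x : (j < i)%N -> face j (face i x) = face i.-1 (face j x).
Proof. move=> ji; face_solve. Qed.

End Faces.

Section BimoduleSums.
Variables (k : fieldType) (A B : algType k) (X : bimod A B).

Lemma lact_sum (J : Type) (r : seq J) (F : J -> X) a :
  a *> (\sum_(j <- r) F j) = \sum_(j <- r) a *> F j.
Proof. by apply: (big_morph (lact a)) => [x y|]; rewrite ?lactDr ?lactm0. Qed.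

Lemma ract_sum (J : Type) (r : seq J) (F : J -> X) b :
  (\sum_(j <- r) F j) <* b = \sum_(j <- r) F j <* b.
Proof. by apply: (big_morph (fun m => m <* b)) => [x y|]; rewrite ?ractDl ?ract0m. Qed.

Lemma sum_lact (J : Type) (r : seq J) (F : J -> A) (m : X) :
  (\sum_(j <- r) F j) *> m = \sum_(j <- r) F j *> m.
Proof. by apply: (big_morph (fun a => a *> m)) => [x y|]; rewrite ?lactDl ?lact0m. Qed.
End BimoduleSums.

(* Cochains of the bar complex relative to the idempotents [e v]: an [n]-cochain
   is an [L]-bilinear map on [L (x)_E ... (x)_E L] ([n.+2] factors), encoded as a
   function of infinite sequences that only reads the coordinates [0 .. n.+1]. *)
Section BarCochains.
Variables (k : fieldType) (L : algType k) (V : Type) (e : V -> L).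

Section Coefficients.
Variable N : bimod L L.
Implicit Types (g : (nat -> L) -> N) (x y : nat -> L).

Definition is_coind n g : Prop :=
  [/\ forall x y, (forall i, (i < n.+2)%N -> x i = y i) -> g x = g y,
      forall i x, (i < n.+2)%N -> linear (fun u => g (upd x i u)),
      forall x b, g (upd x 0 (b * x 0%N)) = b *> g x
    & forall x i v, (i <= n)%N ->
        g (upd x i (x i * e v)) = g (upd x i.+1 (e v * x i.+1))].

Definition is_bar n g : Prop :=
  is_coind n g /\ forall x b, g (upd x n.+1 (x n.+1 * b)) = g x <* b.

Definition dbar n g : (nat -> L) -> N :=
  fun x => \sum_(i < n.+2) (-1) ^+ i *: g (face i x).

Fact dbar_linear n : linear (@dbar n).
Proof.
move=> c f g; apply: funext => x; rewrite -[RHS]/(c *: dbar n f x + dbar n g x).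
rewrite /dbar scaler_sumr -big_split; apply: eq_bigr => i _ /=.
by rewrite -[(c *: f + g) _]/(c *: f _ + g _) scalerDr !scalerA mulrC.
Qed.

HB.instance Definition _ n := GRing.isLinear.Build k
  ((nat -> L) -> N) ((nat -> L) -> N) _ (@dbar n) (@dbar_linear n).

Lemma dbar_coind n g : is_coind n g -> is_coind n.+1 (dbar n g).
Proof.
move=> [loc lin lac bal]; split.
- move=> x y E; apply: eq_bigr => i _; congr (_ *: _); apply: loc => j ji.
  rewrite /face; case: ifP => // _; first by apply: E; lia.
  by rewrite !E //; have := ltn_ord i; lia.
- move=> i x ilt c u v; rewrite /dbar scaler_sumr -big_split; apply: eq_bigr => j _ /=.
  rewrite scalerA [c * _]mulrC -scalerA -scalerDr; congr (_ *: _).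
  have := ltn_ord j; have [ji|ji|<-|->] : [\/ (j.+1 < i)%N, (i < j)%N, j = i :> nat | i = j.+1 :> nat].
  + case: (ltngtP j.+1 i) => h; [exact: Or41| |exact: Or44].
    by case: (ltngtP i j) => h'; [exact: Or42| lia | exact: Or43].
  + by move=> jn; rewrite !face_upd_lt // lin //; lia.
  + by move=> jn; rewrite !face_upd_gt // lin //; lia.
  + by move=> jn; rewrite !face_upd_eq mulrDl -scalerAl lin.
  + by move=> jn; rewrite !face_updS mulrDr -scalerAr lin.
- move=> x b; rewrite /dbar lact_sum; apply: eq_bigr => -[[|i] ilt] _ /=.
    by rewrite lactZr face_upd_eq -mulrA -lac.
  by rewrite lactZr face_upd_gt // -lac.
- move=> x i v ilt; apply: eq_bigr => j _; congr (_ *: _).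
  case: (ltngtP j i) => ji.
  + case: i ilt ji => // i ilt; rewrite ltnS leq_eqVlt => /orP[/eqP ->|ji].
      rewrite face_updS face_upd_lt //= mulrA.
      have -> : x i * x i.+1 = face i x i by rewrite /face ltnn eqxx.
      have -> : x i.+2 = face i x i.+1 by rewrite /face; case: ifP; [lia|case: ifP => //; lia].
      by rewrite bal.
    rewrite !face_upd_lt //=; last by lia.
    have -> : x i.+1 = face j x i by rewrite /face; case: ifP; [lia|case: ifP => //; lia].
    have -> : x i.+2 = face j x i.+1 by rewrite /face; case: ifP; [lia|case: ifP => //; lia].
    by rewrite bal.
  + rewrite face_upd_gt //; have [->|ij] := eqVneq (j : nat) i.+1.
      rewrite face_upd_eq -mulrA.
      have -> : x i.+1 * x i.+2 = face i.+1 x i.+1 by rewrite /face ltnn eqxx.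
      have -> : x i = face i.+1 x i by rewrite /face ltnSn.
      by rewrite bal //; have := ltn_ord j; lia.
    rewrite face_upd_gt; last by lia.
    have -> : x i = face j x i by rewrite /face ji.
    have -> : x i.+1 = face j x i.+1 by rewrite /face; case: ifP => //; lia.
    by rewrite bal //; have := ltn_ord j; lia.
  + by rewrite ji face_upd_eq face_updS mulrA.
Qed.

Lemma dbar_ract n g : (forall x b, g (upd x n.+1 (x n.+1 * b)) = g x <* b) ->
  forall x b, dbar n g (upd x n.+2 (x n.+2 * b)) = dbar n g x <* b.
Proof.
move=> rac x b; rewrite /dbar ract_sum; apply: eq_bigr => i _.
rewrite ractZl -rac; congr (_ *: g _).
have := ltn_ord i; rewrite ltnS leq_eqVlt => /orP[/eqP ->|ilt].
  by rewrite face_updS mulrA /face ltnn eqxx.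
rewrite face_upd_lt //; congr upd; rewrite /face.
by case: ifP; [lia|case: ifP => //; lia].
Qed.

Lemma dbar_bar n g : is_bar n g -> is_bar n.+1 (dbar n g).
Proof. by move=> [cg rg]; split; [apply: dbar_coind | apply: dbar_ract]. Qed.

Lemma dbar_dbar n g : dbar n.+1 (dbar n g) = 0.
Proof.
apply: funext => x; rewrite -[RHS]/(0 : N) /dbar.
pose G i j := (-1) ^+ (i + j) *: g (face j (face i x)).
have GS m j : (j <= m)%N -> G m.+1 j + G j m = 0.
  move=> jm; rewrite /G face_face // -scalerDl [(j + m)%N]addnC addSn exprS mulN1r.
  by rewrite addNr scale0r.
(* From one rectangle of indices to the next, the new row [i = m.+1] and the new column [j = m]
   cancel term by term, by [GS]. *)
have E (m : nat) : \sum_(i < m.+1) \sum_(j < m) G i j = 0.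
  elim: m => [|m IH]; first by rewrite big1 // => i _; rewrite big_ord0.
  rewrite big_ord_recr /= (eq_bigr _ (fun i _ => big_ord_recr _ _)) /= big_split /= IH add0r.
  by rewrite -big_split big1 // => j _; rewrite /= addrC GS // -ltnS.
rewrite -[RHS](E n.+2); apply: eq_bigr => i _.
by rewrite scaler_sumr; apply: eq_bigr => j _; rewrite scalerA -exprD.
Qed.

Definition bar_pred n : {pred (nat -> L) -> N} := fun g => `[< is_bar n g >].
Definition coind_pred n : {pred (nat -> L) -> N} := fun g => `[< is_coind n g >].

Lemma is_coind_lin n c f g : is_coind n f -> is_coind n g -> is_coind n (c *: f + g).
Proof.
have E x : (c *: f + g) x = c *: f x + g x by [].
move=> [floc flin flac fbal] [gloc glin glac gbal]; split=> [x y xy|i x ilt d u v|x b|x i v ilt].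
- by rewrite !E (floc _ _ xy) (gloc _ _ xy).
- by rewrite !E flin // glin // !scalerDr !scalerA [c * d]mulrC addrACA.
- by rewrite !E flac glac lactDr lactZr.
- by rewrite !E fbal // gbal.
Qed.

Lemma is_coind0 n : is_coind n 0.
Proof.
split=> // [i x ilt c u v|x b]; first by rewrite -[RHS]/(c *: 0 + 0) scaler0 addr0.
by rewrite -[RHS]/(b *> 0) lactm0.
Qed.

Fact coind_closed n : submod_closed (@coind_pred n).
Proof.
split=> [|c f g /asboolP Cf /asboolP Cg]; apply/asboolP; first exact: is_coind0.
exact: is_coind_lin.
Qed.

Fact bar_closed n : submod_closed (@bar_pred n).
Proof.
split=> [|c f g /asboolP[Cf rf] /asboolP[Cg rg]]; apply/asboolP.
  by split=> [|x b]; [exact: is_coind0 | rewrite -[RHS]/(0 <* b) ract0m].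
split=> [|x b]; first exact: is_coind_lin.
by rewrite -[LHS]/(c *: f _ + g _) rf rg ractDl ractZl.
Qed.

HB.instance Definition _ n := GRing.isSubmodClosed.Build k ((nat -> L) -> N)
  (@coind_pred n) (@coind_closed n).
HB.instance Definition _ n := GRing.isSubmodClosed.Build k ((nat -> L) -> N)
  (@bar_pred n) (@bar_closed n).

Definition bar_cochains : cochains k :=
  @Cochains k (fun=> ((nat -> L) -> N)) (fun n => @bar_pred n) (fun n => @dbar n).

Lemma bar_predP n g : (g \in bar_pred n) <-> is_bar n g.
Proof. by rewrite unfold_in; split=> /asboolP. Qed.

Lemma coind_predP n g : (g \in coind_pred n) <-> is_coind n g.
Proof. by rewrite unfold_in; split=> /asboolP. Qed.

(** The last argument is free to carry the left action, since right linearity in it is not imposed;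
    the right action is on the values. *)
Definition coind_lact_fun (n : nat) (a : L) (g : (nat -> L) -> N) : (nat -> L) -> N :=
  fun x => g (upd x n.+1 (x n.+1 * a)).
Definition coind_ract_fun (g : (nat -> L) -> N) (b : L) : (nat -> L) -> N :=
  fun x => g x <* b.

Lemma coind_lact_subproof n a (g : subspace (coind_pred n)) :
  coind_lact_fun n a (val g) \in coind_pred n.
Proof.
apply/coind_predP; case: g => g /= /coind_predP[loc lin lac bal].
rewrite /coind_lact_fun; split=> [x y xy|i x ilt c u v|x b|x i v ilt].
- by apply: loc => i ilt; rewrite /upd; case: eqP => // _; rewrite !xy.
- have [->|ni] := eqVneq i n.+1.
    by rewrite !upd_eq !upd_upd mulrDl -scalerAl lin.
  by rewrite ![upd (upd x i _) _ _]upd_comm // !upd_neq 1?eq_sym // lin.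
- by rewrite upd_comm // upd_neq // -[x 0%N in LHS](@upd_neq k L x n.+1 0 (x n.+1 * a)) // lac.
- have [Ei|ni] := eqVneq i n.
    rewrite Ei upd_comm ?neq_ltn ?ltnSn // upd_neq ?neq_ltn ?ltnSn ?orbT // upd_eq upd_upd.
    rewrite -[x n in LHS](@upd_neq k L x n.+1 n (x n.+1 * a)) ?neq_ltn ?ltnSn //.
    by rewrite bal // upd_upd upd_eq mulrA.
  rewrite ![upd (upd x _ _) n.+1 _]upd_comm //; try lia.
  rewrite !upd_neq; try lia.
  rewrite -[x i in LHS](@upd_neq k L x n.+1 i (x n.+1 * a)); last by lia.
  by rewrite -[x i.+1 in RHS](@upd_neq k L x n.+1 i.+1 (x n.+1 * a)) ?bal //; lia.
Qed.

Lemma coind_ract_subproof n (g : subspace (coind_pred n)) b :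
  coind_ract_fun (val g) b \in coind_pred n.
Proof.
apply/coind_predP; case: g => g /= /coind_predP[loc lin lac bal].
rewrite /coind_ract_fun; split=> [x y xy|i x ilt c u v|x c|x i v ilt].
- by rewrite (loc _ _ xy).
- by rewrite lin // ractDl ractZl.
- by rewrite lac lractA.
- by rewrite bal.
Qed.

Definition coind_lact (n : nat) a (g : subspace (coind_pred n)) : subspace (coind_pred n) :=
  Subspace (coind_lact_subproof a g).
Definition coind_ract (n : nat) (g : subspace (coind_pred n)) b : subspace (coind_pred n) :=
  Subspace (coind_ract_subproof g b).

(* The bimodule with Hom_{L-L}(P, coind n) = Hom_{E-L}(L^(x)n (x)_E P, N). *)
Definition coind (n : nat) : bimod L L.
Proof.
refine (@Bimod k L L (subspace (coind_pred n)) (@coind_lact n) (@coind_ract n) _ _ _ _ _ _ _ _ _).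
- move=> g c a b; apply: val_inj; rewrite linearP; apply: funext => x /=.
  have /coind_predP[_ lin _ _] := valP g; rewrite /coind_lact_fun mulrDr -scalerAr.
  exact: lin.
- by move=> a c f g; apply: val_inj; rewrite [RHS]linearP.
- by move=> b c f g; apply: val_inj; rewrite [RHS]linearP; apply: funext => x; apply: ract_linl.
- by move=> g c a b; apply: val_inj; rewrite [RHS]linearP; apply: funext => x; apply: ract_linr.
- by move=> g; apply: val_inj; apply: funext => x; rewrite /= /coind_lact_fun mulr1 upd_id.
- move=> a b g; apply: val_inj; apply: funext => x.
  by rewrite /= /coind_lact_fun /= /coind_lact_fun upd_upd upd_eq mulrA.
- by move=> g; apply: val_inj; apply: funext => x; rewrite /= /coind_ract_fun ract1.
- by move=> g a b; apply: val_inj; apply: funext => x; rewrite /= /coind_ract_fun ractA.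
- by move=> a g b; apply: val_inj.
Defined.

End Coefficients.
End BarCochains.

(** * Splittings over the idempotents *)

(** Over a field the kernel has a complement: by Zorn there is a maximal subspace [S] meeting it
    only in 0, and [D] maps [S] bijectively onto its image. Nothing is claimed about [t] off this
    image. *)
Lemma linear_section (k : fieldType) (U V : lmodType k) (D : {linear U -> V}) :
  exists t : V -> U, (forall u, D (t (D u)) = D u) /\
    (forall c u u', t (c *: D u + D u') = c *: t (D u) + t (D u')).
Proof.
pose stable (S : set U) := forall c x y, S x -> S y -> S (c *: x + y).
pose P (S : set U) := stable S /\ forall x, S x -> D x = 0 -> x = 0.
have [|S [[Slin Sker] Smax]] := @Zorn_bigcup U P.
  move=> F FP Ftot; split=> [c x y [X FX Xx] [Y FY Yy]|x [X FX Xx]]; last first.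
    by have [_] := FP _ FX; apply.
  have [XY|YX] := Ftot _ _ FX FY.
    by exists Y => //; have [sY _] := FP _ FY; apply: sY => //; apply: XY.
  by exists X => //; have [sX _] := FP _ FX; apply: sX => //; apply: YX.
(* The union of the empty chain must satisfy [P], so [P] admits the empty set. A stable set without
   0 is empty, and then the set containing only 0 is larger. *)
have S0 : S 0.
  apply: contrapT => nS0; apply: (Smax (S `|` [set 0])%classic).
    split=> [x Sx|/(_ 0)]; first by left.
    by move=> H; apply/nS0/H; right.
  have noS x : ~ S x.
    move=> Sx; apply: nS0; have := Slin (-1) x x Sx Sx.
    by rewrite scaleN1r addNr.
  split=> [c x y|x]; first by case=> [/noS//|->] [/noS//|->]; right; rewrite scaler0 addr0.
  by case=> [/noS//|->].
have SZ c x : S x -> S (c *: x) by move=> Sx; rewrite -[_ *: _]addr0; apply: Slin.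
have ex u : exists2 s, S s & D s = D u.
  apply: contrapT => nex.
  (* If no element of [S] has the image of [u], then [S + k u] still meets the kernel only in 0,
     against maximality. *)
  pose S' : set U := [set x | exists s c, S s /\ x = s + c *: u]%classic.
  apply: (Smax S').
    split=> [x Sx|SS']; first by exists x, 0; rewrite scale0r addr0.
    by apply: nex; exists u => //; apply: SS'; exists 0, 1; rewrite scale1r add0r.
  split=> [c _ _ [s [a [Ss ->]]] [s' [a' [Ss' ->]]]|_ [s [c [Ss ->]]]].
    exists (c *: s + s'), (c * a + a'); split; first exact: Slin.
    by rewrite scalerDr scalerA scalerDl addrACA.
  rewrite linearD linearZ /=; have [-> |c0] := eqVneq c 0.
    by rewrite !scale0r !addr0; apply: Sker.
  move=> E; case: nex; exists (- c^-1 *: s); first exact: SZ.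
  rewrite linearZ /=; apply: (scalerI c0); rewrite scalerA mulrN divff // scaleN1r.
  by apply/eqP; rewrite eq_sym -subr_eq0 opprK addrC E.
have uniq s s' : S s -> S s' -> D s = D s' -> s = s'.
  move=> Ss Ss' E; apply/eqP; rewrite -subr_eq0; apply/eqP; apply: Sker.
    by rewrite addrC -scaleN1r; apply: Slin.
  by rewrite linearB /= E subrr.
have exV v : exists s, (exists u, v = D u) -> S s /\ D s = v.
  have [[u ->]|nv] := EM (exists u, v = D u); last by exists 0.
  by have [s Ss Es] := ex u; exists s.
pose t v := projT1 (cid (exV v)).
have tE u : S (t (D u)) /\ D (t (D u)) = D u.
  by have := projT2 (cid (exV (D u))); apply; exists u.
exists t; split=> [u|c u u']; first by have [] := tE u.
rewrite -linearP; have [S1 E1] := tE (c *: u + u').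
have [S2 E2] := tE u; have [S3 E3] := tE u'.
by apply: uniq => //; [apply: Slin | rewrite E1 !linearP /= E2 E3].
Qed.

(* [Hom_k(L, U)], with [(a g)(x) = g(x a)]: bimodule maps to it from [P]
   correspond to right linear maps from [P] to [U]. *)
Section Coinduced.
Variables (k : fieldType) (L B : algType k) (U : bimod L B).

Definition homk_pred : {pred L -> U} := fun g => `[< linear g >].

Fact homk_closed : submod_closed homk_pred.
Proof.
split=> [|c f g /asboolP lf /asboolP lg]; apply/asboolP => d x y.
  by rewrite -[RHS]/(d *: 0 + 0) scaler0 addr0.
rewrite -[LHS]/(c *: f _ + g _) lf lg -[RHS]/(d *: (c *: f x + g x) + (c *: f y + g y)).
by rewrite !scalerDr !scalerA [c * d]mulrC addrACA.
Qed.

HB.instance Definition _ := GRing.isSubmodClosed.Build k (L -> U) homk_pred homk_closed.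

Lemma homk_predP g : (g \in homk_pred) <-> linear g.
Proof. by rewrite unfold_in; split=> /asboolP. Qed.

Lemma homk_lact_subproof (a : L) (g : subspace homk_pred) : (fun x => val g (x * a)) \in homk_pred.
Proof.
have /homk_predP lg := valP g; apply/homk_predP => c x y.
by rewrite mulrDl -scalerAl lg.
Qed.

Lemma homk_ract_subproof (g : subspace homk_pred) (b : B) : (fun x => val g x <* b) \in homk_pred.
Proof.
have /homk_predP lg := valP g; apply/homk_predP => c x y.
by rewrite lg ractDl ractZl.
Qed.

Definition homk : bimod L B.
Proof.
refine (@Bimod k L B (subspace homk_pred) (fun a g => Subspace (homk_lact_subproof a g))
  (fun g b => Subspace (homk_ract_subproof g b)) _ _ _ _ _ _ _ _ _).
- move=> g c a b; apply: val_inj; rewrite linearP; apply: funext => x /=.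
  by have /homk_predP lg := valP g; rewrite mulrDr -scalerAr lg.
- by move=> a c f g; apply: val_inj; rewrite [RHS]linearP.
- by move=> b c f g; apply: val_inj; rewrite [RHS]linearP; apply: funext => x; apply: ract_linl.
- by move=> g c a b; apply: val_inj; rewrite [RHS]linearP; apply: funext => x; apply: ract_linr.
- by move=> g; apply: val_inj; apply: funext => x; rewrite /= mulr1.
- by move=> a b g; apply: val_inj; apply: funext => x; rewrite /= mulrA.
- by move=> g; apply: val_inj; apply: funext => x; rewrite /= ract1.
- by move=> g a b; apply: val_inj; apply: funext => x; rewrite /= ractA.
- by move=> a g b; apply: val_inj.
Defined.
End Coinduced.

Section RelativeLift.
Variables (k : fieldType) (L : algType k) (V : finType) (e : V -> L).
Hypothesis e_orth : forall v w, e v * e w = if v == w then e v else 0.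
Hypothesis e_sum : \sum_v e v = 1.

(* The [E]-[L]-linear maps, [E] being the span of the idempotents [e v]. *)
Definition elhom (X Y : bimod L L) (f : X -> Y) : Prop :=
  [/\ linear f, forall v x, f (e v *> x) = e v *> f x & forall x b, f (x <* b) = f x <* b].

(* [P] is projective over [E (x) L^op]: lift to a right linear map through
   coinduced bimodules, then average over the idempotents. *)
Lemma elhom_lift (P X Y : bimod L L) (D : X -> Y) (pi : P -> Y) :
  projective P -> bihom D -> elhom pi -> (forall u, exists x, D x = pi u) ->
  exists2 s : P -> X, elhom s & forall u, D (s u) = pi u.
Proof.
move=> Pproj hD [lp ep rp] piD; have [lD aD bD] := hD.
have [D' D'E] := linear_fun lD.
have [t [tD tlin]] := linear_section D'.
(* Corestricted to its image, [D] is onto, and composing with the linear section [t] shows that it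
   stays onto after applying Hom_k(L, -). The projectivity of [P] can then be applied between
   coinduced bimodules. *)
pose Kp (y : Y) := `[< exists x, D x = y >].
have KC : submod_closed (Kp : {pred Y}).
  split=> [|c y y' /asboolP[x <-] /asboolP[x' <-]]; apply/asboolP.
    by exists 0; rewrite bihom0.
  by exists (c *: x + x'); rewrite lD.
pose K : submodClosed Y := HB.pack (Kp : {pred Y}) (GRing.isSubmodClosed.Build k Y _ KC).
have KP y : y \in K <-> exists x, D x = y by rewrite unfold_in; split=> /asboolP.
have KL a x : x \in K -> a *> x \in K.
  by move=> /KP[z <-]; apply/KP; exists (a *> z).
have KR x b : x \in K -> x <* b \in K.
  by move=> /KP[z <-]; apply/KP; exists (z <* b).
pose Y' := subbimod KL KR.
have homkD (g : homk X) : (fun x => Subspace (proj2 (KP (D (val g x))) (ex_intro _ _ erefl)) : Y') \in @homk_pred k L L Y'.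
  have /homk_predP lg := valP g.
  by apply/homk_predP => c x y; apply: val_inj; rewrite [RHS]linearP /= lg lD.
have homkpi (u : P) : (fun x => Subspace (proj2 (KP (pi (x *> u))) (piD (x *> u))) : Y') \in @homk_pred k L L Y'.
  by apply/homk_predP => c x y; apply: val_inj; rewrite [RHS]linearP /= lact_linl lp.
have [|||G [lG aG bG] GE] := Pproj (homk X) (homk Y') (fun g => Subspace (homkD g)) (fun u => Subspace (homkpi u)).
- split=> [c f g|a g|g b]; apply: val_inj; rewrite ?linearP; apply: funext => x; apply: val_inj.
  + by rewrite [RHS]linearP; apply: lD.
  + by [].
  + exact: bD.
- case=> g Cg; have /homk_predP lg := Cg.
  have tg x : D (t (val (g x))) = val (g x).
    by have /KP[z <-] := valP (g x); rewrite -!D'E.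
  have lt : (fun x => t (val (g x))) \in @homk_pred k L L X.
    apply/homk_predP => c x y; rewrite lg linearP /=.
    have /KP[z Ez] := valP (g x); have /KP[z' Ez'] := valP (g y).
    by rewrite /= in Ez Ez'; rewrite -Ez -Ez' -!D'E tlin.
  by exists (Subspace lt); apply: val_inj; apply: funext => x; apply: val_inj; apply: tg.
- split=> [c f g|a g|g b]; apply: val_inj; rewrite ?linearP; apply: funext => x; apply: val_inj.
  + by rewrite [RHS]linearP /= lact_linr lp.
  + by rewrite /= lactA.
  + by rewrite /= -lractA rp.
have GD u x : D (val (G u) x) = pi (x *> u).
  exact: (congr1 (fun g : homk Y' => val (val g x)) (GE u)).
pose s0 u := val (G u) 1.
have s0lin : linear s0 by move=> c x y; rewrite /s0 lG linearP.
have s00 : s0 0 = 0 by apply: (linear_eq0 s0lin).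
have one v (F : V -> X) : (forall w, w != v -> F w = 0) -> \sum_w F w = F v.
  by move=> F0; rewrite (bigD1 v) //= big1 ?addr0.
(* Evaluation at 1 gives a right linear lift [s0]; the sum makes it commute with the idempotents. It
   still lifts [pi], because [pi] commutes with each [e v] and the [e v] add up to 1. *)
exists (fun u => \sum_v e v *> s0 (e v *> u)).
  split=> [c x y|v x|x b].
  - rewrite scaler_sumr -big_split; apply: eq_bigr => v _ /=.
    by rewrite lact_linr s0lin lact_linr.
  - rewrite (one v) => [|w wv]; last by rewrite -lactA e_orth (negPf wv) lact0m s00 lactm0.
    rewrite -lactA e_orth eqxx lact_sum (one v) => [|w wv].
      by rewrite -lactA e_orth eqxx.
    by rewrite -lactA e_orth eq_sym (negPf wv) lact0m.
  - rewrite ract_sum; apply: eq_bigr => v _.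
    by rewrite lractA -lractA /s0 bG.
move=> u; rewrite -D'E linear_sum -[RHS]lact1 -e_sum sum_lact; apply: eq_bigr => v _.
by rewrite /= D'E aD GD lact1 ep -lactA e_orth eqxx.
Qed.
End RelativeLift.

(** * The coinduced resolution of the coefficients *)

Section CoindResolution.
Variables (k : fieldType) (L : algType k) (V : finType) (e : V -> L) (N : bimod L L).
Local Notation I := (coind e N).

Lemma coind0 n x : val (0 : I n) x = 0.
Proof. by rewrite linear0. Qed.

Lemma coindP n c (f g : I n) x : val (c *: f + g) x = c *: val f x + val g x.
Proof. by rewrite linearP. Qed.

Lemma delta_subproof n (g : I n) : dbar n (val g) \in @coind_pred k L V e N n.+1.
Proof. by apply/coind_predP/dbar_coind/coind_predP/(valP g). Qed.

Definition coind_delta n (g : I n) : I n.+1 := Subspace (delta_subproof g).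

Lemma coind_delta_hom n : bihom (@coind_delta n).
Proof.
split=> [c f g|a g|g b]; apply: val_inj.
- by rewrite [RHS]linearP /= -linearP /=; congr (dbar n _); rewrite linearP.
- apply: funext => x; rewrite /= /coind_lact_fun /dbar; apply: eq_bigr => i _.
  congr (_ *: val g _); have := ltn_ord i; rewrite ltnS leq_eqVlt => /orP[/eqP ->|ilt].
    by rewrite face_updS /face ltnn eqxx mulrA.
  by rewrite face_upd_lt //; congr upd; rewrite /face; case: ifP; [lia|case: ifP => //; lia].
- apply: funext => x; rewrite /= /coind_ract_fun /dbar ract_sum; apply: eq_bigr => i _.
  by rewrite ractZl.
Qed.

Lemma coind_delta_delta n (g : I n) : coind_delta (coind_delta g) = 0.
Proof. by apply: val_inj; rewrite [RHS]linear0; apply: dbar_dbar. Qed.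

(** Putting 1 in the last argument is a contracting homotopy up to sign, allowed because cochains
    need not be right linear. In the cocycle condition at (x, 1) the last face gives back [g x] with
    sign (-1)^(n+2), and the other faces give [dbar n f x]; hence the factor (-1)^(n+1). *)
Lemma coind_delta_exact n (g : I n.+1) : coind_delta g = 0 -> exists f, coind_delta f = g.
Proof.
move=> dg; have /coind_predP[loc lin lac bal] := valP g.
pose f x := val g (upd x n.+2 1).
have Cf : is_coind e n f.
  split=> [x y xy|i x ilt c u v|x b|x i v ilt]; rewrite /f.
  - by apply: loc => i ilt; rewrite /upd; case: eqP => // ni; apply: xy; lia.
  - by rewrite ![upd (upd x i _) _ _]upd_comm ?lin //; lia.
  - by rewrite upd_comm // -lac upd_neq.
  - rewrite ![upd (upd x _ _) n.+2 _]upd_comm; try lia.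
    rewrite -[x i](@upd_neq k L x n.+2 i 1); last by lia.
    by rewrite -[x i.+1](@upd_neq k L x n.+2 i.+1 1) ?bal //; lia.
have Cf' : (-1) ^+ n.+1 *: f \in @coind_pred k L V e N n by rewrite rpredZ //; apply/coind_predP.
exists (Subspace Cf'); apply: val_inj; rewrite /= linearZ /=; apply: funext => x.
have /(congr1 (fun h : I n.+2 => val h (upd x n.+3 1))) := dg.
rewrite coind0 /= /dbar big_ord_recr /= face_updS mulr1.
have -> : val g (upd (face n.+2 x) n.+2 (x n.+2)) = val g x.
  apply: loc => i ilt; rewrite /upd /face; case: eqP => [->//|ni].
  by case: ifP => //; lia.
rewrite (eq_bigr (fun i : 'I_n.+2 => (-1) ^+ i *: f (face i x))); last first.
  move=> i _; congr (_ *: _); rewrite /f; apply: loc => j jlt.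
  by have := ltn_ord i => ilt; rewrite face_upd_lt.
move/eqP; rewrite addr_eq0 => /eqP E.
rewrite -[LHS]/((-1) ^+ n.+1 *: dbar n f x) /dbar E.
by rewrite scalerN scalerA -exprD -scaleN1r scalerA -exprS -signr_odd !addnS !addSn /= oddD addbb expr0 scale1r.
Qed.

Lemma eta_subproof (m : N) : (fun x => (x 0%N * x 1%N) *> m) \in @coind_pred k L V e N 0.
Proof.
apply/coind_predP; split=> [x y xy|[|[|i]] x // ilt c u v|x b|x [|i] v // ilt].
- by rewrite !xy.
- by rewrite /upd /= mulrDl -scalerAl lact_linl.
- by rewrite /upd /= mulrDr -scalerAr lact_linl.
- by rewrite /upd /= -mulrA lactA.
- by rewrite /upd /= mulrA.
Qed.

Definition coind_eta (m : N) : I 0 := Subspace (eta_subproof m).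

Lemma coind_eta_hom : bihom coind_eta.
Proof.
split=> [c m p|a m|m b]; apply: val_inj.
- by rewrite [RHS]linearP; apply: funext => x; apply: lact_linr.
- by apply: funext => x; rewrite /= /coind_lact_fun /upd /= mulrA [RHS]lactA.
- by apply: funext => x; rewrite /= /coind_ract_fun lractA.
Qed.

Lemma coind_eta_inj m : coind_eta m = 0 -> m = 0.
Proof.
move/(congr1 (fun h : I 0 => val h (fun=> 1))).
by rewrite coind0 /= mulr1 lact1.
Qed.

Lemma coind_delta_eta m : coind_delta (coind_eta m) = 0.
Proof.
apply: val_inj; rewrite [RHS]linear0; apply: funext => x.
rewrite /= /dbar !big_ord_recl big_ord0 /= addr0 expr0 scale1r /bump /= expr1 scaleN1r.
by rewrite /face /= mulrA subrr.
Qed.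

(** The cocycle condition at (x_0, x_1, 1) reads g(x_0, x_1) = g(x_0 x_1, 1), which is x_0 x_1 g(1,
    1) by left linearity. *)
Lemma coind_eta_exact (g : I 0) : coind_delta g = 0 -> exists m, coind_eta m = g.
Proof.
move=> dg; have /coind_predP[loc lin lac bal] := valP g.
exists (val g (fun=> 1)); apply: val_inj; apply: funext => x.
have /(congr1 (fun h : I 1 => val h (upd x 2 1))) := dg.
rewrite coind0 /= /dbar !big_ord_recl big_ord0 /= addr0 expr0 scale1r /bump /= expr1 scaleN1r.
move/eqP; rewrite subr_eq0 => /eqP E.
rewrite -lac; have -> : val g x = val g (face 1 (upd x 2 1)).
  by apply: loc => -[|[|i]] // _; rewrite /face /upd /= mulr1.
apply: etrans E; apply: loc => -[|[|i]] // _.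
by rewrite /face /upd /= mulr1.
Qed.

(** This gives the exactness of the rows: maps into a coinduced bimodule behave like E-L-linear
    maps, and for those the partial inverse [s] of [D] suffices. *)
Lemma coind_hom_exact (U Y : bimod L L) q (D : U -> Y) (s : Y -> U) (f : U -> I q) :
  bihom D -> elhom e s -> (forall u, D (s (D u)) = D u) ->
  bihom f -> (forall u, D u = 0 -> f u = 0) ->
  exists2 g : Y -> I q, bihom g & forall u, f u = g (D u).
Proof.
move=> hD [ls es rs] DsD hf fD; have [lf af rf] := hf.
have floc u x y : (forall i, (i < q.+2)%N -> x i = y i) -> val (f u) x = val (f u) y.
  by have /coind_predP[loc _ _ _] := valP (f u); apply: loc.
(* Left linearity of a map to [I q] moves its last argument onto the module element, leaving 1
   there; this forces the formula. That [s] commutes with the idempotents gives the balance at slot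
   [q]. *)
pose g y x := val (f (s (x q.+1 *> y))) (upd x q.+1 1).
have Cg y : g y \in @coind_pred k L V e N q.
  apply/coind_predP; split=> [x x' xx'|i x ilt c u v|x b|x i v ilt]; rewrite /g.
  - by rewrite xx' //; apply: floc => i ilt; rewrite /upd; case: eqP => // _; apply: xx'.
  - have [->|ni] := eqVneq i q.+1.
      by rewrite !upd_eq !upd_upd lact_linl ls lf coindP.
    rewrite ![upd (upd x i _) _ _]upd_comm // !upd_neq 1?eq_sym //.
    by have /coind_predP[_ lin _ _] := valP (f (s (x q.+1 *> y))); apply: lin.
  - rewrite upd_comm // upd_neq //.
    have /coind_predP[_ _ lac _] := valP (f (s (x q.+1 *> y))).
    by rewrite -lac upd_neq.
  - have bal u z := let: And4 _ _ _ bal := elimT (asboolP _) (valP (f u)) in bal z i v ilt.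
    have [Ei|ni] := eqVneq i q.
      rewrite Ei in bal *.
      rewrite upd_neq ?neq_ltn ?ltnSn ?orbT // upd_eq upd_upd.
      rewrite upd_comm ?neq_ltn ?ltnSn // -[x q](@upd_neq k L x q.+1 q 1) ?neq_ltn ?ltnSn //.
      rewrite bal upd_eq mulr1 upd_upd lactA es af.
      by rewrite /= /coind_lact_fun upd_upd upd_eq mul1r.
    rewrite ![upd (upd x _ _) q.+1 _]upd_comm; try lia.
    rewrite !upd_neq; try lia.
    rewrite -[x i](@upd_neq k L x q.+1 i 1); last by lia.
    by rewrite bal upd_neq //; lia.
exists (fun y => Subspace (Cg y)).
  split=> [c y y'|a y|y b]; apply: val_inj.
  - rewrite [RHS]linearP; apply: funext => x.
    by rewrite /= /g lact_linr ls lf coindP.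
  - apply: funext => x; rewrite /= /coind_lact_fun /= /g upd_eq upd_upd.
    by rewrite lactA.
  - apply: funext => x; rewrite /= /coind_ract_fun /= /g -lractA rs rf.
    by [].
move=> u; apply: val_inj; apply: funext => x; rewrite /= /g.
have fsD w : f (s (D w)) = f w.
  apply/eqP; rewrite -subr_eq0 -bihomB // fD // bihomB // DsD subrr //.
case: (hD) => _ <- _; rewrite fsD af /= /coind_lact_fun upd_upd upd_eq mul1r.
by rewrite upd_id.
Qed.

End CoindResolution.

(** * Ext as the cohomology of the relative bar complex *)

Section ExtBar.
Variables (k : fieldType) (L : algType k) (V : finType) (e : V -> L).
Hypothesis e_orth : forall v w, e v * e w = if v == w then e v else 0.
Hypothesis e_sum : \sum_v e v = 1.
Variables (P : proj_resolution (regular L)).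

Let one (M : nmodType) v (F : V -> M) : (forall w, w != v -> F w = 0) -> \sum_w F w = F v.
Proof. by move=> F0; rewrite (bigD1 v) //= big1 ?addr0. Qed.

(** If [u] lifts 1, then [l] goes to [u l] is a right linear section; averaging over the idempotents
    makes it commute with E. *)
Lemma aug_split : exists2 s : regular L -> pres P 0, elhom e s & forall l, paug (s l) = l.
Proof.
have [u Eu] := paug_surj P 1; have [lp ap rp] := paug_hom P.
exists (fun l => \sum_v e v *> (u <* (e v * l))).
  split=> [c x y|v x|x b].
  - rewrite scaler_sumr -big_split; apply: eq_bigr => v _ /=.
    by rewrite mulrDr -scalerAr ract_linr lact_linr.
  - rewrite (one (v := v)) => [|w wv]; last first.
      by rewrite /= mulrA e_orth (negPf wv) mul0r ractm0 lactm0.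
    rewrite /= mulrA e_orth eqxx lact_sum (one (v := v)) => [|w wv].
      by rewrite -lactA e_orth eqxx.
    by rewrite -lactA e_orth eq_sym (negPf wv) lact0m.
  - rewrite ract_sum; apply: eq_bigr => v _.
    by rewrite lractA /= mulrA ractA.
move=> l; have [p pE] := linear_fun lp.
rewrite -pE linear_sum -[RHS]mul1r -e_sum mulr_suml; apply: eq_bigr => v _.
by rewrite /= pE ap rp Eu /= mul1r mulrA e_orth eqxx.
Qed.

(* The resolution is split exact as a complex of [E]-[L]-bimodules. *)
Lemma res_projector p : exists pi : pres P p -> pres P p,
  [/\ elhom e pi, forall u, exists w, pdiff w = pi u & forall w, pi (pdiff w) = pdiff w].
Proof.
have subr_elhom (X Y : bimod L L) (D : X -> Y) (s : Y -> X) :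
    bihom D -> elhom e s -> elhom e (fun x => x - s (D x)).
  move=> [lD aD bD] [ls es rs]; split=> [c x y|v x|x b].
  - by rewrite lD ls scalerBr opprD addrACA.
  - by rewrite aD es -[- _ in LHS]scaleN1r -lactZr scaleN1r lactDr.
  - by rewrite bD rs -[- _ in LHS]scaleN1r -ractZl scaleN1r ractDl.
elim: p => [|p [pi [hpi im_pi pi_id]]].
  have [s hs ps] := aug_split; exists (fun u => u - s (paug u)).
  have s0 : s 0 = 0.
    by have [ls _ _] := hs; exact: (linear_eq0 ls).
  split=> [|u|w]; first exact/subr_elhom/hs/paug_hom.
    by apply/paug_exact; rewrite bihomB ?ps ?subrr //; apply: paug_hom.
  have -> : paug (pdiff w) = 0 by apply/paug_exact; exists w.
  by rewrite s0 subr0.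
(* Let [s] lift [pi] through the differential d. Since [pi] fixes boundaries, 1 - s d has values in
   the kernel of d, and it fixes the next boundaries because d d = 0. *)
have [s hs ds] := elhom_lift e_orth e_sum (@pres_proj _ _ _ _ P p) (@pdiff_hom _ _ _ _ P p) hpi im_pi.
exists (fun u => u - s (pdiff u)).
have s0 : s 0 = 0.
  by have [ls _ _] := hs; exact: (linear_eq0 ls).
split=> [|u|w]; first exact/subr_elhom/hs/pdiff_hom.
  by apply/pdiff_exact; rewrite bihomB ?ds ?pi_id ?subrr //; apply: pdiff_hom.
have -> : pdiff (pdiff w) = 0 by apply/pdiff_exact; exists w.
by rewrite s0 subr0.
Qed.

Lemma res_split p : exists2 s : pres P p -> pres P p.+1, elhom e s &
  forall w, pdiff (s (pdiff w)) = pdiff w.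
Proof.
have [pi [hpi im_pi pi_id]] := res_projector p.
have [s hs ds] := elhom_lift e_orth e_sum (@pres_proj _ _ _ _ P p) (@pdiff_hom _ _ _ _ P p) hpi im_pi.
by exists s => // w; rewrite ds pi_id.
Qed.

Variable N : bimod L L.
Local Notation I := (coind e N).

(** A bimodule map from L is its value at 1, an element on which the left and right actions agree.
    In [I n] this agreement is exactly right linearity in the last argument. *)
Lemma hom_coind_bar n :
  liso (cohomology (hom_cochains (regular L) (@coind_delta_hom k L V e N) ) n)
       (cohomology (bar_cochains e N) n).
Proof.
pose C := hom_cochains (regular L) (@coind_delta_hom k L V e N).
pose F m (c : regular L -> I m) : (nat -> L) -> N := val (c 1).
have Flin m c (f g : regular L -> I m) : F m (c *: f + g) = c *: F m f + F m g.
  by rewrite /F -[(c *: f + g) 1]/(c *: f 1 + g 1) linearP.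
have F_inj m (f g : regular L -> I m) : bihom f -> bihom g -> F m f = F m g -> f = g.
  move=> [_ _ fr] [_ _ gr] /val_inj E; apply: funext => x.
  by rewrite -[x]mul1r; rewrite fr gr E.
have Fbar m f : f \in bihoms (X := regular L) (Y := I m) -> F m f \in @bar_pred k L V e N m.
  move=> /bihomsP[_ fl fr]; apply/bar_predP; split; first exact/coind_predP/(valP (f 1)).
  move=> x b; rewrite -[LHS]/(val (b *> f 1) x) -fl -[RHS]/(val (f 1 <* b) x) -fr /=.
  by rewrite mul1r mulr1.
have Fonto m (g : (nat -> L) -> N) : g \in @bar_pred k L V e N m ->
    exists2 f, f \in bihoms (X := regular L) (Y := I m) & F m f = g.
  move=> /bar_predP[/coind_predP Cg rg].
  exists (fun x : regular L => (Subspace Cg : I m) <* x).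
    apply/bihomsP; split=> [c x y|a x|x b].
    - exact: ract_linr.
    - apply: val_inj; apply: funext => x0; rewrite /= /coind_lact_fun /= /coind_ract_fun rg.
      by rewrite -ractA.
    - exact: ractA.
  by rewrite /F /= /coind_ract_fun; apply: funext => x; rewrite ract1.
have Fd m f : F m.+1 (cdiff C m f) = dbar m (F m f) by [].
have FB m f : f \in bihoms (X := regular L) (Y := I m) ->
    F m f \in @coboundaries k (bar_cochains e N) m <-> f \in @coboundaries k C m.
  case: m f => [|m] f Cf.
    split=> [/(@coboundaries0P k (bar_cochains e N))|/(@coboundaries0P k C)] E.
      apply/(@coboundaries0P k C); apply: F_inj; [exact/bihomsP|exact/bihomsP/rpred0|].
      by rewrite E /F -[(0 : regular L -> I 0) 1]/(0 : I 0) linear0.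
    by apply/(@coboundaries0P k (bar_cochains e N)); rewrite E /F -[(0 : regular L -> I 0) 1]/(0 : I 0) linear0.
  split=> [/(@coboundariesSP k (bar_cochains e N))|/(@coboundariesSP k C)] [b Cb E].
    have [g Cg Eg] := Fonto _ _ Cb.
    apply/(@coboundariesSP k C); exists g => //; apply: F_inj.
    - exact/bihomsP.
    - by apply: (bihom_comp (@coind_delta_hom k L V e N m)); apply/bihomsP.
    - by rewrite E Fd Eg.
  by apply/(@coboundariesSP k (bar_cochains e N)); exists (F m b); rewrite ?Fbar // E Fd.
apply: (sq_reliso2 (R := fun f g => F n f = g)).
- by move=> c a b _ _ <- <-; rewrite Flin.
- move=> a /cocyclesP[Ca da]; exists (F n a) => //.
  apply/(@cocyclesP k (bar_cochains e N)); split; first exact: Fbar.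
  by rewrite -[LHS]Fd da /F -[(0 : regular L -> I _) 1]/(0 : I _) linear0.
- by move=> a _ /cocyclesP[Ca da] _ <- /FB; apply.
- move=> u /(@cocyclesP k (bar_cochains e N))[Cu du].
  have [f Cf Ef] := Fonto _ _ Cu; exists f => //.
  apply/(@cocyclesP k C); split=> //; apply: F_inj.
  + by apply: (bihom_comp (@coind_delta_hom k L V e N n)); apply/bihomsP.
  + exact/bihomsP/rpred0.
  + by rewrite Fd Ef /F -[(0 : regular L -> I _) 1]/(0 : I _) linear0; exact: du.
- by move=> a _ /cocyclesP[Ca da] _ <- /FB; apply.
Qed.

Lemma ext_bar n : liso (Ext P N n) (cohomology (bar_cochains e N) n).
Proof.
apply: liso_trans (hom_coind_bar n).
apply: (balancing (coind_eta_hom e N)).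
- exact: coind_eta_inj.
- exact: coind_delta_eta.
- exact: coind_delta_delta.
- exact: coind_eta_exact.
- exact: coind_delta_exact.
- move=> q f hf fd; have [s hs ps] := aug_split.
  have [||g hg E] := coind_hom_exact (paug_hom P) hs _ hf.
  + by move=> u; rewrite ps.
  + by move=> u /paug_exact[w <-].
  + by exists g.
- move=> p q f hf fd; have [s hs ds] := res_split p.
  have [|g hg E] := coind_hom_exact (@pdiff_hom _ _ _ _ P p) hs ds hf.
  + by move=> u /pdiff_exact[w <-].
  + by exists g.
Qed.

End ExtBar.

(* An [n]-cochain of the bar complex is determined by its values on sequences
   [1, y_0, ..., y_(n-1), 1]; this is the usual description of Hochschild
   cochains. *)
Section NormalizedCochains.
Variables (k : fieldType) (L : algType k) (V : Type) (e : V -> L).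

Definition shift (x : nat -> L) : nat -> L := fun j => x j.+1.

Definition bord n (y : nat -> L) : nat -> L :=
  fun j => if j is j'.+1 then if (j' < n)%N then y j' else 1 else 1.

Section Coefficients.
Variable N : bimod L L.
Implicit Types (f h : (nat -> L) -> N) (x y : nat -> L).

(** Bilinearity over L is lost with the end arguments, and bilinearity over E remains. In degree 0
    no argument is left to carry the idempotents, so the condition becomes that the value commutes
    with them. *)
Record is_hoch n h : Prop := IsHoch {
  hoch_loc : forall x y, (forall i, (i < n)%N -> x i = y i) -> h x = h y;
  hoch_lin : forall i x, (i < n)%N -> linear (fun u => h (upd x i u));
  hoch_bal : forall x i v, (i.+1 < n)%N ->
    h (upd x i (x i * e v)) = h (upd x i.+1 (e v * x i.+1));
  hoch_left : forall x v, (0 < n)%N -> h (upd x 0 (e v * x 0)) = e v *> h x;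
  hoch_right : forall x v, (0 < n)%N -> h (upd x n.-1 (x n.-1 * e v)) = h x <* e v;
  hoch0 : forall x v, n = 0 -> e v *> h x = h x <* e v }.

Definition rbar n f y := f (bord n y).
Definition ebar n h x := x 0%N *> h (shift x) <* x n.+1.

Lemma shift_upd x i u : shift (upd x i.+1 u) = upd (shift x) i u.
Proof. by []. Qed.

Lemma ebar_bar n h : is_hoch n h -> is_bar e n (ebar n h).
Proof.
move=> [loc lin bal left right zero]; rewrite /ebar.
have locS x i u : (n <= i)%N -> h (upd (shift x) i u) = h (shift x).
  by move=> ni; apply: loc => j jn; rewrite upd_neq //; lia.
have locS0 x u : h (shift (upd x 0 u)) = h (shift x) by apply: loc => j jn.
split; last by move=> x b; rewrite shift_upd locS // upd_eq upd_neq // ractA.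
split.
- by move=> x y E; rewrite !E // (loc (shift x) (shift y)) // => i ilt; rewrite /shift E //; lia.
- move=> [|i] x ilt c u v.
    by rewrite !locS0 !upd_eq !upd_neq // lact_linl ract_linl.
  rewrite !shift_upd; have [->|ni] := eqVneq i n.
    by rewrite !locS // !upd_eq !upd_neq // ract_linr.
  rewrite !upd_neq; try lia.
  by rewrite lin ?lact_linr ?ract_linl //; lia.
- by move=> x b; rewrite locS0 upd_eq upd_neq // lactA !lractA.
- move=> x [|i] v ilt; rewrite ?locS0 !shift_upd.
    rewrite upd_eq [upd x 1 _ 0]upd_neq //.
    have [n0|n_gt0] := posnP n.
      by rewrite n0 upd_eq upd_neq // locS ?n0 // lactA zero // ractA [in RHS]lractA.
    rewrite -[x 1%N]/(shift x 0) left // !upd_neq; try lia.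
    by rewrite lactA.
  rewrite -[x i.+1]/(shift x i) -[x i.+2]/(shift x i.+1).
  rewrite [upd x i.+2 _ 0]upd_neq // [upd x i.+1 _ 0]upd_neq // [upd x i.+1 _ n.+1]upd_neq; last by lia.
  have [Ei|ni] := eqVneq n i.+1.
    rewrite Ei upd_eq [h (upd _ i.+1 _)]locS ?Ei // ractA; congr (_ <* _).
    have := right (shift x) v; rewrite Ei /= => -> //.
    by rewrite lractA.
  by rewrite [upd x i.+2 _ n.+1]upd_neq ?bal //; lia.
Qed.

Lemma bord_upd n y i u : (i < n)%N -> bord n (upd y i u) = upd (bord n y) i.+1 u.
Proof.
move=> ilt; apply: funext => -[|j] //; rewrite /upd /= eqSS.
by case: ifP; case: eqP => // ->; rewrite ilt.
Qed.

Lemma rbar_hoch n f : is_bar e n f -> is_hoch n (rbar n f).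
Proof.
move=> [[loc lin lac bal] rac]; rewrite /rbar.
have bordE y i : (i < n)%N -> y i = bord n y i.+1 by rewrite /bord => ->.
split.
- move=> x y E; apply: loc => -[|i] ilt //=; case: ifP => // i_n; exact: E.
- by move=> i x ilt c u v; rewrite !bord_upd // lin //; lia.
- move=> x i v ilt; rewrite !bord_upd //; last by lia.
  rewrite (bordE x i) ?(bordE x i.+1) //; last by lia.
  by rewrite bal //; lia.
- move=> x v n_gt0; rewrite bord_upd // (bordE x 0) // -bal // -lac.
  by rewrite /= mul1r mulr1.
- case: n loc lin lac bal rac bordE => // n loc lin lac bal rac bordE x v _.
  rewrite bord_upd //= (bordE x n) // bal // -rac.
  by rewrite /= ltnn mul1r mulr1.
- move=> x v n0; rewrite n0 in bal rac lac *; rewrite -lac -rac.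
  have := bal (bord 0 x) 0 v isT.
  by rewrite /= !mulr1 !mul1r.
Qed.

Lemma ebarK n f : is_bar e n f -> ebar n (rbar n f) = f.
Proof.
move=> [[loc lin lac bal] rac]; apply: funext => x; rewrite /ebar /rbar -lac -rac.
apply: loc => i ilt; rewrite /upd; have [->|ni] := eqVneq i n.+1; first by rewrite /= ltnn mul1r.
by case: i ilt ni => [|i] ilt ni; rewrite /= ?mulr1 // ifT //; lia.
Qed.

Lemma rebarK n h : is_hoch n h -> rbar n (ebar n h) = h.
Proof.
move=> hh; apply: funext => y; rewrite /rbar /ebar /= ltnn lact1 ract1.
by apply: (hoch_loc hh) => i ilt; rewrite /shift /= ilt.
Qed.

(** In the two outer faces the end argument leaves [f] by bilinearity, and the usual Hochschild
    coboundary results. *)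
Lemma rbar_dbar n f y : is_bar e n f ->
  rbar n.+1 (dbar n f) y = y 0%N *> rbar n f (shift y)
    + \sum_(i < n) (-1) ^+ i.+1 *: rbar n f (face i y) + (-1) ^+ n.+1 *: (rbar n f y <* y n).
Proof.
move=> [[loc lin lac bal] rac]; rewrite /rbar /dbar big_ord_recl big_ord_recr /= addrA.
congr (_ + _ + _).
- rewrite expr0 scale1r -lac; apply: loc => -[|i] ilt.
    by rewrite upd_eq /face /= mul1r mulr1.
  rewrite /face /= ltnS [in RHS]upd_neq //=; case: ifP => //.
- apply: eq_bigr => i _; rewrite /bump /= add1n; congr (_ *: _).
  apply: loc => -[|j] jlt; first by rewrite /face.
  rewrite /face /= ltnS eqSS; have := ltn_ord i => ilt.
  case: ifP => ji; first by rewrite !ifT //; lia.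
  case: ifP => [/eqP ->|ij]; first by rewrite !ifT //; lia.
  by rewrite ltnS.
- rewrite /bump /= add1n -rac; congr (_ *: _); apply: loc => i ilt.
  have [->|ni] := eqVneq i n.+1.
    by rewrite upd_eq /face ltnn eqxx /= ltnSn !ltnn mulr1 mul1r.
  rewrite upd_neq // /face ifT; last by lia.
  by case: i ilt ni => [|i] ilt ni //=; rewrite !ifT //; lia.
Qed.

End Coefficients.

(* [E]-bilinear maps act on normalised cochains, although they need not commute
   with the coboundary. *)
Lemma hoch_map (N N' : bimod L L) (s : N -> N') n (h : (nat -> L) -> N) :
  linear s -> (forall v m, s (e v *> m) = e v *> s m) ->
  (forall v m, s (m <* e v) = s m <* e v) ->
  is_hoch n h -> is_hoch n (fun x => s (h x)).
Proof.
move=> ls sl sr [loc lin bal left right zero]; split.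
- by move=> x y E; rewrite (loc _ _ E).
- by move=> i x ilt c u v; rewrite lin // ls.
- by move=> x i v ilt; rewrite bal.
- by move=> x v n0; rewrite left // sl.
- by move=> x v n0; rewrite right // sr.
- by move=> x v n0; rewrite -sl zero // sr.
Qed.

Lemma bar_map (N N' : bimod L L) (s : N -> N') n (h : (nat -> L) -> N) :
  bihom s -> is_bar e n h -> is_bar e n (fun x => s (h x)).
Proof.
move=> [ls sl sr] [[loc lin lac bal] rac]; split; last by move=> x b; rewrite rac sr.
split.
- by move=> x y E; rewrite (loc _ _ E).
- by move=> i x ilt c u v; rewrite lin // ls.
- by move=> x b; rewrite lac sl.
- by move=> x i v ilt; rewrite bal.
Qed.

Lemma dbar_map (N N' : bimod L L) (s : N -> N') n (h : (nat -> L) -> N) :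
  linear s -> dbar n (fun x => s (h x)) = (fun x => s (dbar n h x)).
Proof.
move=> ls; have [t tE] := linear_fun ls; apply: funext => x.
rewrite /dbar -tE linear_sum; apply: eq_bigr => i _.
by rewrite linearZ /= tE.
Qed.

End NormalizedCochains.

(** * Coefficients in M, in the extension and in A *)

Section Coefficients.
Variables (k : fieldType) (Q : quiver) (D : qset k Q).
Local Notation A := (prodA D).
Local Notation M := (sumM D).
Local Notation L := (Lambda D).

Definition idemA (v : vertex Q) : A := fun y => if y == v then 1 else 0.

Lemma idemA_orth v w : idemA v * idemA w = if v == w then idemA v else 0.
Proof.
apply: functional_extensionality_dep => y; rewrite -[LHS]/(idemA v y * idemA w y) /idemA.
case: (eqVneq v w) => [->|vw]; first by case: ifP; rewrite ?mul1r ?mul0r.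
by rewrite -[RHS]/(0 : valg D y); case: eqP => [->|]; rewrite ?(negPf vw) ?mulr0 ?mul0r.
Qed.

Lemma prodA_sum (J : Type) (r : seq J) (F : J -> A) y : (\sum_(j <- r) F j) y = \sum_(j <- r) F j y.
Proof. by apply: (big_morph (fun a : A => a y)). Qed.

Lemma idemA_sum : \sum_v idemA v = 1.
Proof.
apply: functional_extensionality_dep => y; rewrite prodA_sum (bigD1 y) //= big1 => [|w wy].
  by rewrite addr0 /idemA eqxx.
by rewrite /idemA eq_sym (negPf wy).
Qed.

Hypothesis comp0 : zero_compositions D.

Lemma LambdaM (x y : L) : x * y = (x.1 * y.1, x.1 *> y.2 + x.2 <* y.1).
Proof. by rewrite -[LHS]/(extalg_mul x y) /extalg_mul comp0 addr0. Qed.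

Lemma LambdaMr (x : L) (m : M) : x * ((0, m) : L) = (0, x.1 *> m).
Proof.
rewrite LambdaM; congr pair; first exact: mulr0.
by rewrite -[RHS]addr0; congr (_ + _); apply: ractm0.
Qed.

Lemma LambdaMl (m : M) (x : L) : ((0, m) : L) * x = (0, m <* x.1).
Proof.
rewrite LambdaM; congr pair; first exact: mul0r.
by rewrite -[RHS]add0r; congr (_ + _); apply: lact0m.
Qed.

Lemma LambdaAA (x y : L) : x.2 = 0 :> M -> y.2 = 0 :> M -> x * y = (x.1 * y.1, 0).
Proof. by move=> x0 y0; rewrite LambdaM x0 y0 lactm0 ract0m addr0. Qed.

Definition idemL (v : vertex Q) : L := unit_at D v.

Lemma idemL1 v : (idemL v).1 = idemA v. Proof. by []. Qed.

Lemma idemL_orth v w : idemL v * idemL w = if v == w then idemL v else 0.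
Proof.
rewrite LambdaAA // !idemL1 idemA_orth.
by case: eqP.
Qed.

Lemma idemL_sum : \sum_v idemL v = 1.
Proof.
have E1 (J : Type) (r : seq J) (F : J -> L) : (\sum_(j <- r) F j).1 = \sum_(j <- r) (F j).1.
  by apply: (big_morph (fun x : L => x.1)).
have E2 (J : Type) (r : seq J) (F : J -> L) : (\sum_(j <- r) F j).2 = \sum_(j <- r) (F j).2.
  by apply: (big_morph (fun x : L => x.2)).
rewrite [LHS]surjective_pairing E1 E2 idemA_sum /= big1 //.
Qed.

(** Inflation along the first projection Lambda -> A, which is multiplicative because M M = 0. *)
Definition infl (X : bimod A A) : bimod L L.
Proof.
refine (@Bimod k L L X (fun (a : L) (m : X) => a.1 *> m) (fun (m : X) (b : L) => m <* b.1)
  _ _ _ _ _ _ _ _ _).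
- by move=> m c x y; apply: lact_linl.
- by move=> a c x y; apply: lact_linr.
- by move=> b c x y; apply: ract_linl.
- by move=> m c x y; apply: ract_linr.
- by move=> m; apply: lact1.
- by move=> a a' m; rewrite LambdaM lactA.
- by move=> m; apply: ract1.
- by move=> m b b'; rewrite LambdaM ractA.
- by move=> a m b; apply: lractA.
Defined.

Definition inclM (m : infl M) : regular L := (0, m).
Definition projA (x : regular L) : infl (regular A) := x.1.

Lemma inclM_hom : bihom inclM.
Proof.
split=> [c x y|a x|x b].
- by rewrite -[RHS]/(c *: 0 + 0, _) scaler0 addr0.
- exact/esym/LambdaMr.
- exact/esym/LambdaMl.
Qed.

Lemma projA_hom : bihom projA.
Proof.
split=> [c x y|a x|x b] //.
- by rewrite -[a *> x]/((a : L) * x) LambdaM.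
- by rewrite -[x <* b]/((x : L) * b) LambdaM.
Qed.

Local Notation barL := (bar_cochains idemL (regular L)).
Local Notation barM := (bar_cochains idemL (infl M)).
Local Notation barA := (bar_cochains idemL (infl (regular A))).

Definition post_inclM (f : (nat -> L) -> infl M) : (nat -> L) -> regular L := fun x => inclM (f x).
Definition post_projA (f : (nat -> L) -> regular L) : (nat -> L) -> infl (regular A) := fun x => projA (f x).

Fact post_inclM_linear : linear post_inclM.
Proof. by move=> c f g; apply: funext => x; case: inclM_hom => l _ _; apply: l. Qed.
Fact post_projA_linear : linear post_projA.
Proof. by move=> c f g; apply: funext => x; case: projA_hom => l _ _; apply: l. Qed.
HB.instance Definition _ := GRing.isLinear.Build k ((nat -> L) -> infl M) ((nat -> L) -> regular L) _
  post_inclM post_inclM_linear.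
HB.instance Definition _ := GRing.isLinear.Build k ((nat -> L) -> regular L)
  ((nat -> L) -> infl (regular A)) _ post_projA post_projA_linear.

Lemma coefficient_sequence :
  exists (f : forall n, {linear cohomology barL n -> cohomology barA n})
    (g : forall n, {linear cohomology barA n -> cohomology barM n.+1})
    (h : forall n, {linear cohomology barM n -> cohomology barL n}),
  [/\ forall n, exact (h n) (f n), forall n, exact (f n) (g n)
    & forall n, exact (g n) (h n.+1)].
Proof.
have [||||||||||h [f [g [H1 H2 H3]]]] := @long_exact_sequence k barM barL barA
  (fun=> post_inclM) (fun=> post_projA); last by exists f, g, h.
- by move=> n f /bar_predP Cf; apply/bar_predP/dbar_bar.
- by move=> n f; apply: dbar_dbar.
- by move=> n f /bar_predP Cf; apply/bar_predP/bar_map/Cf/inclM_hom.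
- by move=> n f /bar_predP Cf; apply/bar_predP/bar_map/Cf/projA_hom.
- by move=> n f; have [l _ _] := inclM_hom; apply/esym/(dbar_map n f l).
- by move=> n f; have [l _ _] := projA_hom; apply/esym/(dbar_map n f l).
- by move=> n f g E; apply: funext => x; have := congr1 (fun F => F x) E => -[].
- by [].
- move=> n f /bar_predP Cf pf; have pf0 x : (f x).1 = 0 := congr1 (fun F => F x) pf.
  exists (fun x => (f x).2); last first.
    by apply: funext => x; rewrite [RHS]surjective_pairing pf0.
  apply/bar_predP; case: Cf => -[loc lin lac bal] rac; split; last first.
    by move=> x b; rewrite rac -[_ <* b]/((f x : L) * b) LambdaM pf0 [LHS](_ : _ = 0 *> b.2 + (f x).2 <* b.1) ?lact0m ?add0r.
  split=> [x y E|i x ilt c u v|x b|x i v ilt].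
  + by rewrite (loc _ _ E).
  + by rewrite lin.
  + by rewrite lac -[b *> _]/((b : L) * f x) LambdaM pf0 [LHS](_ : _ = b.1 *> (f x).2 + b.2 <* 0) ?ractm0 ?addr0.
  + by rewrite bal.
(* The section [s] of [projA] is E-bilinear but not Lambda-bilinear: the cochain is normalised,
   composed with [s], and extended again by bilinearity. *)
- move=> n f /bar_predP Cf; pose s (a : infl (regular A)) : regular L := (a, 0).
  have Cs : is_hoch idemL n (fun x => s (rbar n f x)).
    apply: hoch_map (rbar_hoch Cf) => [c a b|v m|v m]; rewrite /s.
    + by rewrite -[RHS]/(_, c *: 0 + 0) scaler0 addr0.
    + by rewrite -[RHS]/(idemL v * ((m, 0) : L)) LambdaAA.
    + by rewrite -[RHS]/(((m, 0) : L) * idemL v) LambdaAA.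
  exists (ebar n (fun x => s (rbar n f x))); first by apply/bar_predP/ebar_bar.
  rewrite -[RHS](ebarK Cf); apply: funext => x.
  rewrite -[LHS]/(projA _) /ebar; have [_ pl pr] := projA_hom.
  by rewrite pr pl.
Qed.

End Coefficients.

(** * Trajectories as words *)

Section Words.
Local Open Scope nat_scope.
Variable Q : quiver.
Local Notation letter := (vertex Q + arrow Q)%type.
Implicit Types (x : vertex Q) (l : letter) (s : seq letter) (w : qpath Q).

Definition lsrc l := match l with inl x => x | inr a => src a end.
Definition ltgt l := match l with inl x => x | inr a => tgt a end.

Definition word_tgt x s := if s is l :: _ then ltgt l else x.

(** Vertices count as identities and [x] is the source at the right end; the words of this kind are
    those spelled by trajectories. *)
Fixpoint is_word x s : bool :=
  if s is l :: s' then (lsrc l == word_tgt x s') && is_word x s' else true.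

Definition is_arrow l := if l is inr _ then true else false.

Definition word_arrows s : seq (arrow Q) := pmap (fun l => if l is inr a then Some a else None) s.

(** Together with [word_arrows] this inverts [letters], so a trajectory can be handled as a plain
    word. *)
Fixpoint waiting s : seq nat :=
  match s with
  | [::] => [:: 0]
  | inl _ :: s' => (head 0 (waiting s')).+1 :: behead (waiting s')
  | inr _ :: s' => 0 :: waiting s'
  end.

Lemma size_waiting s : size (waiting s) = (size (word_arrows s)).+1.
Proof.
elim: s => [|[y|a] s IH] //=; last by rewrite IH.
by rewrite size_behead IH.
Qed.

Lemma waiting_neq0 s : waiting s = head 0 (waiting s) :: behead (waiting s).
Proof. by case: s => [|[y|a] s]. Qed.

Lemma sumn_waiting s : size (word_arrows s) + sumn (waiting s) = size s.
Proof.
elim: s => [|[y|a] s IH] //=; rewrite -IH //.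
by rewrite [in RHS]waiting_neq0 /= addSn addnS.
Qed.

Lemma waiting_nseq x m s : waiting (nseq m (inl x) ++ s) =
  (m + head 0 (waiting s)) :: behead (waiting s).
Proof. by elim: m => [|m IH] /=; [rewrite -waiting_neq0 | rewrite IH]. Qed.

Lemma waiting_letters x (b : seq (arrow Q)) (p : seq nat) :
  size p = (size b).+1 -> waiting (letters x b p) = p.
Proof.
elim: b p => [|a b IH] [|q p] //=; last by case=> /IH E; rewrite waiting_nseq /= addn0 E.
case: p => // _; rewrite -[nseq q _]cats0 waiting_nseq /=.
by rewrite addn0.
Qed.

Lemma word_arrows_nseq x m s : word_arrows (nseq m (inl x) ++ s) = word_arrows s.
Proof. by elim: m. Qed.

Lemma word_arrows_letters x (b : seq (arrow Q)) (p : seq nat) : word_arrows (letters x b p) = b.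
Proof.
elim: b p => [|a b IH] p; rewrite /= ?word_arrows_nseq /= ?IH //.
by rewrite -[nseq _ _]cats0 word_arrows_nseq.
Qed.

Lemma size_letters x (b : seq (arrow Q)) (p : seq nat) :
  size p = (size b).+1 -> size (letters x b p) = size b + sumn p.
Proof. by move=> E; rewrite -sumn_waiting word_arrows_letters waiting_letters. Qed.

Lemma is_word_nseq x y m s : word_tgt x s = y -> is_word x s ->
  is_word x (nseq m (inl y) ++ s) && (word_tgt x (nseq m (inl y) ++ s) == y).
Proof.
move=> Es ws; elim: m => [|m /andP[IH /eqP E]] /=; first by rewrite ws Es eqxx.
by rewrite E !eqxx IH.
Qed.

Lemma is_word_letters x (b : seq (arrow Q)) (p : seq nat) : is_path x b ->
  is_word x (letters x b p) && (word_tgt x (letters x b p) == endpoint x b).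
Proof.
elim: b p => [|a b IH] p /=.
  by move=> _; rewrite -[nseq _ _]cats0; apply: is_word_nseq.
case/andP=> sa pb; have /andP[wb /eqP Eb] := IH (behead p) pb.
by apply: is_word_nseq => //=; rewrite Eb sa wb.
Qed.

Lemma word_tgt_arrows x s : is_word x s -> word_tgt x s = endpoint x (word_arrows s).
Proof. by elim: s => [|[y|a] s IH] //= /andP[/eqP -> /IH]. Qed.

Lemma letters_waiting x s : is_word x s -> letters x (word_arrows s) (waiting s) = s.
Proof.
have lS b q (p : seq nat) : letters x b (q.+1 :: p) = inl (endpoint x b) :: letters x b (q :: p).
  by case: b.
elim: s => [|[y|a] s IH] //= /andP[/eqP Ey ws]; last by rewrite IH.
by rewrite lS -waiting_neq0 IH // -word_tgt_arrows // -Ey.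
Qed.

Lemma is_path_arrows x s : is_word x s -> is_path x (word_arrows s).
Proof.
elim: s => [|[y|a] s IH] //= /andP[/eqP Ey ws]; first exact: IH.
by rewrite -word_tgt_arrows // -Ey eqxx IH.
Qed.

Lemma is_word_nth x s d i : is_word x s -> i.+1 < size s ->
  lsrc (nth d s i) = ltgt (nth d s i.+1).
Proof.
elim: s i => [|l s IH] [|i] //= /andP[/eqP E ws]; last exact: IH.
by case: s {IH} ws E => [|l' s].
Qed.

Lemma is_word_last x s d : is_word x s -> 0 < size s -> lsrc (nth d s (size s).-1) = x.
Proof.
elim: s => [|l s IH] //= /andP[/eqP E ws] _.
by case: s E ws IH => [|l' s] //= _ ws IH; apply: IH.
Qed.

Lemma is_wordP x s d : (forall i, i.+1 < size s -> lsrc (nth d s i) = ltgt (nth d s i.+1)) ->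
  lsrc (nth d s (size s).-1) = x -> is_word x s.
Proof.
elim: s => [|l [|l' s] IH] //= H last; first by rewrite last eqxx.
rewrite -[X in _ && X]/(is_word x (l' :: s)) IH // => [|i ilt]; last exact: (H i.+1).
by rewrite (H 0) // eqxx.
Qed.

Definition word_rem i s := take i s ++ drop i.+1 s.

Lemma nth_word_rem d i s j : i < size s ->
  nth d (word_rem i s) j = if j < i then nth d s j else nth d s j.+1.
Proof.
move=> ilt; rewrite nth_cat size_take ilt; case: ltnP => ji; first by rewrite nth_take.
by rewrite nth_drop; congr nth; lia.
Qed.

Lemma size_word_rem i s : i < size s -> size (word_rem i s) = (size s).-1.
Proof. by move=> ilt; rewrite size_cat size_take ilt size_drop; lia. Qed.

(** Source and target of a vertex letter agree, so its neighbours compose after its deletion; only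
    the waiting time of its run drops by one. *)
Lemma word_rem_vertex x s i y : i < size s -> nth (inl y) s i = inl y -> is_word x s ->
  [/\ is_word x (word_rem i s), word_arrows (word_rem i s) = word_arrows s &
    exists j, j < (size (word_arrows s)).+1 /\
      waiting s = incr_nth (waiting (word_rem i s)) j].
Proof.
rewrite /word_rem; elim: s i => [|l s IH] [|i] //= ilt Ei /andP[/eqP El ws].
  rewrite drop0 Ei; split=> //; exists 0; split=> //.
  by rewrite [waiting s]waiting_neq0.
have [w1 a1 [j [jlt wj]]] := IH i ilt Ei ws.
have Et : word_tgt x (take i s ++ drop i.+1 s) = word_tgt x s.
  by rewrite !word_tgt_arrows // a1.
split; first by rewrite Et El eqxx.
  by case: (l); rewrite ?a1.
case: l El => [z|a] _ /=; last by exists j.+1; rewrite ltnS jlt wj.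
exists j; split; rewrite // wj.
by rewrite [waiting (take i s ++ _)]waiting_neq0; case: j {jlt wj}.
Qed.

Lemma nth_is_arrow d s i : i < size s -> is_arrow (nth d s i) ->
  size (word_arrows (word_rem i s)) < size (word_arrows s).
Proof.
rewrite /word_rem; elim: s i => [|l s IH] [|i] //= ilt; first by rewrite drop0; case: l.
by move/(IH i ilt); case: l.
Qed.

Section Trajectories.
Variables (w : qpath Q) (n : nat).
Implicit Type t : traj w n.

Definition traj_waiting t : seq nat := [seq nat_of_ord q | q <- val t].

Lemma size_traj_waiting t : size (traj_waiting t) = (plen w).+1.
Proof. by rewrite size_map size_tuple. Qed.

Lemma sumn_traj_waiting t : plen w + sumn (traj_waiting t) = n.
Proof. by have /eqP <- := valP t; rewrite sumnE big_map. Qed.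

Lemma traj_waiting_inj : injective traj_waiting.
Proof.
move=> t t' /(inj_map (@ord_inj _)) E; apply: val_inj; exact: val_inj.
Qed.

Lemma traj_of_waiting (p : seq nat) : size p = (plen w).+1 -> plen w + sumn p = n ->
  exists t, traj_waiting t = p.
Proof.
move=> sp En; have leq_sumn (r : seq nat) q : q \in r -> q <= sumn r.
  by elim: r => [|q' r IH] //=; rewrite inE => /orP[/eqP ->|/IH]; lia.
(* Each waiting time is at most [n], so [inord] loses nothing. *)
have ordK : [seq nat_of_ord q | q <- [seq (inord q : 'I_n.+1) | q <- p]] = p.
  rewrite -map_comp -[RHS]map_id; apply/eq_in_map => q /leq_sumn qp /=.
  by rewrite inordK // ltnS -En; apply: leq_trans qp _; apply: leq_addl.
have st : size [seq (inord q : 'I_n.+1) | q <- p] == (plen w).+1 by rewrite size_map sp.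
have tP : (plen w + \sum_(q <- Tuple st) q)%N == n.
  by rewrite -[X in _ == X]En -[in X in _ == X]ordK sumnE big_map.
by exists (exist _ (Tuple st) tP).
Qed.

Lemma traj_letters_waiting t : waiting (traj_letters t) = traj_waiting t.
Proof. by rewrite /traj_letters waiting_letters // size_traj_waiting. Qed.

Lemma traj_letters_inj : injective (@traj_letters Q w n).
Proof.
by move=> t t' /(congr1 waiting); rewrite !traj_letters_waiting; apply: traj_waiting_inj.
Qed.

Lemma size_traj_letters t : size (traj_letters t) = n.
Proof. by rewrite size_letters ?size_traj_waiting // sumn_traj_waiting. Qed.

Lemma traj_arrows t : word_arrows (traj_letters t) = parrows w.
Proof. exact: word_arrows_letters. Qed.

Lemma traj_word t : is_word (psrc w) (traj_letters t).
Proof. by have /andP[] := is_word_letters (traj_waiting t) (qpathP w). Qed.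

Lemma traj_has_arrow d t : (0 < plen w)%N ->
  exists2 i, (i < n)%N & is_arrow (nth d (traj_letters t) i).
Proof.
rewrite /plen -(traj_arrows t) => H.
suff : exists2 i, i < size (traj_letters t) & is_arrow (nth d (traj_letters t) i).
  by rewrite size_traj_letters.
elim: (traj_letters t) H => [|[v|a] s IH] //= H; last by exists 0.
by have [i ilt ai] := IH H; exists i.+1.
Qed.

Lemma traj_src d t : (0 < n)%N -> lsrc (nth d (traj_letters t) n.-1) = psrc w.
Proof. by move=> n_gt0; have := is_word_last d (traj_word t); rewrite size_traj_letters => ->. Qed.

Lemma traj_tgt t : word_tgt (psrc w) (traj_letters t) = ptgt w.
Proof. by have /andP[_ /eqP] := is_word_letters (traj_waiting t) (qpathP w). Qed.

End Trajectories.

Lemma traj_of_word x s n : is_word x s -> size s = n ->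
  exists w (t : traj w n), traj_letters t = s.
Proof.
move=> ws <-; pose w := QPath (is_path_arrows ws).
have [||t Et] := @traj_of_waiting w (size s) (waiting s).
- exact: size_waiting.
- exact: sumn_waiting.
exists w, t.
by rewrite /traj_letters -/(traj_waiting t) Et letters_waiting.
Qed.

Lemma qpath_eq w w' : psrc w = psrc w' -> parrows w = parrows w' -> w = w'.
Proof.
case: w w' => [x b p] [x' b' p'] /= Ex Eb; case: x' / Ex p' => p'; case: b' / Eb p' => p'.
by rewrite (bool_irrelevance p p').
Qed.

(** The source of the path is read off the last letter, hence the positive duration: the empty word
    is the trajectory of duration 0 over every vertex. *)
Lemma traj_letters_path n w w' (t : traj w n) (t' : traj w' n) : (0 < n)%N ->
  traj_letters t = traj_letters t' -> existT (fun w => traj w n) w t = existT _ w' t'.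
Proof.
move=> n_gt0 E; have Ew : w = w'.
  apply: qpath_eq; last by rewrite -(traj_arrows t) E traj_arrows.
  rewrite -(traj_src (inl (psrc w)) t n_gt0) E.
  exact: traj_src.
by case: w' / Ew t' E => t' /traj_letters_inj ->.
Qed.

Lemma plen_traj w n (t : traj w n) : (plen w <= n)%N.
Proof. by rewrite -(sumn_traj_waiting t) leq_addr. Qed.

(** The faces of a coboundary at [u] delete letters, whereas [path_diff] sums over predecessors;
    this links the two. *)
Lemma traj_succ_rem w n (u : traj w n.+1) i y : (i < n.+1)%N ->
  nth (inl y) (traj_letters u) i = inl y ->
  exists2 t : traj w n, traj_succ t u & traj_letters t = word_rem i (traj_letters u).
Proof.
move=> ilt Ei; have su := size_traj_letters u.
have [|w1 a1 [j [jlt wj]]] := word_rem_vertex _ Ei (traj_word u); first by rewrite su.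
rewrite traj_arrows in a1 jlt.
have [||t Et] := @traj_of_waiting w n (waiting (word_rem i (traj_letters u))).
- by rewrite size_waiting a1.
- by rewrite /plen -a1 sumn_waiting size_word_rem su.
exists t; last first.
  by rewrite [LHS]/traj_letters -/(traj_waiting t) Et -a1 letters_waiting.
apply/existsP; exists (Ordinal jlt); apply/forallP => m.
have mu : tnth (val u) m = nth 0 (traj_waiting u) m :> nat.
  by rewrite (tnth_nth ord0) (nth_map ord0) ?size_tuple.
have mt : tnth (val t) m = nth 0 (traj_waiting t) m :> nat.
  by rewrite (tnth_nth ord0) (nth_map ord0) ?size_tuple.
rewrite mu mt -traj_letters_waiting wj nth_incr_nth Et addnC.
by rewrite -[m == _]/(nat_of_ord m == j) [j == _]eq_sym.
Qed.

End Words.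

(** * Projections of Lambda onto the summands A_x and M_a *)

Section LetterProjections.
Variables (k : fieldType) (Q : quiver) (D : qset k Q).
Hypothesis comp0 : zero_compositions D.
Local Notation A := (prodA D).
Local Notation M := (sumM D).
Local Notation L := (Lambda D).
Local Notation letter := (vertex Q + arrow Q)%type.
Implicit Types (l : letter) (x y z : L) (v : vertex Q).
Local Notation pl := (@proj_letter k Q D).
Local Notation e := (idemL D).

Lemma Lambda_eq x y : (forall v, x.1 v = y.1 v) -> (forall a, x.2 a = y.2 a) -> x = y.
Proof.
move=> E1 E2; rewrite [x]surjective_pairing [y]surjective_pairing.
by congr pair; apply: functional_extensionality_dep.
Qed.

Lemma LambdaM1 x y v : (x * y).1 v = x.1 v * y.1 v.
Proof. by rewrite (LambdaM comp0). Qed.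

Lemma LambdaM2 x y a : (x * y).2 a = x.1 (tgt a) *> y.2 a + x.2 a <* y.1 (src a).
Proof. by rewrite (LambdaM comp0). Qed.

Lemma pl1 l y v : (pl l y).1 v = if l == inl v then y.1 v else 0.
Proof.
case: l => [x|a] //=; rewrite -[inl x == inl v]/(x == v) eq_sym.
by case: ifP.
Qed.

Lemma pl2 l y a : (pl l y).2 a = if l == inr a then y.2 a else 0.
Proof.
case: l => [x|b] //=; rewrite -[inr b == inr a]/(b == a) eq_sym.
by case: ifP.
Qed.

Lemma idem1 v u : (e v).1 u = if u == v then 1 else 0. Proof. by []. Qed.
Lemma idem2 v a : (e v).2 a = 0. Proof. by []. Qed.

Definition plE := (pl1, pl2, LambdaM1, LambdaM2, idem1, idem2).

Lemma pl_linear l : linear (pl l).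
Proof.
move=> c x y; apply: Lambda_eq => u.
  rewrite -[RHS]/(c *: (pl l x).1 u + (pl l y).1 u) !pl1.
  by case: ifP => // _; rewrite scaler0 addr0.
rewrite -[RHS]/(c *: (pl l x).2 u + (pl l y).2 u) !pl2.
by case: ifP => // _; rewrite scaler0 addr0.
Qed.

Lemma pl_pl l l' y : pl l (pl l' y) = if l == l' then pl l y else 0.
Proof.
case: (eqVneq l l') => [->|ll']; apply: Lambda_eq => u; rewrite !plE.
- by case: (l' == inl u).
- by case: (l' == inr u).
- by case: eqP => // El; rewrite El in ll'; rewrite eq_sym (negPf ll').
- by case: eqP => // El; rewrite El in ll'; rewrite eq_sym (negPf ll').
Qed.

Lemma pl_id l y : pl l (pl l y) = pl l y.
Proof. by rewrite pl_pl eqxx. Qed.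

Lemma pl_sum y : \sum_(l : letter) pl l y = y.
Proof.
have E1 (F : letter -> L) v : (\sum_l F l).1 v = \sum_l (F l).1 v.
  by apply: (big_morph (fun x : L => x.1 v)).
have E2 (F : letter -> L) a : (\sum_l F l).2 a = \sum_l (F l).2 a.
  by apply: (big_morph (fun x : L => x.2 a)).
apply: Lambda_eq => u.
  rewrite E1 (bigD1 (inl u)) //= big1 => [|l lu]; first by rewrite addr0 eqxx.
  by rewrite pl1 (negPf lu).
rewrite E2 (bigD1 (inr u)) //= big1 => [|l lu]; first by rewrite addr0 eqxx.
by rewrite pl2 (negPf lu).
Qed.

(** The summand of [l] lies in the corner e_(ltgt l) Lambda e_(lsrc l), so an idempotent on either
    side keeps it or kills it. *)
Lemma pl_idemR l y v : pl l (y * e v) = if v == lsrc l then pl l y else 0.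
Proof.
case: (eqVneq v (lsrc l)) => [->|vl]; apply: Lambda_eq => u; rewrite !plE.
- by case: (eqVneq l (inl u)) => [->|//]; rewrite /= eqxx mulr1.
- by case: (eqVneq l (inr u)) => [->|//]; rewrite /= eqxx lactm0 ract1 add0r.
- by case: (eqVneq l (inl u)) vl => [->|//] /= vl; rewrite eq_sym (negPf vl) mulr0.
- by case: (eqVneq l (inr u)) vl => [->|//] /= vl; rewrite eq_sym (negPf vl) lactm0 ractm0 addr0.
Qed.

Lemma pl_idemL l y v : pl l (e v * y) = if v == ltgt l then pl l y else 0.
Proof.
case: (eqVneq v (ltgt l)) => [->|vl]; apply: Lambda_eq => u; rewrite !plE.
- by case: (eqVneq l (inl u)) => [->|//]; rewrite /= eqxx mul1r.
- by case: (eqVneq l (inr u)) => [->|//]; rewrite /= eqxx ract0m lact1 addr0.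
- by case: (eqVneq l (inl u)) vl => [->|//] /= vl; rewrite eq_sym (negPf vl) mul0r.
- by case: (eqVneq l (inr u)) vl => [->|//] /= vl; rewrite eq_sym (negPf vl) lact0m ract0m addr0.
Qed.

Lemma pl_mul_idemR l y v : pl l y * e v = if v == lsrc l then pl l y else 0.
Proof.
rewrite -[LHS]pl_sum (bigD1 l) //= big1 ?addr0 => [|l' ll'].
  by rewrite pl_idemR pl_id.
by rewrite pl_idemR pl_pl (negPf ll'); case: ifP.
Qed.

Lemma pl_mul_idemL l y v : e v * pl l y = if v == ltgt l then pl l y else 0.
Proof.
rewrite -[LHS]pl_sum (bigD1 l) //= big1 ?addr0 => [|l' ll'].
  by rewrite pl_idemL pl_id.
by rewrite pl_idemL pl_pl (negPf ll'); case: ifP.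
Qed.

Lemma pl_vertexM l v y z : pl l (pl (inl v) y * pl l z) = pl (inl v) y * pl l z.
Proof.
apply: Lambda_eq => u; rewrite !plE; first by case: (l == inl u); rewrite ?mulr0.
by case: (l == inr u); rewrite //= lactm0 ract0m addr0.
Qed.

Lemma pl_Mvertex l v y z : pl l (pl l y * pl (inl v) z) = pl l y * pl (inl v) z.
Proof.
apply: Lambda_eq => u; rewrite !plE; first by case: (l == inl u); rewrite ?mul0r.
by case: (l == inr u); rewrite //= lactm0 ract0m addr0.
Qed.

Lemma pl_arrowM a b y z : pl (inr a) y * pl (inr b) z = 0.
Proof.
apply: Lambda_eq => u; rewrite !plE /=; first by rewrite mul0r.
by rewrite lact0m ractm0 addr0.
Qed.

Lemma pl_arrow1 a y : (pl (inr a) y).1 = 0 :> A. Proof. by []. Qed.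

End LetterProjections.

Section OrdinalSequences.
Variables (k : fieldType) (L : algType k).

(** The bridge from the ordinal-indexed arguments of path cochains to the sequences of the bar
    complex; the default 0 lies beyond the arguments that are read. *)
Definition ext n (x : 'I_n -> L) : nat -> L := fun j => if insub j is Some i then x i else 0.

Lemma ext_ord n (x : 'I_n -> L) (i : 'I_n) : ext x i = x i.
Proof. by rewrite /ext valK. Qed.

Lemma ext_merge n (i : 'I_n) (x : 'I_n.+1 -> L) j : (j < n)%N ->
  ext (merge_at i x) j = face i (ext x) j.
Proof.
move=> jn; rewrite -[j]/(nat_of_ord (Ordinal jn)) ext_ord /merge_at /face.
have E1 (m : 'I_n) : ext x m = x (lift ord_max m).
  by rewrite -ext_ord lift_max.
have E2 (m : 'I_n) : ext x m.+1 = x (lift ord0 m).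
  by rewrite -ext_ord lift0.
by rewrite !E1 !E2.
Qed.

Lemma ext_lift0 n (x : 'I_n.+1 -> L) j : (j < n)%N -> ext (fun i => x (lift ord0 i)) j = shift (ext x) j.
Proof.
move=> jn; rewrite -[j in LHS]/(nat_of_ord (Ordinal jn)) ext_ord.
by rewrite -ext_ord lift0.
Qed.

Lemma ext_lift_max n (x : 'I_n.+1 -> L) j : (j < n)%N -> ext (fun i => x (lift ord_max i)) j = ext x j.
Proof.
move=> jn; rewrite -[j in LHS]/(nat_of_ord (Ordinal jn)) ext_ord.
by rewrite -ext_ord lift_max.
Qed.

Lemma ext_upd n (x : 'I_n -> L) (i : 'I_n) u : 
  ext (fun j => if j == i then u else x j) = upd (ext x) i u.
Proof.
apply: funext => j; rewrite /upd /ext; case: insubP => [m _ <-|].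
  by [].
by case: eqP => // -> /negP; rewrite ltn_ord.
Qed.

(** With the sum inside each face, a face can be matched with the single predecessor that it comes
    from. *)
Lemma sum_hcobound n (J : finType) (P : pred J) (F : J -> ('I_n -> L) -> L) (y : 'I_n.+1 -> L) :
  \sum_(t | P t) hcobound (F t) y =
    y ord0 * (\sum_(t | P t) F t (fun j => y (lift ord0 j)))
    + \sum_(i < n) (-1) ^+ i.+1 *: (\sum_(t | P t) F t (merge_at i y))
    + (-1) ^+ n.+1 *: ((\sum_(t | P t) F t (fun j => y (lift ord_max j))) * y ord_max).
Proof.
rewrite /hcobound !big_split mulr_sumr mulr_suml scaler_sumr; congr (_ + _ + _).
by rewrite exchange_big; apply: eq_bigr => i _; rewrite scaler_sumr.
Qed.

End OrdinalSequences.

(* Applied to [X = M] with [S] the non cycles, and to [X = A] with [S] the cycles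
   of positive length; [iota] embeds [X] into [A (+) M], with retraction [rho]. *)
Section Decomposition.
Variables (k : fieldType) (Q : quiver) (D : qset k Q).
Hypothesis comp0 : zero_compositions D.
Local Notation A := (prodA D).
Local Notation L := (Lambda D).
Local Notation letter := (vertex Q + arrow Q)%type.
Local Notation pl := (@proj_letter k Q D).
Local Notation e := (idemL D).

Variable X : bimod A A.
Local Notation W := (infl comp0 X).
Variables (iota : X -> L) (rho : L -> X) (S : qpath Q -> bool).
Hypothesis iota_lin : linear iota.
Hypothesis rho_lin : linear rho.
Hypothesis iotaL : forall (a : L) (m : X), a.2 = 0 :> sumM D -> iota (a.1 *> m) = a * iota m.
Hypothesis iotaR : forall (a : L) (m : X), a.2 = 0 :> sumM D -> iota (m <* a.1) = iota m * a.
Hypothesis iotaK : cancel iota rho.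
Hypothesis rhoL : forall v z, rho (e v * z) = (e v).1 *> rho z.
Hypothesis rhoR : forall v z, rho (z * e v) = rho z <* (e v).1.
Hypothesis S_pos : forall w, S w -> (0 < plen w)%N.
(** [S_val] lets values of path cochains be read in X, and [S_not] discards the other paths of
    positive length. Vertices are covered by neither; the condition [vanish] excludes components
    along them. *)
Hypothesis S_val : forall w z, S w -> e (ptgt w) * z * e (psrc w) = z -> iota (rho z) = z.
Hypothesis S_not : forall w (m : X), ~~ S w -> (0 < plen w)%N ->
  (e (ptgt w)).1 *> m <* (e (psrc w)).1 = 0.

Implicit Types (h : (nat -> L) -> W) (s : seq letter) (z : nat -> L) (d : letter).

Definition pw d s z : nat -> L := fun j => pl (nth d s j) (z j).
Definition homog d s z := forall j, (j < size s)%N -> pl (nth d s j) (z j) = z j.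
Definition vanish n h := forall z, (forall i, (i < n)%N -> (z i).2 = 0 :> sumM D) -> h z = 0.

Lemma hoch_eq0 n h i z : is_hoch e n h -> (i < n)%N -> z i = 0 -> h z = 0.
Proof.
move=> hh ilt z0; rewrite -(upd_id z i) z0.
exact: (linear_eq0 (hoch_lin hh z ilt)).
Qed.

Lemma hoch_homog n h d s z : is_hoch e n h -> size s = n -> homog d s z -> h (pw d s z) = h z.
Proof. by move=> hh sn hz; apply: (hoch_loc hh) => i ilt; rewrite /pw hz ?sn. Qed.

Lemma hoch_other n h d s s' z : is_hoch e n h -> size s = n -> size s' = n ->
  s <> s' -> homog d s' z -> h (pw d s z) = 0.
Proof.
move=> hh sn s'n ss' hz.
have [j jn nj] : exists2 j, (j < n)%N & nth d s j != nth d s' j.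
  apply: contrapT => H; apply: ss'; apply: (@eq_from_nth _ d) => [|j]; first by rewrite sn s'n.
  rewrite sn => jn; apply/eqP/negPn/negP => nj; apply: H; by exists j.
apply: (hoch_eq0 hh jn); rewrite /pw -hz ?s'n // pl_pl.
by rewrite (negPf nj).
Qed.

Lemma pw_upd d s z i u : pw d s (upd z i u) = upd (pw d s z) i (pl (nth d s i) u).
Proof. by apply: funext => j; rewrite /pw /upd; case: eqP => // ->. Qed.

(* The component along [w] of a normalised cochain. *)
Definition Phi w n h (t : traj w n) (x : 'I_n -> L) : L := iota (h (ext (proj_traj t x))).

Lemma PhiE w n h (t : traj w n) x : is_hoch e n h ->
  Phi h t x = iota (h (pw (inl (psrc w)) (traj_letters t) (ext x))).
Proof.
move=> hh; congr iota; apply: (hoch_loc hh) => j jn.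
by rewrite -[j]/(nat_of_ord (Ordinal jn)) ext_ord /pw ext_ord.
Qed.

Lemma iota0 : iota 0 = 0.
Proof. by apply: (linear_eq0 iota_lin). Qed.

Lemma traj_homog w n (t : traj w n) x :
  homog (inl (psrc w)) (traj_letters t) (pw (inl (psrc w)) (traj_letters t) x).
Proof. by move=> j jlt; rewrite /pw pl_id. Qed.

Lemma traj_ends n w (t : traj w n) h z : is_hoch e n h -> (0 < n)%N ->
  homog (inl (psrc w)) (traj_letters t) z ->
  (e (ptgt w)).1 *> (h z : X) = h z /\ (h z : X) <* (e (psrc w)).1 = h z.
Proof.
move=> hh n_gt0 hz; have st := size_traj_letters t.
split.
  rewrite -[LHS]/(e (ptgt w) *> h z) -(hoch_left hh) // -(hz 0%N) ?st //.
  rewrite pl_mul_idemL // ifT.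
    by rewrite hz ?st // upd_id.
  rewrite -(traj_tgt t); case: (traj_letters t) st => [/= n0|l s' _] /=; last by rewrite eqxx.
  by move: n_gt0; rewrite -{1}n0.
rewrite -[LHS]/(h z <* e (psrc w)) -(hoch_right hh) // -(hz n.-1) ?st ?ltn_predL //.
rewrite pl_mul_idemR // traj_src // eqxx.
by rewrite hz ?st ?ltn_predL // upd_id.
Qed.

Lemma Phi_path w n h : is_hoch e n h -> S w -> @Phi w n h \in @path_coch k Q D w n.
Proof.
move=> hh Sw; apply/asboolP => t; split.
- move=> i x c u v; rewrite !PhiE // !ext_upd !pw_upd pl_linear.
  by rewrite (hoch_lin hh) // iota_lin.
- move=> x; rewrite /Phi; congr (iota (h (ext _))); apply: funext => i.
  exact: pl_id.
- move=> x; rewrite PhiE //; set z := pw _ _ _.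
  have n_gt0 : (0 < n)%N := leq_trans (S_pos Sw) (plen_traj t).
  have [E1 E2] := traj_ends hh n_gt0 (@traj_homog _ _ t (ext x)).
  by rewrite -[unit_at _ _]/(e _) -iotaL // E1 -[unit_at _ _]/(e _) -iotaR // E2.
Qed.

(* Along [w], a face of a trajectory removes a vertex; faces that lose an arrow
   contribute nothing, as [M M = 0] and as [M] kills the coefficients. *)
Lemma Phi_sum_hit w n h (u : traj w n.+1) i y (z : 'I_n -> L) : is_hoch e n h -> (i < n.+1)%N ->
  nth (inl (psrc w)) (traj_letters u) i = inl y ->
  homog (inl (psrc w)) (word_rem i (traj_letters u)) (ext z) ->
  \sum_(t | traj_succ t u) Phi h t z = iota (h (ext z)).
Proof.
move=> hh ilt Ei hz.
have Ei' : nth (inl y) (traj_letters u) i = inl y.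
  by rewrite (set_nth_default (inl (psrc w))) ?size_traj_letters.
have [t0 t0u Et0] := traj_succ_rem ilt Ei'.
rewrite (bigD1 t0) //= big1 ?addr0 => [|t /andP[_ tt0]].
  by rewrite PhiE // Et0 (hoch_homog hh _ hz) // -Et0 size_traj_letters.
rewrite PhiE // (hoch_other hh _ _ _ hz) ?iota0 ?size_traj_letters //.
  by rewrite -Et0 size_traj_letters.
by rewrite -Et0 => /traj_letters_inj E; rewrite E eqxx in tt0.
Qed.

Lemma Phi_short w n h (t : traj w n) s (z : 'I_n -> L) : is_hoch e n h -> size s = n ->
  (size (word_arrows s) < plen w)%N -> homog (inl (psrc w)) s (ext z) -> Phi h t z = 0.
Proof.
move=> hh sn sw hz; rewrite PhiE // (hoch_other hh _ sn _ hz) ?iota0 ?size_traj_letters //.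
by move=> E; rewrite -E traj_arrows ltnn in sw.
Qed.

(** The two coboundaries are compared face by face. A face that removes a vertex from [u] sees
    exactly one predecessor; any other face is zero on both sides. *)
Lemma Phi_dbar w n (f : (nat -> L) -> W) : is_bar e n f -> S w ->
  path_diff (@Phi w n (rbar n f)) = @Phi w n.+1 (rbar n.+1 (dbar n f)).
Proof.
move=> bf Sw; apply: funext => u; apply: funext => x.
set h := rbar n f; have hh : is_hoch e n h := rbar_hoch bf.
rewrite /path_diff {2}/Phi; set y := proj_traj u x.
rewrite (rbar_dbar _ bf) -/h.
set d := inl (psrc w) : letter; set s := traj_letters u.
have ss : size s = n.+1 := size_traj_letters u.
have hy : homog d s (ext y).
  move=> j; rewrite ss => jlt; rewrite -[j]/(nat_of_ord (Ordinal jlt)) ext_ord.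
  exact: pl_id.
rewrite sum_hcobound.
have [iota' iota'E] := linear_fun iota_lin.
have iotaD a b : iota (a + b) = iota a + iota b by rewrite -iota'E linearD !iota'E.
rewrite 2!iotaD.
have y0 : y ord0 = ext y 0%N by rewrite -ext_ord.
have yn : y ord_max = ext y n by rewrite -ext_ord.
have locE := hoch_loc hh.
congr (_ + _ + _).
- rewrite y0; case E0 : (nth d s 0) => [v|a].
    have E : h (ext (fun j => y (lift ord0 j))) = h (shift (ext y)).
      by apply: locE => i ilt; rewrite ext_lift0.
    rewrite (Phi_sum_hit hh (i := 0) (y := v)) // ?E ?iotaL //.
      by rewrite -(hy 0%N) ?ss // E0.
    move=> j; rewrite size_word_rem ?ss // => jlt.
    by rewrite nth_word_rem ?ss //= ext_lift0 // /shift hy // ss.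
  (* The first letter is an arrow: its action on the coefficients is zero, and what remains has too
     few arrows to be a trajectory over [w]. *)
  rewrite big1 => [|t _].
    by rewrite -[ext y 0 *> _]/((ext y 0).1 *> _) -(hy 0%N) ?ss // E0 pl_arrow1 mulr0 lact0m iota0.
  apply: (@Phi_short _ _ _ _ (word_rem 0 s) _ hh).
  + by rewrite size_word_rem ss.
  + rewrite /plen -(traj_arrows u) -/s; apply: (@nth_is_arrow _ d s 0); [by rewrite ss | by rewrite E0].
  + move=> j; rewrite size_word_rem ?ss // => jlt.
    by rewrite nth_word_rem ?ss //= ext_lift0 // /shift hy // ss.
- rewrite -iota'E linear_sum; apply: eq_bigr => i _; rewrite linearZ /= iota'E; congr (_ *: _).
  have ilt := ltn_ord i.
  have E : h (ext (merge_at i y)) = h (face i (ext y)).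
    by apply: locE => j jlt; rewrite ext_merge.
  case Ei : (nth d s i) => [v|a].
    rewrite (Phi_sum_hit hh (i := i) (y := v)) ?E //; first by lia.
    move=> j; rewrite size_word_rem ?ss; last by lia.
    move=> jlt; rewrite nth_word_rem ?ss; last by lia.
    rewrite ext_merge // /face; case: ltnP => ji; first by rewrite hy // ss; lia.
    case: eqP => [->|ni]; last by rewrite hy // ss; lia.
    rewrite -[ext y i]hy ?ss; last by lia.
    by rewrite -[ext y i.+1]hy ?ss // Ei pl_vertexM.
  (* Letter [i] is an arrow here, so the vertex to remove can only be letter [i.+1]; two arrows have
     product zero. *)
  case Ei1 : (nth d s i.+1) => [v|b].
    rewrite (Phi_sum_hit hh (i := i.+1) (y := v)) ?E //.
    move=> j; rewrite size_word_rem ?ss // => jlt; rewrite nth_word_rem ?ss //.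
    rewrite ext_merge // /face; case: (ltngtP j i) => ji.
    + by rewrite ifT ?hy ?ss //; lia.
    + by rewrite ifF ?hy ?ss //; lia.
    + rewrite ji ltnSn -[ext y i]hy ?ss; last by lia.
      by rewrite -[ext y i.+1]hy ?ss // Ei1 pl_Mvertex.
  have f0 : face i (ext y) i = 0.
    rewrite /face ltnn eqxx -[ext y i]hy ?ss; last by lia.
    by rewrite -[ext y i.+1]hy ?ss // Ei Ei1 pl_arrowM.
  rewrite big1 => [|t _]; first by rewrite (hoch_eq0 hh ilt f0) iota0.
  rewrite PhiE // (hoch_eq0 hh ilt) ?iota0 // /pw ext_merge // f0.
  by apply: (linear_eq0 (@pl_linear k Q D (nth (inl (psrc w)) (traj_letters t) i))).
- have -> m : iota ((-1) ^+ n.+1 *: m) = (-1) ^+ n.+1 *: iota m by rewrite -iota'E linearZ /= iota'E.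
  congr (_ *: _); rewrite yn; case En : (nth d s n) => [v|a].
    have E : h (ext (fun j => y (lift ord_max j))) = h (ext y).
      by apply: locE => i ilt; rewrite ext_lift_max.
    rewrite (Phi_sum_hit hh (i := n) (y := v)) // ?E ?iotaR //.
      by rewrite -(hy n) ?ss // En.
    move=> j; rewrite size_word_rem ?ss // => jlt.
    by rewrite nth_word_rem ?ss // jlt ext_lift_max // hy // ss; lia.
  rewrite big1 => [|t _].
    by rewrite -[_ <* ext y n]/(_ <* (ext y n).1) -(hy n) ?ss // En pl_arrow1 mul0r ractm0 iota0.
  apply: (@Phi_short _ _ _ _ (word_rem n s) _ hh).
  + by rewrite size_word_rem ss.
  + rewrite /plen -(traj_arrows u) -/s; apply: (@nth_is_arrow _ d s n); [by rewrite ss | by rewrite En].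
  + move=> j; rewrite size_word_rem ?ss // => jlt.
    by rewrite nth_word_rem ?ss // jlt ext_lift_max // hy // ss; lia.
Qed.
Lemma hoch_sum_letters n h m z : is_hoch e n h -> (m < n)%N ->
  h z = \sum_l h (upd z m (pl l (z m))).
Proof.
move=> hh mn; have [g gE] := linear_fun (hoch_lin hh z mn).
have -> : h z = g (z m) by rewrite gE upd_id.
rewrite -{1}(pl_sum (z m)) linear_sum; by apply: eq_bigr => l _; rewrite gE.
Qed.

(* Induction on the number of arguments that have been decomposed into letters. *)
Lemma hoch_letters n h m : is_hoch e n h -> (m <= n)%N ->
  (forall (ell : nat -> letter) z, h (fun i => if (i < m)%N then pl (ell i) (z i) else z i) = 0) ->
  forall z, h z = 0.
Proof.
move=> hh; elim: m => [|m IH] mn H z.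
  by have /card_gt0P[v _] := vertex_inh Q; apply: (H (fun=> inl v)).
apply: (IH (ltnW mn) _ z) => ell {}z.
rewrite (hoch_sum_letters _ hh mn) big1 // => l _; rewrite ltnn.
rewrite -(H (fun i => if i == m then l else ell i) z); congr h; apply: funext => i.
rewrite /upd; have [->|ni] := eqVneq i m; first by rewrite ltnSn.
by rewrite ltnS [in RHS]leq_eqVlt (negPf ni).
Qed.

(** By multilinearity the arguments may be single letters. If two neighbours do not compose, an
    idempotent inserted between them gives 0 by balance. Otherwise they spell a trajectory, and the
    value is zero by the assumption on [Phi], by [vanish] for a vertex, or by [S_not]. *)
Lemma Phi_inj n h : is_hoch e n h -> vanish n h ->
  (forall w, S w -> forall t x, @Phi w n h t x = 0) -> forall z, h z = 0.
Proof.
move=> hh hv H; apply: (hoch_letters hh (leqnn n)) => ell x.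
set z := fun i => _; have zE i : (i < n)%N -> z i = pl (ell i) (x i) by rewrite /z => ->.
have [[i [ilt ni]]|comp] := EM (exists i, (i.+1 < n)%N /\ lsrc (ell i) <> ltgt (ell i.+1)).
  rewrite -(upd_id z i); have -> : z i = z i * e (lsrc (ell i)).
    by rewrite zE ?(ltnW ilt) // pl_mul_idemR // eqxx.
  rewrite (hoch_bal hh) // (hoch_eq0 hh ilt) // upd_eq zE // pl_mul_idemL //.
  by case: eqP.
have [n0|n_gt0] := posnP n; first by apply: hv => i; rewrite n0.
set d := ell n.-1; set s := mkseq ell n.
have ss : size s = n by rewrite size_mkseq.
have sE i : (i < n)%N -> nth d s i = ell i by move=> ilt; rewrite nth_mkseq.
have ws : is_word (lsrc d) s.
  apply: (@is_wordP _ _ _ d) => [i|]; rewrite ss; last by rewrite sE ?ltn_predL.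
  move=> ilt; rewrite !sE ?(ltnW ilt) //; apply: contrapT => ni; apply: comp; by exists i.
have [w [t Et]] := traj_of_word ws ss.
have hz : homog (inl (psrc w)) (traj_letters t) z.
  move=> j; rewrite size_traj_letters => jlt.
  by rewrite Et (set_nth_default d) ?ss // sE // zE // pl_id.
have [Sw|nSw] := boolP (S w).
  have := H w Sw t (fun i => z i); rewrite PhiE //.
  rewrite -[h z](hoch_homog hh (size_traj_letters t) hz) => /(congr1 rho).
  rewrite iotaK => E; transitivity (rho 0).
    rewrite -E; apply: (hoch_loc hh) => i ilt; rewrite /pw; congr (pl _ _).
    by rewrite -[i in RHS]/(nat_of_ord (Ordinal ilt)) ext_ord.
  by apply: (linear_eq0 rho_lin).
have [w0|w_gt0] := posnP (plen w).
  apply: hv => i ilt; rewrite zE // -sE //; case E : (nth d s i) => [v|a] //.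
  have : is_arrow (nth d s i) by rewrite E.
  by move/nth_is_arrow; rewrite ss ilt -Et traj_arrows -/(plen w) w0 => /(_ isT).
have [E1 E2] := traj_ends hh n_gt0 hz.
by rewrite -E2 -E1 S_not.
Qed.

(** The components are added up over words of [n] letters, a finite type, instead of over the
    possibly infinitely many paths. In degree 0 no path in [S] has a trajectory, and 0 serves. *)
Lemma Phi_onto n (F : forall w, traj w n -> ('I_n -> L) -> L) :
  (forall w, S w -> F w \in @path_coch k Q D w n) ->
  exists f, [/\ is_bar e n f, vanish n (rbar n f) &
    forall w, S w -> @Phi w n (rbar n f) = F w].
Proof.
move=> FC; have [n0|n_gt0] := posnP n.
  have notraj w : S w -> traj w n -> False.
    by move=> /S_pos w_gt0 /plen_traj; rewrite n0 leqNgt w_gt0.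
  exists 0; split; first by split=> [|x b]; [exact: is_coind0 | rewrite -[RHS]/(0 <* b) ract0m].
    by [].
  by move=> w Sw; apply: funext => t; case: (notraj w Sw t).
pose hit (s : n.-tuple letter) w (t : traj w n) := S w /\ traj_letters t = s.
(* A word of positive length spells at most one trajectory, so the component attached to it is well
   defined. *)
have exG (s : n.-tuple letter) : exists g : ('I_n -> L) -> L,
    (forall w t, hit s w t -> g = F w t) /\
    (g = (fun=> 0) \/ exists w t, hit s w t /\ g = F w t).
  have [[w [t ht]]|nh] := EM (exists w t, hit s w t).
    exists (F w t); split; last by right; exists w, t.
    move=> w' t' ht'; have Et := etrans ht.2 (esym ht'.2).
    have := traj_letters_path n_gt0 Et => E.
    exact: (f_equal (fun p : {w : qpath Q & traj w n} => F (projT1 p) (projT2 p)) E).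
  by exists (fun=> 0); split; [move=> w t ht; case: nh; exists w, t | left].
pose G (s : n.-tuple letter) := projT1 (cid (exG s)).
have GF (s : n.-tuple letter) w t : hit s w t -> G s = F w t by have := (projT2 (cid (exG s))).1; apply.
have G0F (s : n.-tuple letter) : G s = (fun=> 0) \/ exists w t, hit s w t /\ G s = F w t.
  exact: (projT2 (cid (exG s))).2.
have rho0 : rho 0 = 0 by apply: (linear_eq0 rho_lin).
pose h (z : nat -> L) : W := \sum_(s : n.-tuple letter) rho (G s (fun i : 'I_n => z i)).
have FP w t x : S w -> F w t (proj_traj t x) = F w t x.
  by move=> Sw; have /asboolP/(_ t)[_ E _] := FC w Sw.
have Flin w t (i : 'I_n) (x : 'I_n -> L) : S w -> linear (fun u : L => F w t (fun j => if j == i then u else x j)).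
  by move=> Sw; have /asboolP/(_ t)[E _ _] := FC w Sw; apply: E.
have F0 w t (i : 'I_n) (x : 'I_n -> L) : S w -> x i = 0 -> F w t x = 0.
  move=> Sw xi; have -> : x = fun j => if j == i then 0 else x j.
    by apply: funext => j; case: eqP => // ->.
  by apply: (linear_eq0 (Flin w t i x Sw)).
have Fval w t x : S w -> e (ptgt w) * F w t x * e (psrc w) = F w t x.
  by move=> Sw; have /asboolP/(_ t)[_ _ E] := FC w Sw; apply: E.
have Fpl w t (x y : 'I_n -> L) : S w -> (forall i : 'I_n, pl (nth (inl (psrc w)) (traj_letters t) i) (x i) =
    pl (nth (inl (psrc w)) (traj_letters t) i) (y i)) -> F w t x = F w t y.
  by move=> Sw E; rewrite -FP // -[RHS]FP //; congr (F w t _); apply: funext => i; apply: E.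
have Fpl0 w t (x : 'I_n -> L) (i : 'I_n) : S w -> pl (nth (inl (psrc w)) (traj_letters t) i) (x i) = 0 -> F w t x = 0.
  by move=> Sw E; rewrite -FP // (F0 _ _ i).
have hh : is_hoch e n h.
  split=> [x y E|i x ilt c u v|x i v ilt|x v _|x v _|x v n0]; last by rewrite n0 in n_gt0.
  - by apply: eq_bigr => s _; congr (rho (G s _)); apply: funext => i; apply: E.
  - rewrite /h scaler_sumr -big_split; apply: eq_bigr => s _ /=.
    case: (G0F s) => [->|[w [t [[Sw _] ->]]]]; first by rewrite rho0 scaler0 addr0.
    rewrite -rho_lin; congr rho.
    exact: (Flin w t (Ordinal ilt) (fun j => x j) Sw c u v).
  - apply: eq_bigr => s _; congr rho.
    case: (G0F s) => [->//|[w [t [[Sw _] ->]]]].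
    have i_n : (i < n)%N := ltnW ilt.
    pose d' : letter := inl (psrc w).
    have Ei : lsrc (nth d' (traj_letters t) i) = ltgt (nth d' (traj_letters t) i.+1).
      by apply: is_word_nth (traj_word t) _; rewrite size_traj_letters.
    (* Consecutive letters of a trajectory compose, so [e v] fixes both neighbouring arguments or
       kills both. *)
    have [vE|nv] := eqVneq v (lsrc (nth d' (traj_letters t) i)).
      apply: Fpl => // j; rewrite /upd; case: eqP => [->|ni].
        rewrite ifF; last by apply/eqP; lia.
        by rewrite pl_idemR // vE eqxx.
      by case: eqP => [->|//]; rewrite pl_idemL // vE Ei eqxx.
    rewrite (Fpl0 w t _ (Ordinal i_n)) ?upd_eq ?pl_idemR ?(negPf nv) //.
    rewrite (Fpl0 w t _ (Ordinal ilt)) ?upd_eq ?pl_idemL //=.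
    by rewrite -Ei (negPf nv).
  - rewrite /h lact_sum; apply: eq_bigr => s _.
    rewrite -[e v *> _]/((e v).1 *> rho _) -rhoL; congr rho.
    case: (G0F s) => [->|[w [t [[Sw _] ->]]]]; first by rewrite mulr0.
    have Et : ltgt (nth (inl (psrc w)) (traj_letters t) 0) = ptgt w.
      by rewrite -(traj_tgt t); case: (traj_letters t).
    rewrite -[in RHS]Fval // mulrA mulrA idemL_orth //.
    have [vE|nv] := eqVneq v (ptgt w).
      rewrite vE Fval //; apply: Fpl => // j; rewrite /upd; case: eqP => [->|//].
      by rewrite pl_idemL // Et eqxx.
    rewrite !mul0r (Fpl0 w t _ (Ordinal n_gt0)) ?upd_eq ?pl_idemL //=.
    by rewrite Et (negPf nv).
  - rewrite /h ract_sum; apply: eq_bigr => s _.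
    rewrite -[_ <* e v]/(rho _ <* (e v).1) -rhoR; congr rho.
    case: (G0F s) => [->|[w [t [[Sw _] ->]]]]; first by rewrite mul0r.
    have Et := traj_src (inl (psrc w)) t n_gt0.
    rewrite -[in RHS]Fval // -[RHS]mulrA idemL_orth //.
    have [vE|nv] := eqVneq (psrc w) v.
      rewrite -vE Fval //; apply: Fpl => // j; rewrite /upd; case: eqP => [->|//].
      by rewrite pl_idemR // Et eqxx.
    have nlt : (n.-1 < n)%N by rewrite ltn_predL.
    rewrite mulr0 (Fpl0 w t _ (Ordinal nlt)) ?upd_eq ?pl_idemR //=.
    by rewrite Et eq_sym (negPf nv).
exists (ebar n h); rewrite (rebarK hh); split; first exact: ebar_bar.
  move=> z z0; rewrite /h big1 // => s _.
  case: (G0F s) => [->//|[w [t [[Sw _] ->]]]].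
  have [i ilt ai] := traj_has_arrow (inl (psrc w)) t (S_pos Sw).
  rewrite (Fpl0 w t _ (Ordinal ilt)) //=.
  case: (nth _ _ _) ai => // a _; apply: Lambda_eq => u; first by rewrite pl1.
  by rewrite pl2 z0 //; case: ifP.
move=> w Sw; apply: funext => t; apply: funext => x.
rewrite PhiE // /h; set z := pw _ _ _.
have st : size (traj_letters t) == n by rewrite size_traj_letters.
rewrite (bigD1 (Tuple st)) //= big1 ?addr0.
  rewrite (GF _ w t) //; have -> : F w t (fun i => z i) = F w t x.
    by apply: Fpl => // i; rewrite /z /pw pl_id ext_ord.
  by apply: (S_val Sw); apply: Fval.
move=> s sne; case: (G0F s) => [->//|[w' [t' [[Sw' Et'] ->]]]].
have [j jn nj] : exists2 j, (j < n)%N & nth (inl (psrc w')) (traj_letters t') j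
     != nth (inl (psrc w)) (traj_letters t) j.
  apply: contrapT => H; case/negP: sne; apply/eqP/val_inj; rewrite /= -Et'.
  apply: (@eq_from_nth _ (inl (psrc w'))) => [|j]; first by rewrite !size_traj_letters.
  rewrite size_traj_letters => jn; apply/eqP/negPn/negP => nj; apply: H; exists j => //.
  by rewrite [X in _ != X](set_nth_default (inl (psrc w'))) ?size_traj_letters.
rewrite (Fpl0 w' t' _ (Ordinal jn)) //= /z /pw pl_pl.
by rewrite (negPf nj).
Qed.

Lemma dbar_vanish n f : is_bar e n f -> vanish n (rbar n f) ->
  vanish n.+1 (rbar n.+1 (dbar n f)).
Proof.
move=> bf vf z z0; rewrite (rbar_dbar _ bf) (vf (shift z)) => [|i ilt]; last exact: z0.
rewrite (vf z) => [|i ilt]; last by apply: z0; apply: ltnW.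
rewrite lactm0 ract0m scaler0 addr0 add0r big1 // => i _.
rewrite (vf (face i z)) ?scaler0 // => j jlt; rewrite /face.
case: ifP => _; first by apply: z0; apply: ltnW.
case: ifP => _; last exact: z0.
by rewrite (LambdaAA comp0) // z0 //; have := ltn_ord i; lia.
Qed.

Lemma PhiP w n c (f g : (nat -> L) -> W) :
  @Phi w n (rbar n (c *: f + g)) = c *: @Phi w n (rbar n f) + @Phi w n (rbar n g).
Proof. by apply: funext => t; apply: funext => x; apply: iota_lin. Qed.

Local Notation barW := (bar_cochains e W).
Local Notation Pw w n f := (@Phi w n (rbar n f)).

Lemma Phi_cocycle w n f : S w -> f \in @cocycles k barW n ->
  Pw w n f \in @cocycles k (path_cochains D w) n.
Proof.
move=> Sw /(@cocyclesP k barW)[/bar_predP bf df].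
apply/(@cocyclesP k (path_cochains D w)); split; first exact/Phi_path/Sw/rbar_hoch.
rewrite -[LHS]/(path_diff _) Phi_dbar //.
have -> : dbar n f = 0 by exact: df.
by apply: funext => t; apply: funext => x; apply: iota0.
Qed.

Lemma Phi_bound w n f : S w -> f \in @coboundaries k barW n ->
  Pw w n f \in @coboundaries k (path_cochains D w) n.
Proof.
move=> Sw; case: n f => [|n] f.
  move/(@coboundaries0P k barW) ->; apply/(@coboundaries0P k (path_cochains D w)).
  by apply: funext => t; apply: funext => x; apply: iota0.
move/(@coboundariesSP k barW) => [g /bar_predP bg ->].
apply/(@coboundariesSP k (path_cochains D w)); exists (Pw w n g); first exact/Phi_path/Sw/rbar_hoch.
by rewrite -[RHS]/(path_diff _) Phi_dbar.
Qed.

(** Primitives along the single paths are assembled by [Phi_onto] into one cochain [g]; then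
    [f - dbar n g] has no component left and is zero by [Phi_inj]. *)
Lemma Phi_bound_inv n f : is_bar e n f -> vanish n (rbar n f) ->
  (forall w, S w -> (plen w <= n)%N -> Pw w n f \in @coboundaries k (path_cochains D w) n) ->
  f \in @coboundaries k barW n.
Proof.
move=> bf vf Bf.
have ebar0 (m : nat) (f' : (nat -> L) -> W) : is_bar e m f' -> (forall z, rbar m f' z = 0) -> f' = 0.
  move=> bf' f0; rewrite -(ebarK bf'); apply: funext => x.
  by rewrite /ebar f0 lactm0 ract0m.
case: n f bf vf Bf => [|n] f bf vf Bf.
  apply/(@coboundaries0P k barW)/(ebar0 0 _ bf).
  apply: (Phi_inj (rbar_hoch bf) vf) => w Sw t x.
  by have := leq_trans (S_pos Sw) (plen_traj t).
have exG w : exists G : traj w n -> ('I_n -> L) -> L, S w -> G \in @path_coch k Q D w n /\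
    Pw w n.+1 f = path_diff G.
  have [Sw|nSw] := boolP (S w); last by exists 0.
  (* A path longer than the degree has no trajectory, so 0 is a primitive. *)
  have [wn|wn] := leqP (plen w) n.+1.
    by have /(@coboundariesSP k (path_cochains D w))[G CG EG] := Bf w Sw wn; exists G.
  exists 0 => _; split; first exact: rpred0.
  by apply: funext => t; have := plen_traj t; rewrite leqNgt wn.
pose G w := projT1 (cid (exG w)).
have GP w : S w -> G w \in @path_coch k Q D w n /\ Pw w n.+1 f = path_diff (G w).
  exact: (projT2 (cid (exG w))).
have [|g [bg vg Eg]] := @Phi_onto n G; first by move=> w /GP[].
apply/(@coboundariesSP k barW); exists g; first exact/bar_predP.
apply/eqP; rewrite -subr_eq0; apply/eqP.
have bfg : is_bar e n.+1 (f - dbar n g).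
  by apply/bar_predP/submodB; apply/bar_predP => //; apply: dbar_bar.
apply: (ebar0 n.+1 _ bfg); apply: (Phi_inj (rbar_hoch bfg)) => [z z0|w Sw t x].
  rewrite -[LHS]/(rbar n.+1 f z - rbar n.+1 (dbar n g) z).
  by rewrite vf // (dbar_vanish bg vg) // subr0.
have := PhiP w n.+1 (-1) (dbar n g) f; rewrite !scaleN1r addrC => E.
transitivity (Pw w n.+1 (f - dbar n g) t x) => //.
by rewrite E -Phi_dbar // Eg // (GP w Sw).2 addNr.
Qed.

Section PathClasses.
Variables (n : nat) (J : Type) (wJ : J -> qpath Q).
Hypothesis wJ_inj : injective wJ.
Hypothesis wJ_S : forall j, S (wJ j).
Hypothesis wJ_onto : forall w, S w -> (plen w <= n)%N -> exists j, wJ j = w.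

Definition path_class (f : (nat -> L) -> W) : prodspace (fun j => Hpath D (wJ j) n) :=
  fun j => sqclass (@cocycles k (path_cochains D (wJ j)) n)
    (@coboundaries k (path_cochains D (wJ j)) n) (Pw (wJ j) n f).

Lemma path_classP c f g : f \in @cocycles k barW n -> g \in @cocycles k barW n ->
  path_class (c *: f + g) = c *: path_class f + path_class g.
Proof.
move=> Zf Zg; apply: functional_extensionality_dep => j.
by rewrite /path_class PhiP sqclassP //; apply: Phi_cocycle.
Qed.

Lemma path_class_bound f : f \in @cocycles k barW n -> f \in @coboundaries k barW n ->
  path_class f = 0.
Proof.
move=> Zf Bf; apply: functional_extensionality_dep => j.
by apply/sqclass_eq0; [apply: Phi_cocycle | apply: Phi_bound].
Qed.

Lemma path_class_inj f : f \in @cocycles k barW n -> vanish n (rbar n f) ->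
  path_class f = 0 -> f \in @coboundaries k barW n.
Proof.
move=> Zf vf f0; have /(@cocyclesP k barW)[/bar_predP bf _] := Zf.
apply: Phi_bound_inv => // w Sw wn; have [j Ej] := wJ_onto Sw wn; case: w / Ej Sw wn => Sw wn.
have := congr1 (fun y : prodspace _ => y j) f0.
by move/sqclass_eq0; apply; apply: Phi_cocycle.
Qed.

Lemma path_class_onto (y : prodspace (fun j => Hpath D (wJ j) n)) :
  exists f, [/\ f \in @cocycles k barW n, vanish n (rbar n f) & path_class f = y].
Proof.
pose Zp w := @cocycles k (path_cochains D w) n.
have repP j : exists2 c, c \in Zp (wJ j) & y j = sqclass _ _ c := sqclassW (y j).
pose rep j := projT1 (cid2 (repP j)).
have repZ j : rep j \in Zp (wJ j) by rewrite /rep; case: cid2.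
have repE j : y j = sqclass (Zp (wJ j)) _ (rep j) by rewrite {1}/rep; case: cid2.
(* [Phi_onto] expects a family indexed by paths, while the representatives are indexed by [J];
   injectivity of [wJ] makes the transported choice unambiguous. *)
have exF w : exists2 F, F \in Zp w & forall j (E : wJ j = w),
    F = eq_rect (wJ j) (fun w => traj w n -> ('I_n -> L) -> L) (rep j) w E.
  have [[j0 E0]|nj] := EM (exists j, wJ j = w).
    case: w / E0; exists (rep j0) => // j E.
    have Ej := wJ_inj E; move: E; rewrite Ej => E.
    by rewrite (Prop_irrelevance E erefl).
  by exists 0; [exact: rpred0 | move=> j E; case: nj; exists j].
pose F w := projT1 (cid2 (exF w)).
have FZ w : F w \in Zp w by rewrite /F; case: cid2.
have FE j : F (wJ j) = rep j.
  by rewrite /F; case: cid2 => G ZG /= /(_ j erefl).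
have FC w : F w \in @path_coch k Q D w n.
  by have /(@cocyclesP k (path_cochains D w))[] := FZ w.
have [f [bf vf Ef]] := Phi_onto (fun w (_ : S w) => FC w).
exists f; split=> //; last first.
  by apply: functional_extensionality_dep => j; rewrite /path_class Ef // FE repE.
apply/(@cocyclesP k barW); split; first exact/bar_predP.
have bdf := dbar_bar bf.
suff df0 z : rbar n.+1 (dbar n f) z = 0.
  rewrite -[LHS]/(dbar n f) -(ebarK bdf); apply: funext => x.
  by rewrite /ebar df0 lactm0 ract0m.
apply: (Phi_inj (rbar_hoch bdf) (dbar_vanish bf vf)) z => w Sw t x.
transitivity (path_diff (Pw w n f) t x); first by rewrite Phi_dbar.
rewrite Ef //; have /(@cocyclesP k (path_cochains D w))[_ E] := FZ w.
exact: (congr1 (fun G => G t x) E).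
Qed.

End PathClasses.

End Decomposition.

(** * The long exact sequence *)

Section Pullback.
Variables (k : fieldType) (L1 L2 : algType k) (V : Type) (e1 : V -> L1) (e2 : V -> L2).
Variables (th : L1 -> L2) (W1 : bimod L1 L1) (W2 : bimod L2 L2) (tau : W2 -> W1).
Hypothesis th_lin : linear th.
Hypothesis thM : forall x y, th (x * y) = th x * th y.
Hypothesis th_idem : forall v, th (e1 v) = e2 v.
Hypothesis tau_lin : linear tau.
Hypothesis tauL : forall b m, tau (th b *> m) = b *> tau m.
Hypothesis tauR : forall b m, tau (m <* th b) = tau m <* b.

(** Used along Lambda -> A and along the section A -> Lambda, to compare the bar complex of A with
    that of Lambda. *)
Definition pullback (f : (nat -> L2) -> W2) : (nat -> L1) -> W1 :=
  fun x => tau (f (fun j => th (x j))).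

Lemma th_upd x i u : (fun j => th (upd x i u j)) = upd (fun j => th (x j)) i (th u).
Proof. by apply: funext => j; rewrite /upd; case: ifP. Qed.

Lemma th_face x i : (fun j => th (face i x j)) = face i (fun j => th (x j)).
Proof. by apply: funext => j; rewrite /face; do 2 case: ifP => //. Qed.

Lemma pullback_bar n f : is_bar e2 n f -> is_bar e1 n (pullback f).
Proof.
move=> [[loc lin lac bal] rac]; rewrite /pullback; split; last first.
  by move=> x b; rewrite th_upd thM rac tauR.
split.
- by move=> x y E; congr tau; apply: loc => i ilt; rewrite E.
- by move=> i x ilt c u v; rewrite !th_upd th_lin lin // tau_lin.
- by move=> x b; rewrite th_upd thM lac tauL.
- by move=> x i v ilt; rewrite !th_upd !thM th_idem bal.
Qed.

Lemma dbar_pullback n f : dbar n (pullback f) = pullback (dbar n f).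
Proof.
apply: funext => x; rewrite /pullback /dbar; have [t tE] := linear_fun tau_lin.
rewrite -tE linear_sum; apply: eq_bigr => i _.
by rewrite th_face linearZ /= tE.
Qed.

Lemma pullback_cocycle n f : f \in @cocycles k (bar_cochains e2 W2) n ->
  pullback f \in @cocycles k (bar_cochains e1 W1) n.
Proof.
move=> /(@cocyclesP k (bar_cochains e2 W2))[/bar_predP bf df].
apply/(@cocyclesP k (bar_cochains e1 W1)); split; first exact/bar_predP/pullback_bar.
rewrite -[LHS]/(dbar n _) dbar_pullback.
have -> : dbar n f = 0 by exact: df.
by apply: funext => x; apply: (linear_eq0 tau_lin).
Qed.

Lemma pullback_bound n f : f \in @coboundaries k (bar_cochains e2 W2) n ->
  pullback f \in @coboundaries k (bar_cochains e1 W1) n.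
Proof.
case: n f => [|n] f.
  move/(@coboundaries0P k (bar_cochains e2 W2)) ->; apply/(@coboundaries0P k (bar_cochains e1 W1)).
  by apply: funext => x; apply: (linear_eq0 tau_lin).
move/(@coboundariesSP k (bar_cochains e2 W2)) => [g /bar_predP bg ->].
apply/(@coboundariesSP k (bar_cochains e1 W1)); exists (pullback g).
  exact/bar_predP/pullback_bar.
exact/esym/dbar_pullback.
Qed.
End Pullback.

Section CohomologyWithCoefficients.
Variables (k : fieldType) (Q : quiver) (D : qset k Q).
Hypothesis no_loop : forall a : arrow Q, src a <> tgt a.
Hypothesis comp0 : zero_compositions D.
Local Notation A := (prodA D).
Local Notation M := (sumM D).
Local Notation L := (Lambda D).
Local Notation e := (idemL D).
Local Notation WM := (infl comp0 M).
Local Notation WA := (infl comp0 (regular A)).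

Definition iotaM (m : M) : L := (0, m).
Definition rhoM (z : L) : M := z.2.
Definition SM (w : qpath Q) : bool := ~~ is_cycle w.

Lemma iotaM_lin : linear iotaM.
Proof. by move=> c x y; rewrite -[RHS]/(c *: 0 + 0, _) scaler0 addr0. Qed.
Lemma rhoM_lin : linear rhoM. Proof. by []. Qed.
Lemma iotaML (a : L) (m : M) : a.2 = 0 :> M -> iotaM (a.1 *> m) = a * iotaM m.
Proof. by move=> _; rewrite (LambdaMr comp0). Qed.
Lemma iotaMR (a : L) (m : M) : a.2 = 0 :> M -> iotaM (m <* a.1) = iotaM m * a.
Proof. by move=> _; rewrite (LambdaMl comp0). Qed.
Lemma iotaMK : cancel iotaM rhoM. Proof. by []. Qed.
Lemma rhoML v (z : L) : rhoM (e v * z) = (e v).1 *> rhoM z.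
Proof.
apply: functional_extensionality_dep => a.
by rewrite -[LHS]/((e v * z).2 a) (LambdaM2 comp0) idem2 ract0m addr0.
Qed.
Lemma rhoMR v (z : L) : rhoM (z * e v) = rhoM z <* (e v).1.
Proof.
apply: functional_extensionality_dep => a.
by rewrite -[LHS]/((z * e v).2 a) (LambdaM2 comp0) idem2 lactm0 add0r.
Qed.
Lemma SM_pos w : SM w -> (0 < plen w)%N.
Proof. by rewrite /SM /is_cycle /ptgt /plen; case: (parrows w) => //=; rewrite eqxx. Qed.

Lemma idem_corner1 (z : L) v u y : (e v * z * e u).1 y = if (y == v) && (y == u) then z.1 y else 0.
Proof.
rewrite !(LambdaM1 comp0) !idem1; case: (y == v); rewrite ?mul1r ?mul0r //=.
by case: (y == u); rewrite ?mulr1 ?mulr0.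
Qed.

Lemma idem_corner2 (z : L) v u a :
  (e v * z * e u).2 a = if (tgt a == v) && (src a == u) then z.2 a else 0.
Proof.
rewrite !(LambdaM2 comp0) !idem2 !idem1 lactm0 add0r ract0m addr0.
case: (tgt a == v); rewrite ?lact1 ?lact0m ?ract0m //=.
by case: (src a == u); rewrite ?ract1 ?ractm0.
Qed.

Lemma SM_val w z : SM w -> e (ptgt w) * z * e (psrc w) = z -> iotaM (rhoM z) = z.
Proof.
move=> Sw E; rewrite [RHS]surjective_pairing; congr pair.
apply: functional_extensionality_dep => y; rewrite -{1}E idem_corner1.
case: ifP => // /andP[/eqP -> /eqP Ew]; move: Sw; rewrite /SM /is_cycle.
by rewrite -Ew eqxx.
Qed.

Lemma no_loop_corner (z : M) v : (e v).1 *> z <* (e v).1 = 0.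
Proof.
apply: functional_extensionality_dep => a.
rewrite -[LHS]/((e v).1 (tgt a) *> z a <* (e v).1 (src a)) !idem1.
case: eqP => [tv|_]; last by rewrite lact0m ract0m.
case: eqP => [sv|_]; last by rewrite ractm0.
by case: (no_loop (a := a)); rewrite sv tv.
Qed.

Lemma SM_not w (m : M) : ~~ SM w -> (0 < plen w)%N -> (e (ptgt w)).1 *> m <* (e (psrc w)).1 = 0.
Proof. by rewrite /SM negbK /is_cycle => /eqP <- _; apply: no_loop_corner. Qed.

Definition iotaA (a : regular A) : L := (a, 0).
Definition rhoA (z : L) : regular A := z.1.
Definition SA (w : qpath Q) : bool := (0 < plen w)%N && is_cycle w.

Lemma iotaA_lin : linear iotaA.
Proof. by move=> c x y; rewrite -[RHS]/(_, c *: 0 + 0) scaler0 addr0. Qed.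
Lemma rhoA_lin : linear rhoA. Proof. by []. Qed.
Lemma iotaAL (a : L) (m : regular A) : a.2 = 0 :> M -> iotaA (a.1 *> m) = a * iotaA m.
Proof. by move=> a0; rewrite (LambdaAA comp0). Qed.
Lemma iotaAR (a : L) (m : regular A) : a.2 = 0 :> M -> iotaA (m <* a.1) = iotaA m * a.
Proof. by move=> a0; rewrite (LambdaAA comp0). Qed.
Lemma iotaAK : cancel iotaA rhoA. Proof. by []. Qed.
Lemma rhoAL v (z : L) : rhoA (e v * z) = (e v).1 *> (rhoA z : regular A).
Proof. by rewrite /rhoA (LambdaM comp0). Qed.
Lemma rhoAR v (z : L) : rhoA (z * e v) = (rhoA z : regular A) <* (e v).1.
Proof. by rewrite /rhoA (LambdaM comp0). Qed.
Lemma SA_pos w : SA w -> (0 < plen w)%N. Proof. by case/andP. Qed.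

Lemma SA_val w z : SA w -> e (ptgt w) * z * e (psrc w) = z -> iotaA (rhoA z) = z.
Proof.
move=> /andP[_ /eqP cw] E; rewrite [RHS]surjective_pairing; congr pair.
apply: functional_extensionality_dep => a; rewrite -{1}E idem_corner2 -cw.
by case: ifP => // /andP[/eqP ta /eqP sa]; case: (no_loop (a := a)); rewrite ta sa.
Qed.

Lemma SA_not w (m : regular A) : ~~ SA w -> (0 < plen w)%N ->
  (e (ptgt w)).1 *> m <* (e (psrc w)).1 = 0.
Proof.
rewrite /SA => + w_gt0; rewrite w_gt0 /= => cw; apply: functional_extensionality_dep => y.
rewrite -[LHS]/((e (ptgt w)).1 y * m y * (e (psrc w)).1 y) !idem1.
case: eqP => [yt|_]; last by rewrite !mul0r.
case: eqP => [ys|_]; last by rewrite mulr0.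
by case/negP: cw; rewrite /is_cycle -yt -ys.
Qed.

(* On arguments in [A], which commute with the [e v], the idempotents can be moved
   from one end to the other; and [e v M e v = 0] as there are no loops. *)
Lemma vanishM n (h : (nat -> L) -> WM) : is_hoch e n h -> vanish n h.
Proof.
move=> hh z z0.
have comm : forall v, (e v).1 *> (h z : M) = (h z : M) <* (e v).1.
  move=> v; have [n0|n_gt0] := posnP n; first exact: (hoch0 hh).
  have H i : (i < n)%N -> h (upd z i (e v * z i)) = e v *> h z.
    elim: i => [|i IH] ilt; first exact: (hoch_left hh).
    rewrite -(hoch_bal hh) // -IH ?(ltnW ilt) //; congr (h (upd z i _)).
    apply: Lambda_eq => u; last by rewrite !(LambdaM2 comp0) !idem2 z0 ?(ltnW ilt) // !lactm0 !ract0m.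
    rewrite !(LambdaM1 comp0) !idem1; case: ifP; by rewrite ?mul1r ?mulr1 ?mul0r ?mulr0.
  have nn : (n.-1 < n)%N by rewrite ltn_predL.
  rewrite -[LHS]/(e v *> h z) -(H _ nn) -[RHS]/(h z <* e v) -(hoch_right hh) //.
  congr (h (upd z _ _)).
  apply: Lambda_eq => u; last by rewrite !(LambdaM2 comp0) !idem2 z0 // !lactm0 !ract0m.
  rewrite !(LambdaM1 comp0) !idem1; case: ifP; by rewrite ?mul1r ?mulr1 ?mul0r ?mulr0.
apply: functional_extensionality_dep => a.
have := congr1 (fun m : M => m a) (comm (tgt a)).
rewrite -[LHS]/((e (tgt a)).1 (tgt a) *> (h z : M) a).
rewrite -[RHS]/((h z : M) a <* (e (tgt a)).1 (src a)) !idem1 eqxx lact1.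
by case: eqP => [/no_loop //|_]; rewrite ractm0.
Qed.

Local Notation barL := (bar_cochains e (regular L)).
Local Notation barM := (bar_cochains e WM).
Local Notation barA := (bar_cochains e WA).
Local Notation barAA := (bar_cochains (idemA D) (regular A)).

Lemma path_classM_iso n : liso (cohomology barM n) (HDQ D n).
Proof.
pose pc := @path_class k Q D comp0 M iotaM n (DQle Q n) val.
have pcS (j : DQle Q n) : SM (val j) by case: j => w /= /andP[].
have pcO w : SM w -> (plen w <= n)%N -> exists j : DQle Q n, val j = w.
  move=> Sw wn; have H : (plen w <= n)%N && ~~ is_cycle w by rewrite wn.
  by exists (exist _ w H).
have pcI : injective (val : DQle Q n -> qpath Q) by exact: val_inj.
apply: (sq_reliso (R := fun f y => f \in @cocycles k barM n /\ y = pc f)).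
- move=> c f g y y' [Zf ->] [Zg ->]; split; first exact: (submodP c Zf Zg).
  by rewrite -(path_classP iotaM_lin iotaML iotaMR SM_pos pcS c Zf Zg).
- by move=> f Zf; exists (pc f).
- move=> f y Zf [_ ->] Bf.
  exact: (path_class_bound iotaM_lin iotaML iotaMR SM_pos pcS Zf Bf).
- move=> f Zf [_ /esym f0]; have /(@cocyclesP k barM)[/bar_predP bf _] := Zf.
  apply: (path_class_inj iotaM_lin rhoM_lin iotaML iotaMR iotaMK rhoML rhoMR SM_pos SM_val SM_not pcO Zf _ f0).
  exact/vanishM/rbar_hoch.
- move=> y; have [f [Zf _ <-]] := path_class_onto comp0 iotaM_lin rhoM_lin iotaML iotaMR iotaMK
    rhoML rhoMR SM_pos SM_val SM_not pcI pcS y.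
  by exists f.
Qed.
Lemma bar_eq0 (X : bimod A A) n (f : (nat -> L) -> infl comp0 X) :
  is_bar e n f -> (forall z, rbar n f z = 0) -> f = 0.
Proof.
move=> bf f0; rewrite -(ebarK bf); apply: funext => x.
by rewrite /ebar f0 lactm0 ract0m.
Qed.

(** In degree 0 [vanish] puts no condition on the arguments, so [vanishM] says that the cochain is
    zero. *)
Lemma barM0 (f : (nat -> L) -> WM) : is_bar e 0 f -> f = 0.
Proof. by move=> bf; apply: (bar_eq0 bf) => z; apply: (vanishM (rbar_hoch bf)). Qed.

(* A 1-cocycle with values in M is a derivation of [A (+) M] which vanishes on A. *)
Lemma derivations_iso : liso (cohomology barM 1) (biHom M M).
Proof.
pose h1 (f : (nat -> L) -> WM) (x : L) : M := rbar 1 f (fun=> x).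
have h1E f y : is_bar e 1 f -> rbar 1 f y = h1 f (y 0%N).
  by move=> bf; apply: (hoch_loc (rbar_hoch bf)) => -[|i].
have h1A f a : is_bar e 1 f -> h1 f (a, 0) = 0.
  by move=> bf; apply: (vanishM (rbar_hoch bf)).
have dE f y : is_bar e 1 f -> rbar 2 (dbar 1 f) y =
    (y 0%N).1 *> h1 f (y 1%N) - h1 f (y 0%N * y 1%N) + h1 f (y 0%N) <* (y 1%N).1.
  move=> bf; rewrite (rbar_dbar _ bf) big_ord_recl big_ord0 addr0 expr1 scaleN1r.
  by rewrite expr2 mulrNN mulr1 scale1r !h1E.
have h1lin f : is_bar e 1 f -> linear (h1 f).
  move=> bf c x y; have := hoch_lin (rbar_hoch bf) (fun=> 0) (ltn0Sn 0) c x y.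
  by rewrite !h1E // !upd_eq.
pose R (f : (nat -> L) -> WM) (u : biHom M M) :=
  f \in @cocycles k barM 1 /\ forall m, val u m = h1 f (0, m).
apply: (sq_reliso (R := R)).
- move=> c f g u v [Zf Ef] [Zg Eg]; split; first exact: (submodP c Zf Zg).
  by move=> m; rewrite linearP -[LHS]/(c *: val u m + val v m) Ef Eg.
- move=> f Zf; have /(@cocyclesP k barM)[/bar_predP bf df] := Zf.
  have der x y : h1 f (x * y) = x.1 *> h1 f y + h1 f x <* y.1.
    pose z i := if i is 0 then x else y.
    have : rbar 2 (dbar 1 f) z = 0 by rewrite (_ : dbar 1 f = 0) //; exact: df.
    rewrite dE // addrAC => /eqP; rewrite subr_eq0 => /eqP E; exact: esym E.
  have Cu : (fun m : M => h1 f (0, m)) \in bihoms (X := M) (Y := M).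
    apply/bihomsP; split=> [c m p|a m|m a].
    - have := h1lin f bf c ((0, m) : L) (0, p).
      by rewrite -[(c *: ((0, m) : L) + (0, p))]/(c *: 0 + 0, c *: m + p) scaler0 addr0.
    - have := der (a, 0) (0, m).
      by rewrite (LambdaMr comp0) h1A // ract0m addr0.
    - have := der (0, m) (a, 0).
      by rewrite (LambdaMl comp0) h1A // lactm0 add0r.
  by exists (Subspace Cu).
(* By [barM0] the only coboundary in degree 1 is 0: there are no nonzero inner derivations into
   M. *)
- move=> f u Zf [_ Eu] /(@coboundariesSP k barM)[g /bar_predP/barM0 -> f0].
  apply: val_inj; apply: funext => m; rewrite Eu f0.
  rewrite /h1 /rbar -[cdiff _ _ _]/(dbar 0 (0 : (nat -> L) -> WM)) linear0.
  by rewrite [in RHS]linear0.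
- move=> f Zf [_ E0]; have /(@cocyclesP k barM)[/bar_predP bf _] := Zf.
  have -> : f = 0; last exact: rpred0.
  apply: (bar_eq0 bf) => z; rewrite h1E //; case: (z 0%N) => a m.
  have := h1lin f bf 1 ((a, 0) : L) (0, m).
  rewrite h1A // -E0 linear0 !scale1r -[(_ + _ : L)]/(a + 0, 0 + m) addr0 add0r => ->.
  by rewrite add0r.
- move=> u; have /bihomsP[lu ul ur] := valP u.
  (* The derivation that extends an endomorphism of M by zero on A. *)
  pose h (y : nat -> L) : WM := val u (y 0%N).2.
  have hh : is_hoch e 1 h.
    split=> //.
    - by move=> x y E; rewrite /h E.
    - by move=> [|i] x ilt c a b //; rewrite /h !upd_eq; apply: lu.
    - by move=> x v _; rewrite /h upd_eq -[_.2]/(rhoM (e v * x 0%N)) rhoML ul.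
    - by move=> x v _; rewrite /h upd_eq -[_.2]/(rhoM (x 0%N * e v)) rhoMR ur.
  have bf := ebar_bar hh.
  have h1h x : h1 (ebar 1 h) x = val u x.2 by rewrite /h1 (rebarK hh).
  have Zf : ebar 1 h \in @cocycles k barM 1.
    apply/(@cocyclesP k barM); split; first exact/bar_predP.
    apply: (bar_eq0 (dbar_bar bf)) => z; rewrite dE // !h1h (LambdaM comp0) /=.
    have uD a b : val u (a + b) = val u a + val u b by have := lu 1 a b; rewrite !scale1r.
    by rewrite uD ul ur addrAC subrr.
  by exists (ebar 1 h) => //; split=> // m; rewrite h1h.
Qed.

Definition inflate : ((nat -> A) -> regular A) -> (nat -> L) -> WA :=
  @pullback k L A (fun x : L => x.1) WA (regular A) id.
Definition restrict : ((nat -> L) -> WA) -> (nat -> A) -> regular A :=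
  @pullback k A L iotaA (regular A) WA id.

Let fstM (x y : L) : (x * y).1 = x.1 * y.1. Proof. by rewrite (LambdaM comp0). Qed.
Let iotaAM (x y : A) : iotaA (x * y) = iotaA x * iotaA y. Proof. by rewrite (LambdaAA comp0). Qed.

Lemma restrict_vanish n (f : (nat -> L) -> WA) : restrict f = 0 -> vanish n (rbar n f).
Proof.
move=> f0 z z0; have E := congr1 (fun F => F (fun j => (bord n z j).1)) f0.
transitivity (restrict f (fun j => (bord n z j).1)); last exact: E.
rewrite /rbar /restrict /pullback; congr f; apply: funext => -[|j] //=.
by case: ifP => // jn; rewrite [LHS]surjective_pairing z0.
Qed.

(** A trajectory of positive length has an argument in M, which the projection to A sends to 0. *)
Lemma Phi_inflate n (g : (nat -> A) -> regular A) w : is_bar (idemA D) n g -> SA w ->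
  @Phi k Q D comp0 (regular A) iotaA w n (rbar n (inflate g)) = 0.
Proof.
move=> bg Sw.
have hh : is_hoch e n (rbar n (inflate g)).
  by apply: rbar_hoch; apply: pullback_bar bg => // x y; apply: fstM.
apply: funext => t; apply: funext => x; rewrite (PhiE _ t x hh).
have [i ilt ai] := traj_has_arrow (inl (psrc w)) t (SA_pos Sw).
set z := pw _ _ _.
have -> : rbar n (inflate g) z = rbar n (inflate g) (upd z i 0).
  rewrite /rbar /inflate /pullback; congr g; apply: funext => -[|j] //=; case: ifP => // jn.
  rewrite /upd; case: eqP => // ->; rewrite /z /pw.
  by case: (nth _ _ _) ai.
by rewrite (hoch_eq0 hh ilt) ?upd_eq.
Qed.

(** [restrict] after [inflate] is the identity, so subtracting [inflate (restrict f)] from [f]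
    leaves a cochain vanishing on A, which its components along the cycles of positive length
    determine. Inflated cochains have no such components, so the two parts do not interfere. *)
Lemma cycle_iso n : liso (cohomology barA n) (cohomology barAA n * HCQ D n)%type.
Proof.
pose pc := @path_class k Q D comp0 (regular A) iotaA n (CQle_pos Q n) val.
have pcS (j : CQle_pos Q n) : SA (val j).
  by case: j => w /= /and3P[w_gt0 _ cw]; rewrite /SA w_gt0.
have pcO w : SA w -> (plen w <= n)%N -> exists j : CQle_pos Q n, val j = w.
  move=> /andP[w_gt0 cw] wn.
  have H : [&& (0 < plen w)%N, (plen w <= n)%N & is_cycle w] by rewrite w_gt0 wn.
  by exists (exist _ w H).
have pcI : injective (val : CQle_pos Q n -> qpath Q) by exact: val_inj.
pose cA (g : (nat -> A) -> regular A) : cohomology barAA n :=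
  sqclass (@cocycles k barAA n) (@coboundaries k barAA n) g.
have resZ (f : (nat -> L) -> WA) : f \in @cocycles k barA n -> restrict f \in @cocycles k barAA n.
  by apply: pullback_cocycle => //; exact: iotaA_lin.
have infZ (g : (nat -> A) -> regular A) : g \in @cocycles k barAA n -> inflate g \in @cocycles k barA n.
  by apply: pullback_cocycle => //; exact: fstM.
have infB m (g : (nat -> A) -> regular A) : g \in @coboundaries k barAA m -> inflate g \in @coboundaries k barA m.
  by apply: pullback_bound => //; exact: fstM.
have pc_inf (g : (nat -> A) -> regular A) : g \in @cocycles k barAA n -> pc (inflate g) = 0.
  move=> /(@cocyclesP k barAA)[/bar_predP bg _]; apply: functional_extensionality_dep => j.
  by rewrite /pc /path_class Phi_inflate // sqclass0.
have pcD f g : f \in @cocycles k barA n -> g \in @cocycles k barA n -> pc (f + g) = pc f + pc g.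
  move=> Zf Zg; have := path_classP iotaA_lin iotaAL iotaAR SA_pos pcS 1 Zf Zg.
  by rewrite !scale1r.
pose R (f : (nat -> L) -> WA) (u : cohomology barAA n * HCQ D n) :=
  f \in @cocycles k barA n /\ u = (cA (restrict f), pc f).
apply: (sq_reliso (R := R)).
- move=> c f g u v [Zf ->] [Zg ->]; split; first exact: (submodP c Zf Zg).
  rewrite -[LHS]/(c *: cA (restrict f) + cA (restrict g), c *: pc f + pc g); congr pair.
    exact: esym (sqclassP _ c (resZ _ Zf) (resZ _ Zg)).
  exact: esym (path_classP iotaA_lin iotaAL iotaAR SA_pos pcS c Zf Zg).
- by move=> f Zf; exists (cA (restrict f), pc f).
- move=> f u Zf [_ ->] Bf; congr pair.
    apply/sqclass_eq0; first exact: resZ.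
    by move: Bf; apply: pullback_bound => //; exact: iotaA_lin.
  exact: (path_class_bound iotaA_lin iotaAL iotaAR SA_pos pcS Zf Bf).
- move=> f Zf [_ [/esym q0 /esym f0]].
  have Br : restrict f \in @coboundaries k barAA n by exact: proj1 (sqclass_eq0 _ (resZ _ Zf)) q0.
  have Zi := infZ _ (resZ _ Zf).
  suff : f - inflate (restrict f) \in @coboundaries k barA n.
    move=> B; rewrite -[f](subrK (inflate (restrict f))).
    exact: (rpredD B (infB _ _ Br)).
  have Zd : f - inflate (restrict f) \in @cocycles k barA n := submodB Zf Zi.
  apply: (path_class_inj iotaA_lin rhoA_lin iotaAL iotaAR iotaAK rhoAL rhoAR SA_pos SA_val SA_not pcO Zd).
    by apply: restrict_vanish; apply: funext => x; apply: subrr.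
  have E := pcD _ _ Zd Zi; rewrite subrK (pc_inf _ (resZ _ Zf)) in E.
  exact: etrans (etrans (esym (addr0 _)) (esym E)) f0.
- move=> [q y]; have [g Zg ->] := sqclassW q.
  have [f [Zf vf <-]] := path_class_onto comp0 iotaA_lin rhoA_lin iotaAL iotaAR iotaAK
    rhoAL rhoAR SA_pos SA_val SA_not pcI pcS y.
  exists (inflate g + f); first exact: (rpredD (infZ _ Zg) Zf).
  split; first exact: (rpredD (infZ _ Zg) Zf).
  rewrite pcD ?infZ // pc_inf // add0r; congr pair; congr (sqclass _ _ _).
  apply: funext => x; rewrite -[RHS]/(g x + f (fun j => iotaA (x j))).
  suff -> : f (fun j => iotaA (x j)) = 0 by rewrite addr0.
  have /(@cocyclesP k barA)[/bar_predP bf _] := Zf.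
  by rewrite -(ebarK bf) /ebar vf // lactm0 ract0m.
Qed.

End CohomologyWithCoefficients.

Theorem theorem4p18 (k : fieldType) (Q : quiver) (D : qset k Q)
    (Qlaced : simply_laced Q) (comp0 : zero_compositions D)
    (PL : proj_resolution (regular (Lambda D)))
    (PA : proj_resolution (regular (prodA D))) :
  exists (f : forall n, {linear HH PL n -> les_cycle PA n})
         (g : forall n, {linear les_cycle PA n -> les_noncycle D n})
         (h : forall n, {linear les_noncycle D n -> HH PL n.+1}),
    [/\ injective (f 0%N),
        forall n, exact (f n) (g n),
        forall n, exact (g n) (h n)
      & forall n, exact (h n) (f n.+1)].
Proof.
have no_loop := proj1 Qlaced.
have [f [g [h [hf fg gh]]]] := coefficient_sequence comp0.
have isoL n := ext_bar (idemL_orth comp0) (idemL_sum D) PL (regular (Lambda D)) n.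
have isoC n : liso (les_cycle PA n) (cohomology (bar_cochains (idemL D) (infl comp0 (regular (prodA D)))) n).
  have isoA := ext_bar (idemA_orth D) (idemA_sum D) PA (regular (prodA D)) n.
  have H : liso (HH PA n * HCQ D n)%type (cohomology (bar_cochains (idemL D) (infl comp0 (regular (prodA D)))) n).
    by apply: liso_sym; apply: liso_trans (cycle_iso no_loop comp0 n) _;
      apply/liso_prod/liso_refl/liso_sym.
  (* In degrees 0 and 1 the product over cycles is zero: a cycle of length 1 would be a loop. *)
  case: n isoA H => [|[|n]] isoA H //; apply: liso_trans H; apply/liso_sym/liso_prod0 => y;
    apply: functional_extensionality_dep => -[w /= H]; exfalso.
    by case/and3P: H => w_gt0; rewrite leqNgt w_gt0.
  case/and3P: H => + + /eqP; rewrite /plen /ptgt.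
  by case: w => x [|a [|b p]] //= /andP[/eqP <- _] _ _ /no_loop.
have isoN n : liso (les_noncycle D n) (cohomology (bar_cochains (idemL D) (infl comp0 (sumM D))) n.+1).
  apply: liso_sym; case: n => [|n]; first exact: derivations_iso.
  exact: path_classM_iso.
pose a n := projT1 (cid (isoL n)); pose a' n := projT1 (cid (projT2 (cid (isoL n)))).
have aK n : cancel (a n) (a' n) := proj1 (projT2 (cid (projT2 (cid (isoL n))))).
have a'K n : cancel (a' n) (a n) := proj2 (projT2 (cid (projT2 (cid (isoL n))))).
pose b n := projT1 (cid (isoC n)); pose b' n := projT1 (cid (projT2 (cid (isoC n)))).
have bK n : cancel (b n) (b' n) := proj1 (projT2 (cid (projT2 (cid (isoC n))))).
have b'K n : cancel (b' n) (b n) := proj2 (projT2 (cid (projT2 (cid (isoC n))))).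
pose c n := projT1 (cid (isoN n)); pose c' n := projT1 (cid (projT2 (cid (isoN n)))).
have cK n : cancel (c n) (c' n) := proj1 (projT2 (cid (projT2 (cid (isoN n))))).
have c'K n : cancel (c' n) (c n) := proj2 (projT2 (cid (projT2 (cid (isoN n))))).
exists (fun n => b' n \o f n \o a n : {linear _ -> _}).
exists (fun n => c' n \o g n \o b n : {linear _ -> _}).
exists (fun n => a' n.+1 \o h n.+1 \o c n : {linear _ -> _}).
split=> [x y /= xy|n|n|n].
- have E := can_inj (b'K 0%N) xy; apply: (can_inj (aK 0%N)); apply/eqP; rewrite -subr_eq0; apply/eqP.
  (* The kernel of the first map is the image of the M-valued cohomology of degree 0, which is zero
     by [barM0]. *)
  have : f 0%N (a 0%N x - a 0%N y) = 0 by rewrite linearB E subrr.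
  move/(hf 0%N) => [m <-]; have [z Zz ->] := sqclassW m.
  have /(@cocyclesP _ (bar_cochains (idemL D) (infl comp0 (sumM D))))[/bar_predP bz _] := Zz.
  by rewrite (barM0 no_loop bz) sqclass0 linear0.
- exact: exact_conj (a'K n) (b'K n) (bK n) (can_inj (c'K n)) (fg n).
- exact: exact_conj (b'K n) (c'K n) (cK n) (can_inj (a'K n.+1)) (gh n).
- exact: exact_conj (c'K n) (a'K n.+1) (aK n.+1) (can_inj (b'K n.+1)) (hf n.+1).
Qed.
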